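(* For $r\geq1$ let $\Gamma_1^p(\mathfrak{n},\wp^r)$ denote $\Gamma_1^\Theta(\mathfrak{n},\wp^r)$ with $\Theta=1+\wp A_r$. For any integer $k\geq 2$ and any character $\chi:\kappa(\wp)^\times\to\kappa(\wp)^\times$, the dimensions $d(\Gamma_1^p(\mathfrak{n},\wp^r),k,0)$ and $d(\Gamma_1^p(\mathfrak{n},\wp^r),k,\chi,0)$ are independent of $r\geq 1$.
   Context: Let $p$ be a prime, $q>1$ a power of $p$, $A=\mathbb{F}_q[t]$, $K=\mathbb{F}_q(t)$. Let $\wp\in A$ be an irreducible polynomial of positive degree, $\kappa(\wp)=A/(\wp)$, $\mathfrak{n}\in A$ non-zero and prime to $\wp$, $A_r=A/(\wp^r)$. $K_\wp$ is the $\wp$-adic completion of $K$, $\mathbb{C}_\wp$ the completion of an algebraic closure of $K_\wp$, $v_\wp$ the valuation with $v_\wp(\wp)=1$. $K_\infty$ is the $(1/t)$-adic completion of $K$, $\mathbb{C}_\infty$ the completion of an algebraic closure of it, $\bar K$ the algebraic closure of $K$ in $\mathbb{C}_\infty$, $\iota_\wp:\bar K\to\mathbb{C}_\wp$ a fixed $K$-embedding, $\Omega=\mathbb{P}^1(\mathbb{C}_\infty)\setminus\mathbb{P}^1(K_\infty)$. For a subgroup $\Theta\subseteq1+\wp A_r$ put $\Gamma_1(\mathfrak{n})=\{\gamma\in \mathrm{SL}_2(A): \gamma\equiv\begin{pmatrix}1&*\\0&1\end{pmatrix}\bmod \mathfrak{n}\}$, $\Gamma_0^\Theta(\wp^r)=\{\gamma\in\mathrm{SL}_2(A):\gamma\bmod\wp^r\in\begin{pmatrix}\Theta&*\\0&\Theta\end{pmatrix}\}$,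 $\Gamma_1^\Theta(\mathfrak{n},\wp^r)=\Gamma_1(\mathfrak{n})\cap\Gamma_0^\Theta(\wp^r)$. Let $\Gamma=\Gamma_1^\Theta(\mathfrak{n},\wp^r)$. For $\gamma=\begin{pmatrix}a&b\\c&d\end{pmatrix}\in\mathrm{GL}_2(K)$ put $(f|_k\gamma)(z)=\det(\gamma)^{k-1}(cz+d)^{-k}f\left(\frac{az+b}{cz+d}\right)$. $S_k(\Gamma)$ is the $\mathbb{C}_\infty$-space of Drinfeld cuspforms of weight $k$ and level $\Gamma$: rigid analytic functions $f$ on $\Omega$ with $f|_k\gamma=f$ for $\gamma\in\Gamma$, holomorphic and vanishing at all cusps. The Hecke operator $U=T_\wp$ is $Uf=\sum_i f|_k\xi_i$, where $\Gamma\begin{pmatrix}1&0\\0&\wp\end{pmatrix}\Gamma=\coprod_i\Gamma\xi_i$; its eigenvalues $\lambda$ lie in $\bar K$, and the slope of $\lambda$ is $v_\wp(\iota_\wp(\lambda))$. $d(\Gamma,k,a)$ is the total dimension of the generalized $U$-eigenspaces in $S_k(\Gamma)$ for eigenvalues of slope $a$. Let $[-]:\kappa(\wp)\to\mathcal{O}_{K_\wp}$ be the canonical ring-homomorphic section of reduction; its image lies in $\iota_\wp(\bar K)$, making $\bar K$ (hence $\mathbb{C}_\infty$) a $\kappa(\wp)$-algebra. For $\lambda\in\kappa(\wp)^\times$ choose $\eta_\lambda\in\mathrm{SL}_2(A)$ with $\eta_\lambda\equiv I\bmod\mathfrak{n}$, $\eta_\lambda\equiv\begin{pmatrix}[\lambda]^{-1}&0\\0&[\lambda]\end{pmatrix}\bmod\wp^r$;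 then $\langle\lambda\rangle_{\wp^r}f=f|_k\eta_\lambda$ is a well-defined action of $\kappa(\wp)^\times$ on $S_k(\Gamma)$ commuting with $U$. $S_k(\Gamma)(\chi)$ is the subspace where each $\langle\lambda\rangle_{\wp^r}$ acts by $\chi(\lambda)$, and $d(\Gamma,k,\chi,a)$ is the total dimension of the generalized $U$-eigenspaces of slope $a$ in $S_k(\Gamma)(\chi)$. *)

(* Defs.v *)
From HB Require Import structures.
From mathcomp Require Import all_boot all_order all_algebra all_fingroup.
From mathcomp Require Import boolp classical_sets reals constructive_ereal.

Set Implicit Arguments.
Unset Strict Implicit.
Unset Printing Implicit Defensive.

Import Order.TTheory GRing.Theory Num.Theory.

Local Open Scope classical_set_scope.
Local Open Scope ring_scope.

Local Notation "x %:F" := (@FracField.tofrac _ x) : ring_scope.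

Section ValuedFields.
Context {R : realType} {C : fieldType}.
Implicit Types (v : C -> \bar R) (S : set C).

Definition is_valuation v : Prop :=
  [/\ forall x, v x = +oo%E <-> x = 0,
      forall x, x != 0 -> v x \is a fin_num,
      forall x y, v (x * y) = (v x + v y)%E &
      forall x y, (Order.min (v x) (v y) <= v (x + y)%R)%E].

Definition vcvg v (u : nat -> C) (l : C) : Prop :=
  forall M : R, exists N, forall n, (N <= n)%N -> (M%:E < v (u n - l)%R)%E.

Definition vcauchy v (u : nat -> C) : Prop :=
  forall M : R, exists N, forall m n, (N <= m)%N -> (N <= n)%N ->
    (M%:E < v (u m - u n)%R)%E.

Definition vcomplete v : Prop :=
  forall u, vcauchy v u -> exists l, vcvg v u l.

Definition vlim v (u : nat -> C) : C := xget 0 [set l | vcvg v u l].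

Definition vclosure v S : set C :=
  [set x | forall M : R, exists2 y, S y & (M%:E < v (x - y)%R)%E].

Definition poly_over S : set {poly C} := [set f | forall i, S f`_i].

Definition algebraic_over S : set C :=
  [set x | exists f : {poly C}, [/\ poly_over S f, f != 0 & root f x]].

(* (C, v) is the completion of an algebraic closure of the completion of the
   subfield S: the completion S^ of S is realised as the closure of S in C, the
   algebraic closure of S^ as the set of elements of C algebraic over S^. *)
Definition completed_algebraic_closure v S : Prop :=
  [/\ is_valuation v,
      vcomplete v,
      forall f : {poly C}, poly_over (vclosure v S) f -> (1 < size f)%N ->
        exists x, root f x &
      vclosure v (algebraic_over (vclosure v S)) = setT].

End ValuedFields.

Section DegreeValuation.
Context {R : realType} {F : finFieldType} {C : fieldType}.

(* the valuation of F_q(t) at 1/t, normalised by v(1/t) = 1 *)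
Definition extends_infty_valuation
    (emb : {fraction {poly F}} -> C) (v : C -> \bar R) : Prop :=
  forall a : {poly F}, a != 0 -> v (emb a%:F) = (- ((size a).-1)%:R)%:E.

Definition extends_adic_valuation (wp : {poly F})
    (emb : {fraction {poly F}} -> C) (v : C -> \bar R) : Prop :=
  v (emb wp%:F) = 1%E /\
  forall a : {poly F}, ~~ (wp %| a) -> v (emb a%:F) = 0%E.

End DegreeValuation.

Definition mat2 (T : Type) (a b c d : T) : 'M[T]_2 :=
  \matrix_(i < 2, j < 2)
    if i == 0 then (if j == 0 then a else b) else (if j == 0 then c else d).

Section CongruenceSubgroups.
Context {F : finFieldType}.
Implicit Types (n wp : {poly F}) (r : nat) (Theta : set {poly F}).

Definition SL2 : set 'M[{poly F}]_2 := [set g | \det g = 1].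

Definition Gamma1 n : set 'M[{poly F}]_2 :=
  [set g | [/\ SL2 g, n %| g 0 0 - 1, n %| g 1 0 & n %| g 1 1 - 1]].

(* Elements of A_r = A/(wp^r) are represented by their remainders modulo wp^r,
   so Theta is a set of such remainders. *)
Definition Gamma0Theta wp r Theta : set 'M[{poly F}]_2 :=
  [set g | [/\ SL2 g, Theta (g 0 0 %% wp ^+ r), wp ^+ r %| g 1 0 &
               Theta (g 1 1 %% wp ^+ r)]].

Definition Gamma1Theta n wp r Theta : set 'M[{poly F}]_2 :=
  Gamma1 n `&` Gamma0Theta wp r Theta.

(* 1 + wp A_r *)
Definition one_units wp r : set {poly F} :=
  [set (1 + wp * x) %% wp ^+ r | x in [set: {poly F}]].

Definition Gamma1p n wp r : set 'M[{poly F}]_2 :=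
  Gamma1Theta n wp r (one_units wp r).

End CongruenceSubgroups.

Section Cuspforms.
Context {R : realType} {F : finFieldType} {C : fieldType}.
Variables (emb : {fraction {poly F}} -> C) (v : C -> \bar R).

Local Notation A := {poly F}.
Local Notation K := {fraction {poly F}}.

Definition Kinfty : set C := vclosure v (range emb).

(* P^1(C) minus P^1(K_infty), which does not contain the point at infinity *)
Definition Omega : set C := ~` Kinfty.

(* Functions on Omega are represented by functions on C that vanish outside
   Omega. *)
Definition supported_on_Omega (f : C -> C) : Prop :=
  forall z, ~ Omega z -> f z = 0.

(* |z| <= q^m and |z - x| >= q^-m for all x in K_infty *)
Definition Omega_affinoid (m : nat) : set C :=
  [set z | ((- m%:R)%R%:E <= v z)%E /\
           forall x, Kinfty x -> (v (z - x)%R <= (m%:R)%:E)%E].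

(* On each affinoid of the standard admissible covering of Omega, f is a
   uniform limit of rational functions without poles there. *)
Definition rigid_analytic (f : C -> C) : Prop :=
  forall (m : nat) (M : R), exists g h : {poly C},
    forall z, Omega_affinoid m z ->
      h.[z] != 0 /\ (M%:E < v (f z - g.[z] / h.[z])%R)%E.

Definition slash (k : nat) (g : 'M[K]_2) (f : C -> C) : C -> C := fun z =>
  emb (\det g) ^+ k.-1 * (emb (g 1 0) * z + emb (g 1 1)) ^- k
  * f ((emb (g 0 0) * z + emb (g 0 1)) / (emb (g 1 0) * z + emb (g 1 1))).

Definition toK (g : 'M[A]_2) : 'M[K]_2 := map_mx (fun a : A => a%:F) g.

Definition translations (Gamma : set 'M[A]_2) (g : 'M[A]_2) : set A :=
  [set b | Gamma (g *m mat2 1 b 0 1 *m invmx g)].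

(* e_Lambda(z) = z prod_(0 <> a in Lambda) (1 - z / a), as the limit over m of
   the products over the a of degree < m *)
Definition lattice_exp (Lambda : set A) (z : C) : C :=
  vlim v (fun m => z * \prod_(a : 'rV[F]_m | (rVpoly a != 0) &&
                                             (rVpoly a \in Lambda))
                         (1 - z / emb (rVpoly a)%:F)).

(* At the cusp g(infty), f|_k g has an expansion \sum_(i >= 1) a_i u^i in the
   uniformiser u = 1 / e_Lambda, valid where inf_(x in K_infty) |z - x| is
   large; Lambda is the lattice of translations in g^-1 Gamma g. *)
Definition vanishes_at_cusp (Gamma : set 'M[A]_2) (k : nat) (f : C -> C)
    (g : 'M[A]_2) : Prop :=
  exists (a : nat -> C) (M : R), a 0%N = 0 /\
    forall z, Omega z -> (forall x, Kinfty x -> (v (z - x)%R <= M%:E)%E) ->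
      vcvg v (fun N => \sum_(i < N)
                         a i * (lattice_exp (translations Gamma g) z)^-1 ^+ i)
             (slash k (toK g) f z).

(* SL_2(A) acts transitively on P^1(K), so the g(infty) exhaust the cusps. *)
Definition cuspforms (k : nat) (Gamma : set 'M[A]_2) : set (C -> C) :=
  [set f | [/\ supported_on_Omega f,
               rigid_analytic f,
               forall g, Gamma g -> slash k (toK g) f = f &
               forall g, SL2 g -> vanishes_at_cusp Gamma k f g]].

Section Hecke.
Variables (k : nat) (Gamma : set 'M[A]_2) (wp : A).

Definition right_coset (x : 'M[A]_2) : set 'M[A]_2 :=
  [set g *m x | g in Gamma].

Definition hecke_double_coset : set 'M[A]_2 :=
  [set y | exists g h, [/\ Gamma g, Gamma h & y = g *m mat2 1 0 0 wp *m h]].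

Definition is_coset_decomposition (xi : seq 'M[A]_2) : Prop :=
  [/\ uniq xi,
      forall y, hecke_double_coset y <-> exists2 x, x \in xi & right_coset x y &
      forall x x', x \in xi -> x' \in xi ->
        (exists y, right_coset x y /\ right_coset x' y) -> x = x'].

Definition hecke_U (f : C -> C) : C -> C := fun z =>
  \sum_(x <- xget [::] [set xi | is_coset_decomposition xi]) slash k (toK x) f z.

End Hecke.
End Cuspforms.

Section Dimensions.
Context {C : fieldType}.
Implicit Types (W : set (C -> C)) (U : (C -> C) -> C -> C).

Definition has_dimension W (d : nat) : Prop :=
  exists b : 'I_d -> C -> C,
    (forall f, W f <->
       exists c : 'I_d -> C, f = (fun z => \sum_(i < d) c i * b i z)) /\
    (forall c : 'I_d -> C,
       (forall z, \sum_(i < d) c i * b i z = 0) -> forall i, c i = 0).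

Definition eigenvalue_on W U (l : C) : Prop :=
  exists f, [/\ W f, f <> (fun=> 0) & U f = (fun z => l * f z)].

Definition generalized_eigenspace W U (l : C) : set (C -> C) :=
  [set f | W f /\
     exists m, iter m (fun g z => U g z - l * g z) f = (fun=> 0)].

(* d is the sum of the dimensions of the generalised eigenspaces of U on W for
   the eigenvalues j l, with l in the field L such that sl l = a. *)
Definition slope_dimension (X : Type) (L : fieldType) (j : L -> C) (sl : L -> X)
    W U (a : X) (d : nat) : Prop :=
  exists (s : seq L) (e : L -> nat),
    [/\ uniq s,
        forall l, l \in s <-> eigenvalue_on W U (j l) /\ sl l = a,
        forall l, l \in s ->
          has_dimension (generalized_eigenspace W U (j l)) (e l) &
        d = (\sum_(l <- s) e l)%N].

End Dimensions.

(* For a ring homomorphism red : A -> kappa, this says that red induces an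
   isomorphism from A/(wp) to kappa. *)
Definition is_residue_map (F : finFieldType) (wp : {poly F})
    (kappa : finFieldType) (red : {poly F} -> kappa) : Prop :=
  (forall x, exists a, red a = x) /\ (forall a, red a = 0 <-> wp %| a).

Section Diamond.
Context {R : realType} {F : finFieldType} {kappa : finFieldType}.
Context {L C D : fieldType}.
Variables (iK : {fraction {poly F}} -> L) (j : L -> C) (iota : L -> D).
Variables (v : D -> \bar R) (n wp : {poly F}) (r : nat).
Variables (red : {poly F} -> kappa) (teich : kappa -> L).

(* iota \o teich takes values in the valuation ring of K_wp and is a section of
   its reduction map. *)
Definition is_residue_section : Prop :=
  forall x, [/\ vclosure v (range (iota \o iK)) (iota (teich x)),
                (0 <= v (iota (teich x)))%E &
                forall a, red a = x ->
                  (0 < v (iota (teich x) - iota (iK a%:F))%R)%E].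

(* The congruences modulo wp^r on the diagonal take place in the valuation ring
   of K_wp. *)
Definition is_diamond_matrix (l : {unit kappa}) (g : 'M[{poly F}]_2) : Prop :=
  [/\ SL2 g,
      forall i k, n %| g i k - (i == k)%:R,
      wp ^+ r %| g 0 1 /\ wp ^+ r %| g 1 0,
      ((r%:R)%:E <= v (iota (iK (g 0 0)%:F) - (iota (teich (val l)))^-1)%R)%E &
      ((r%:R)%:E <= v (iota (iK (g 1 1)%:F) - iota (teich (val l)))%R)%E].

Definition diamond (k : nat) (l : {unit kappa}) (f : C -> C) : C -> C :=
  slash (j \o iK) k (toK (xget 1%:M [set g | is_diamond_matrix l g])) f.

Definition diamond_eigenspace (k : nat) (W : set (C -> C))
    (chi : {unit kappa} -> {unit kappa}) : set (C -> C) :=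
  [set f | W f /\
     forall l, diamond k l f = (fun z => j (teich (val (chi l))) * f z)].

End Diamond.

(* Main.v *)
(** [U] is given by the cosets of the matrices [1 b; 0 wp], and maps a function
    invariant at level [wp^(s+1)], [s >= 1], to one invariant at level [wp^s].
    Hence a generalised eigenvector for a nonzero eigenvalue, being a combination
    of its images under [U], is invariant at level [wp], and the generalised
    eigenspaces at levels [wp^r] and [wp] coincide once the conditions at the
    cusps are compared.  For these, let [L] be a sublattice of [L']: then
    [e_L'] is a polynomial in [e_L], and an [L']-periodic function with an
    expansion in [1 / e_L] has one in [1 / e_L'].  A diamond matrix modulo [wp^r]
    differs from one modulo [wp] by an element of the group of level [wp], so the
    diamond operators agree too.

    It remains to bound the dimension.  On the standard apartment of the tree of
    PGL_2(K_infty), -v(f) satisfies mean value inequalities, which limit its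
    growth towards the cusps by the weight; a cusp form that vanishes to high
    order at all cusps is therefore zero. *)
Require Import Defs.
From HB Require Import structures.
From mathcomp Require Import all_boot all_order all_algebra all_fingroup all_field.
From mathcomp Require Import boolp classical_sets reals constructive_ereal.
From mathcomp Require Import zify ring lra.

Set Implicit Arguments.
Unset Strict Implicit.
Unset Printing Implicit Defensive.

Import Order.TTheory GRing.Theory Num.Theory.
Local Open Scope classical_set_scope.
Local Open Scope ring_scope.

(** * Valuations *)

(** [slope_dimension] asks for a finite list of eigenvalues with finite multiplicities, so the mere
    existence of d rests on a finiteness theorem. It is obtained by analysis on Omega rather than by
    Riemann-Roch on a curve.

    On an affinoid a form is close to a rational function, whose valuation is a sum over linear
    factors, so mean value inequalities need proof for z - a only. This requires C to be
    algebraically closed, whereas [completed_algebraic_closure] provides roots for polynomials over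
    K_infty only: C is reached by approximation, after a detour through a perfect closure because
    the characteristic is p. Zeros of the form may lie anywhere, so each neighbouring vertex is
    represented by a point in general position with respect to them.

    The order of vanishing comes from two growth rates. Translations and the inversion, which costs
    the weight k, carry all but one neighbour of a vertex back along the apartment, so the infimum
    of the valuation at vertex i is at most a constant plus k q^i. There 1 / e_L has valuation at
    least q^(i - d) with d = deg (n wp^r), so an order J > k q^d is contradictory unless the form is
    0. *)

Section Valuation.
Context {R : realType} {C : fieldType} (v : C -> \bar R).
Hypothesis vv : is_valuation v.

Definition vl (x : C) : R := fine (v x).
(** [vl 0] is 0, the default of [fine] at infinity. Lower bounds therefore go through [vge], true at
    0 for every M, and upper bounds on [vl x] come with [x != 0]. *)
Definition vge (M : R) (x : C) : Prop := x = 0 \/ M <= vl x.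

Lemma v0 : v 0 = +oo%E.
Proof. by case: vv => h _ _ _; apply/h. Qed.

Lemma vE x : x != 0 -> v x = (vl x)%:E.
Proof. by case: vv => _ h _ _ /h fx; rewrite /vl fineK. Qed.

Lemma vgeP M x : (M%:E <= v x)%E <-> vge M x.
Proof.
have [->|x0] := eqVneq x 0; first by rewrite v0 leey; split=> // _; left.
rewrite vE // lee_fin /vge; split=> [|[/eqP|//]]; first by right.
by rewrite (negbTE x0).
Qed.

Lemma vgt_vge M x : (M%:E < v x)%E -> vge M x.
Proof. by move=> h; apply/vgeP/ltW. Qed.

Lemma vge_vgt M M' x : M < M' -> vge M' x -> (M%:E < v x)%E.
Proof.
by move=> lt /vgeP; apply: lt_le_trans; rewrite lte_fin.
Qed.

Lemma vleP M x : (v x <= M%:E)%E <-> x != 0 /\ vl x <= M.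
Proof.
have [->|x0] := eqVneq x 0; first by rewrite v0; split=> [|[]].
by rewrite vE // lee_fin; split=> // -[].
Qed.

Lemma vge_gt M x : ~ (v x <= M%:E)%E <-> (M%:E < v x)%E.
Proof. by split=> [/negP|h]; rewrite ?ltNge //; apply/negP; rewrite -ltNge. Qed.

Lemma vge0 M : vge M 0. Proof. by left. Qed.

Lemma vgeW M M' x : M <= M' -> vge M' x -> vge M x.
Proof. by move=> h [->|h']; [left|right; apply: le_trans h']. Qed.

Lemma vge_val x : vge (vl x) x. Proof. by right. Qed.

Lemma vge_nz M x : x != 0 -> vge M x -> M <= vl x.
Proof. by move=> x0 [/eqP|//]; rewrite (negbTE x0). Qed.

Lemma vlM x y : x != 0 -> y != 0 -> vl (x * y) = vl x + vl y.
Proof.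
move=> x0 y0; case: (vv) => _ h hM _; rewrite {1}/vl hM.
by rewrite fineD //; exact: h.
Qed.

Lemma vl1 : vl 1 = 0.
Proof.
by have := vlM (oner_neq0 C) (oner_neq0 C); rewrite mulr1 => h; lra.
Qed.

Lemma vlV x : vl x^-1 = - vl x.
Proof.
have [->|x0] := eqVneq x 0; first by rewrite invr0 /vl v0 /= oppr0.
have x0' : x^-1 != 0 by rewrite invr_eq0.
by have := vlM x0 x0'; rewrite divff // vl1 => h; lra.
Qed.

Lemma vlN1 : vl (-1) = 0.
Proof.
have n0 : -1 != 0 :> C by rewrite oppr_eq0 oner_neq0.
by have := vlM n0 n0; rewrite mulrNN mulr1 vl1 => h; lra.
Qed.

Lemma vlN x : vl (- x) = vl x.
Proof.
have [->|x0] := eqVneq x 0; first by rewrite oppr0.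
by rewrite -mulN1r vlM ?oppr_eq0 ?oner_neq0 // vlN1 add0r.
Qed.

Lemma vlB x y : vl (x - y) = vl (y - x).
Proof. by rewrite -vlN opprB. Qed.

Lemma vl_div x y : x != 0 -> y != 0 -> vl (x / y) = vl x - vl y.
Proof. by move=> x0 y0; rewrite vlM ?invr_eq0 // vlV. Qed.

Lemma vlX x n : x != 0 -> vl (x ^+ n) = vl x * n%:R.
Proof.
move=> x0; elim: n => [|n IH]; first by rewrite expr0 vl1 mulr0.
by rewrite exprS vlM ?expf_neq0 // IH -natr1; lra.
Qed.

Lemma vl_prod (I : Type) (r : seq I) (P : pred I) (f : I -> C) :
  (forall i, P i -> f i != 0) ->
  vl (\prod_(i <- r | P i) f i) = \sum_(i <- r | P i) vl (f i).
Proof.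
move=> h; have [] : \prod_(i <- r | P i) f i != 0 /\
  vl (\prod_(i <- r | P i) f i) = \sum_(i <- r | P i) vl (f i); last by [].
elim/big_rec2: _ => [|i x y Pi [IH1 IH2]]; first by rewrite oner_neq0 vl1.
by rewrite mulf_neq0 ?h // vlM ?h // IH2.
Qed.

Lemma vgeN M x : vge M (- x) <-> vge M x.
Proof.
have [->|x0] := eqVneq x 0; first by rewrite oppr0.
rewrite /vge vlN; split=> -[/eqP|]; rewrite ?oppr_eq0 ?(negbTE x0) //;
by right.
Qed.

Lemma vgeD M x y : vge M x -> vge M y -> vge M (x + y).
Proof.
move=> /vgeP hx /vgeP hy; apply/vgeP; case: vv => _ _ _ h.
by apply: le_trans (h x y); rewrite le_min hx hy.
Qed.

Lemma vgeB M x y : vge M x -> vge M y -> vge M (x - y).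
Proof. by move=> hx hy; apply: vgeD => //; apply/vgeN. Qed.

Lemma vgeBC M x y : vge M (x - y) <-> vge M (y - x).
Proof. by rewrite -vgeN opprB. Qed.

Lemma vge_sum M (I : Type) (r : seq I) (P : pred I) (f : I -> C) :
  (forall i, P i -> vge M (f i)) -> vge M (\sum_(i <- r | P i) f i).
Proof.
by move=> h; apply: big_ind => //; [exact: vge0 | exact: vgeD].
Qed.

Lemma vgeM M M' x y : vge M x -> vge M' y -> vge (M + M') (x * y).
Proof.
have [->|x0] := eqVneq x 0; first by rewrite mul0r => *; left.
have [->|y0] := eqVneq y 0; first by rewrite mulr0 => *; left.
move=> /(vge_nz x0) hx /(vge_nz y0) hy; right; rewrite vlM //; lra.
Qed.

Lemma vgeX M x n : vge M x -> vge (M * n%:R) (x ^+ n).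
Proof.
move=> h; elim: n => [|n IH]; first by right; rewrite mulr0 expr0 vl1.
by rewrite exprS -natr1 mulrDr mulr1 addrC; apply: vgeM.
Qed.

Lemma vl_add_eq x y : x != 0 -> (y = 0 \/ vl x < vl y) ->
  x + y != 0 /\ vl (x + y) = vl x.
Proof.
move=> x0 [->|lt]; first by rewrite addr0.
have ge : vge (vl x) (x + y).
  by apply: vgeD; [exact: vge_val | right; exact: ltW].
have nz : x + y != 0.
  by apply/eqP => /eqP; rewrite addr_eq0 => /eqP e; move: lt; rewrite e vlN ltxx.
split=> //; apply/eqP; rewrite eq_le (vge_nz nz ge) andbT leNgt; apply/negP => lt'.
have : vge (Order.min (vl (x + y)) (vl y)) ((x + y) - y).
  by apply: vgeB; right; rewrite ge_min lexx ?orbT.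
rewrite addrK => /(vge_nz x0); rewrite ge_min => /orP[]; lra.
Qed.

Lemma vl_sub_eq x y : x != 0 -> (y = 0 \/ vl x < vl y) ->
  x - y != 0 /\ vl (x - y) = vl x.
Proof.
move=> x0 h; apply: vl_add_eq => //; rewrite vlN.
by case: h => [->|]; [left; rewrite oppr0|right].
Qed.

Lemma vge_near M x y : x != 0 -> vl x < M -> vge M (y - x) ->
  y != 0 /\ vl y = vl x.
Proof.
move=> x0 lt h; have -> : y = x + (y - x) by ring.
by apply: vl_add_eq => //; case: h => [->|h]; [left|right; lra].
Qed.

Lemma vge_all0 x : (forall M, vge M x) -> x = 0.
Proof.
move=> h; have [->//|x0] := eqVneq x 0.
by exfalso; have := vge_nz x0 (h (vl x + 1)); lra.
Qed.

Lemma vcvgP u l : vcvg v u l <->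
  forall M, exists N, forall n, (N <= n)%N -> vge M (u n - l).
Proof.
split=> h M.
  by have [N hN] := h M; exists N => n /hN /vgt_vge.
have [N hN] := h (M + 1); exists N => n /hN; apply: vge_vgt; lra.
Qed.

Lemma vcvg_uniq u l l' : vcvg v u l -> vcvg v u l' -> l = l'.
Proof.
move=> /vcvgP h /vcvgP h'; apply/eqP; rewrite -subr_eq0; apply/eqP/vge_all0 => M.
have [N hN] := h M; have [N' hN'] := h' M.
have -> : l - l' = (u (maxn N N') - l') - (u (maxn N N') - l) by ring.
by apply: vgeB; [apply: hN'|apply: hN]; rewrite leq_max leqnn ?orbT.
Qed.

Lemma vlimE u l : vcvg v u l -> vlim v u = l.
Proof.
by move=> h; apply: xget_unique => // l' h'; apply: vcvg_uniq h' h.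
Qed.

Lemma vcvg_ext u u' l : (exists N, forall n, (N <= n)%N -> u n = u' n) ->
  vcvg v u l -> vcvg v u' l.
Proof.
move=> [N h] c M; have [N' h'] := c M; exists (maxn N N') => n.
by rewrite geq_max => /andP[h1 h2]; rewrite -h //; apply: h'.
Qed.

Lemma vcvg_cst l : vcvg v (fun=> l) l.
Proof. by apply/vcvgP => M; exists 0%N => n _; left; rewrite subrr. Qed.

Lemma vcvgD u u' l l' : vcvg v u l -> vcvg v u' l' ->
  vcvg v (fun n => u n + u' n) (l + l').
Proof.
move=> /vcvgP h /vcvgP h'; apply/vcvgP => M.
have [N hN] := h M; have [N' hN'] := h' M; exists (maxn N N') => n.
rewrite geq_max => /andP[h1 h2].
have -> : u n + u' n - (l + l') = (u n - l) + (u' n - l') by ring.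
by apply: vgeD; [apply: hN|apply: hN'].
Qed.

Lemma vcvg_bounded u l : vcvg v u l ->
  exists M N, forall n, (N <= n)%N -> vge M (u n).
Proof.
move=> /vcvgP h; have [N hN] := h (vl l); exists (vl l), N => n /hN hn.
by have -> : u n = (u n - l) + l by [ring]; apply: vgeD => //; apply: vge_val.
Qed.

Lemma vcvgM u u' l l' : vcvg v u l -> vcvg v u' l' ->
  vcvg v (fun n => u n * u' n) (l * l').
Proof.
move=> h h'; have [B [N1 hB]] := vcvg_bounded h.
move/vcvgP: h => h; move/vcvgP: h' => h'; apply/vcvgP => M.
have [N2 h2] := h' (M - B); have [N3 h3] := h (M - vl l').
exists (maxn N1 (maxn N2 N3)) => n; rewrite !geq_max => /and3P[a1 a2 a3].
have -> : u n * u' n - l * l' = u n * (u' n - l') + (u n - l) * l' by ring.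
apply: vgeD.
  by have -> : M = B + (M - B) by [ring]; apply: vgeM; [apply: hB|apply: h2].
have -> : M = M - vl l' + vl l' by ring.
by apply: vgeM; [apply: h3|exact: vge_val].
Qed.

Lemma vcvgZ c u l : vcvg v u l -> vcvg v (fun n => c * u n) (c * l).
Proof. exact: (vcvgM (vcvg_cst c)). Qed.

Lemma vcvgN u l : vcvg v u l -> vcvg v (fun n => - u n) (- l).
Proof.
move=> /(vcvgZ (-1)); rewrite mulN1r; apply: vcvg_ext.
by exists 0%N => n _; rewrite mulN1r.
Qed.

Lemma vcvgB u u' l l' : vcvg v u l -> vcvg v u' l' ->
  vcvg v (fun n => u n - u' n) (l - l').
Proof. by move=> h /vcvgN; apply: vcvgD. Qed.

Lemma vcvg_sum (I : Type) (r : seq I) (u : I -> nat -> C) (l : I -> C) :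
  (forall i, vcvg v (u i) (l i)) ->
  vcvg v (fun n => \sum_(i <- r) u i n) (\sum_(i <- r) l i).
Proof.
move=> h; elim: r => [|i r IH].
  by rewrite big_nil; apply: vcvg_ext (vcvg_cst 0); exists 0%N => n _; rewrite big_nil.
rewrite big_cons; apply: vcvg_ext (vcvgD (h i) IH).
by exists 0%N => n _; rewrite big_cons.
Qed.

Lemma vcvg_vge M u l : (exists N, forall n, (N <= n)%N -> vge M (u n)) ->
  vcvg v u l -> vge M l.
Proof.
move=> [N h] /vcvgP c; have [N' h'] := c M.
have -> : l = u (maxn N N') - (u (maxn N N') - l) by ring.
by apply: vgeB; [apply: h|apply: h']; rewrite leq_max leqnn ?orbT.
Qed.

Lemma vcvg_subn u l d : vcvg v u l -> vcvg v (fun n => u (n - d)%N) l.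
Proof.
move=> /vcvgP h; apply/vcvgP => M; have [N hN] := h M; exists (N + d)%N => n hn.
by apply: hN; lia.
Qed.

Lemma vcvg_vle M u l : (exists N, forall n, (N <= n)%N -> u n != 0 /\ vl (u n) <= M) ->
  vcvg v u l -> l != 0 /\ vl l <= M.
Proof.
move=> [N h] /vcvgP c; have [N' h'] := c (M + 1).
have [nz le] := h (maxn N N') (leq_maxl _ _).
have /vgeBC lN := h' (maxn N N') (leq_maxr _ _).
have lt : vl (u (maxn N N')) < M + 1 by lra.
by have [? ->] := vge_near nz lt lN.
Qed.

Hypothesis vcomp : vcomplete v.

Lemma cauchy_succ (u : nat -> C) :
  (forall M, exists N, forall n, (N <= n)%N -> vge M (u n.+1 - u n)) ->
  exists l, vcvg v u l.
Proof.
move=> h; apply: vcomp => M; have [N hN] := h (M + 1); exists N.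
have step m : vge (M + 1) (u (N + m)%N - u N).
  elim: m => [|m IH]; first by rewrite addn0 subrr; left.
  have -> : u (N + m.+1)%N - u N = (u (N + m).+1 - u (N + m)%N) + (u (N + m)%N - u N).
    by rewrite addnS; ring.
  by apply: vgeD => //; apply: hN; lia.
move=> m n hm hn; apply: (@vge_vgt _ (M + 1)); first by lra.
have -> : u m - u n = (u (N + (m - N))%N - u N) - (u (N + (n - N))%N - u N).
  by rewrite !subnKC //; ring.
exact: vgeB.
Qed.

Lemma cauchy_succ_bound (u : nat -> C) (l : C) M N : vcvg v u l ->
  (forall n, (N <= n)%N -> vge M (u n.+1 - u n)) -> vge M (l - u N).
Proof.
move=> c h; apply: (@vcvg_vge M (fun n => u n - u N)); last first.
  by apply: vcvgB => //; apply: vcvg_cst.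
exists N => n /subnKC <-; elim: (n - N)%N => [|m IH]; first by rewrite addn0 subrr; left.
have -> : u (N + m.+1)%N - u N = (u (N + m).+1 - u (N + m)%N) + (u (N + m)%N - u N).
  by rewrite addnS; ring.
by apply: vgeD => //; apply: h; lia.
Qed.

End Valuation.

(** * Completed algebraic closures are algebraically closed *)

Section SubfieldType.
Context (F : fieldType) (S : divringClosed F).

(** A subfield given by a predicate becomes a field type, so that minimal polynomials and the
    primitive element theorem over it make sense. *)
Record subfield_of := SubfieldOf { subfield_val : F; subfield_valP : subfield_val \in S }.

HB.instance Definition _ := [isSub for subfield_val].
HB.instance Definition _ := [Choice of subfield_of by <:].
HB.instance Definition _ := [SubChoice_isSubIntegralDomain of subfield_of by <:].
HB.instance Definition _ := [SubIntegralDomain_isSubField of subfield_of by <:].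

Lemma subfield_val_zmod : zmod_morphism subfield_val. Proof. by []. Qed.
Lemma subfield_val_monoid : monoid_morphism subfield_val. Proof. by []. Qed.
HB.instance Definition _ :=
  GRing.isZmodMorphism.Build subfield_of F subfield_val subfield_val_zmod.
HB.instance Definition _ :=
  GRing.isMonoidMorphism.Build subfield_of F subfield_val subfield_val_monoid.

End SubfieldType.

Lemma irreducible_coprimep (F : fieldType) (p q : {poly F}) :
  irreducible_poly p -> ~~ (p %| q) -> coprimep p q.
Proof.
move=> [p1 irr] npq; apply/negP => /negP nc; move/negP: npq; apply.
have sg : size (gcdp p q) != 1%N by [].
by rewrite -(eqp_dvdl _ (irr _ sg (dvdp_gcdl _ _))) dvdp_gcdr.
Qed.

(** Among nonzero polynomials with property P one of least degree is irreducible, since P passes to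
    a factor. With P vanishing at z this gives minimal polynomials; with P being a nonconstant
    divisor of h it gives irreducible factors. *)
Lemma irreducible_min (F : fieldType) (P : {poly F} -> Prop) (p : {poly F}) :
  p != 0 -> P p -> ~ P 1 -> (forall q c, c != 0 -> P (c *: q) -> P q) ->
  (forall q r, P (q * r) -> P q \/ P r) ->
  exists m, irreducible_poly m /\ P m.
Proof.
move=> p0 Pp n1 PZ PM.
have ex : exists n, `[< exists q : {poly F}, [/\ q != 0, P q & size q = n] >].
  by exists (size p); apply/asboolP; exists p.
case: (ex_minnP ex) => n /asboolP[m [m0 Pm sm]] min.
exists m; split=> //; split=> [|q sq1 qm].
  rewrite ltnNge; apply/negP => /size1_polyC e.
  have c0 : m`_0 != 0 by move: m0; rewrite {1}e polyC_eq0.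
  by apply: n1; apply: (PZ _ _ c0); rewrite alg_polyC -e.
rewrite -dvdp_size_eqp // eqn_leq dvdp_leq //=.
have /dvdpP[r mE] := qm; move: (m0); rewrite mE mulf_eq0 negb_or => /andP[r0 q0].
rewrite -mE; move: Pm; rewrite {1}mE => /PM[Pr|Pq]; last first.
  by rewrite sm min //; apply/asboolP; exists q.
have : (n <= size r)%N by apply: min; apply/asboolP; exists r.
rewrite -sm mE size_mul //; have := sq1; rewrite -size_poly_gt0 in q0.
by move: (size r) (size q) q0 => a b; lia.
Qed.

Section RootTransfer.
Context (K C L : fieldType) (i : {rmorphism K -> C}) (io : {rmorphism C -> L}).
Hypothesis K_root : forall f : {poly K}, (1 < size f)%N ->
  exists x, root (map_poly i f) x.
Hypothesis K_inf : exists e : nat -> K, injective e.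
Hypothesis K_sep : forall f : {poly K}, irreducible_poly f -> separable_poly f.

Let il : {rmorphism K -> L} := (io \o i).

(** Provides a parameter outside the finite exceptional set of the primitive element theorem. *)
Lemma infinite_nonroot (E : fieldType) (e : {rmorphism K -> E}) (f : {poly E}) :
  f != 0 -> exists t, ~~ root f (e t).
Proof.
move=> f0; have [h hI] := K_inf; apply: contrapT => nr.
have /(max_poly_roots f0) : all (root f) (mkseq (e \o h) (size f)).
  by apply/allP => _ /mapP[k _ ->]; apply/negP => /negP ?; apply: nr; exists (h k).
rewrite size_mkseq ltnn => /(_ _); apply/not_implyP; split=> //.
by apply: mkseq_uniq => a b /= /fmorph_inj/hI.
Qed.

Lemma ex_minpoly (E : fieldType) (e : {rmorphism K -> E}) z :
  algebraicOver e z -> exists m, irreducible_poly m /\ root (map_poly e m) z.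
Proof.
move=> [p p0 pz].
apply: (@irreducible_min K (fun q => root (map_poly e q) z) p) => //.
- by rewrite rmorph1 rootE hornerC (negbTE (oner_neq0 _)).
- move=> q c c0; rewrite map_polyZ rootE hornerZ mulf_eq0 fmorph_eq0.
  by rewrite (negbTE c0).
- by move=> q r; rewrite rmorphM rootM => /orP.
Qed.

Lemma irreducible_root (E : fieldType) (e : {rmorphism K -> E}) z m P :
  irreducible_poly m -> root (map_poly e m) z ->
  root (map_poly e P) z = (m %| P).
Proof.
move=> irr mz; apply/idP/idP => [Pz|/dvdpP[r ->]]; last first.
  by rewrite rmorphM rootM mz orbT.
apply: contraT => /(irreducible_coprimep irr) /Bezout_coprimepP[[a b] /= /eqpP].
move=> [[c d]] /= /andP[c0 d0] e1.
have := congr1 (fun Q => (map_poly e Q).[z]) e1.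
rewrite /= !map_polyZ !hornerZ rmorphD !rmorphM hornerD !hornerM (rootP mz) (rootP Pz).
rewrite rmorph1 hornerC !mulr0 addr0 mulr0 mulr1 => /esym/eqP.
by rewrite fmorph_eq0 (negbTE d0).
Qed.

(** Take for z' a root in C of the minimal polynomial of z. The equivalence expresses the
    isomorphism between K(z) and K(z') without constructing it. *)
Lemma root_transfer z : algebraicOver il z -> exists z', algebraicOver i z' /\
  forall P, root (map_poly il P) z = root (map_poly i P) z'.
Proof.
move=> /ex_minpoly[m [irr mz]]; have [m1 _] := irr.
have [z' mz'] := K_root m1; exists z'; split.
  by exists m => //; rewrite -size_poly_gt0 ltnW.
by move=> P; rewrite (irreducible_root P irr mz) (irreducible_root P irr mz').
Qed.

Lemma root_comp (E : fieldType) (e : {rmorphism K -> E}) z (P Q : {poly K}) :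
  root (map_poly e (P \Po Q)) z = root (map_poly e P) (map_poly e Q).[z].
Proof. by rewrite map_comp_poly !rootE horner_comp. Qed.

(* [theta] is chosen so that K(theta) contains as many roots of the minimal
   polynomial m of u as possible.  If u were not among them, a primitive element
   z of K(theta, u) would have a conjugate z' in C, and K(z') would contain more
   roots of m. *)
Lemma algebraic_in u : algebraicOver il u -> exists c, io c = u.
Proof.
move=> alu; have [m [irr mu]] := ex_minpoly alu; have [m1 _] := irr.
have m0 : m != 0 by rewrite -size_poly_gt0 ltnW.
pose good r := exists th : C, algebraicOver i th /\ exists s : seq {poly K},
  [/\ size s = r, uniq [seq (map_poly i a).[th] | a <- s] &
      all (fun a => root (map_poly i m) (map_poly i a).[th]) s].
have ex : exists r, `[< good r >].
  by exists 0%N; apply/asboolP; exists 0; split; [exact: algebraic0|exists [::]].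
have bd r : `[< good r >] -> (r <= size m)%N.
  move=> /asboolP[th [_ [s [<- us al]]]].
  rewrite -(size_map (fun a => (map_poly i a).[th])) ltnW //.
  rewrite -(size_map_poly i); apply: max_poly_roots => //; first by rewrite map_poly_eq0.
  by rewrite all_map.
case: (ex_maxnP ex bd) => r /asboolP[th [alth [s [ss us als]]]] max.
have [/mapP[a _ ->]|nin] := boolP (u \in [seq io (map_poly i a).[th] | a <- s]).
  by exists (map_poly i a).[th].
exfalso.
have alioth : algebraicOver il (io th).
  have [p p0 pth] := alth; exists p => //.
  by rewrite map_poly_comp /= fmorph_root.
have [p p0 pth] := alioth.
have [rr rr0 PET] := large_field_PET p0 pth mu (K_sep irr).
have [t nt] := infinite_nonroot il rr0.
have [] := PET t nt.
set z := _ - _ => -[A Ath] [B Bu].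
have alz : algebraicOver il z.
  by apply: algebraic_sub => //; apply: algebraic_mul => //; apply: algebraic_id.
have [z' [alz' tr]] := root_transfer alz.
have io_eval (a : {poly K}) x : io (map_poly i a).[x] = (map_poly il a).[io x].
  by rewrite map_poly_comp /= horner_map.
have /max : `[< good r.+1 >]; last by rewrite ltnn.
(* In K(z) the old roots are the values of [a \Po A] at z, and u is that of B. At z' the same
   polynomials take r + 1 distinct values in C, all roots of m. *)
apply/asboolP; exists z'; split=> //; exists (B :: [seq a \Po A | a <- s]).
have ev P Q : ((map_poly i P).[z'] == (map_poly i Q).[z']) =
              ((map_poly il P).[z] == (map_poly il Q).[z]).
  rewrite -subr_eq0 -[RHS]subr_eq0.
  by have := tr (P - Q); rewrite !rmorphB !rootE !hornerD !hornerN => ->.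
have evA a : (map_poly il (a \Po A)).[z] = io (map_poly i a).[th].
  by rewrite map_comp_poly horner_comp Ath io_eval.
split; first by rewrite /= size_map ss.
- rewrite /= -map_comp; apply/andP; split.
    apply/negP => /mapP[a ia /= /eqP]; rewrite ev evA Bu => /eqP e.
    by move/negP: nin; apply; apply/mapP; exists a.
  rewrite map_inj_in_uniq; first by move: us; apply: map_uniq.
  move=> a b ia ib /= /eqP; rewrite ev !evA => /eqP/fmorph_inj e.
  have := us; move: ia ib e => /(nthP 0)[x xs <-] /(nthP 0)[y ys <-].
  have nE w : (w < size s)%N -> (map_poly i s`_w).[th] =
      nth 0 [seq (map_poly i a).[th] | a <- s] w.
    by move=> ws; rewrite (nth_map 0).
  by rewrite !nE // => /eqP e us'; rewrite nth_uniq ?size_map // in e; rewrite (eqP e).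
- rewrite /= -root_comp -tr root_comp Bu mu /= all_map; apply/allP => a ia /=.
  rewrite -root_comp -tr root_comp evA.
  rewrite (_ : map_poly il m = map_poly io (map_poly i m)) ?fmorph_root; last first.
    exact: map_poly_comp.
  exact: (allP als).
Qed.

End RootTransfer.

Lemma expr_pchar_sum (A : comNzRingType) (p N : nat) (I : Type) (r : seq I) (f : I -> A) :
  p \in [pchar A] ->
  (\sum_(i <- r) f i) ^+ (p ^ N) = \sum_(i <- r) f i ^+ (p ^ N).
Proof.
move=> pA; have pr := pcharf_prime pA; elim: r => [|i r IH].
  by rewrite !big_nil expr0n expn_eq0 eqn0Ngt prime_gt0.
rewrite !big_cons -IH exprDn_pchar // pnatX pnatE //.
by rewrite pA.
Qed.

Lemma expr_pchar_poly (A : comNzRingType) (p N : nat) (q : {poly A}) :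
  p \in [pchar A] ->
  q ^+ (p ^ N) = \sum_(i < size q) q`_i ^+ (p ^ N) *: 'X^(i * p ^ N).
Proof.
move=> pA; rewrite -{1}[q]coefK poly_def expr_pchar_sum ?pchar_poly //.
by apply: eq_bigr => i _; rewrite exprZn exprM.
Qed.

(** Only divisors of p are asked to have roots, so that the lemma already applies when p has
    algebraic coefficients and nothing is known about other polynomials. *)
Lemma splits_of_roots (E : fieldType) (p : {poly E}) :
  (forall h, h %| p -> (1 < size h)%N -> exists x, root h x) ->
  exists s, p = lead_coef p *: \prod_(a <- s) ('X - a%:P).
Proof.
move: {2}(size p) (leqnn (size p)) => n; elim: n p => [|n IH] p.
  by rewrite leqn0 size_poly_eq0 => /eqP-> _; exists [::]; rewrite lead_coef0 scale0r.
move=> sp h; have [s1|s1] := leqP (size p) 1.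
  exists [::]; rewrite big_nil alg_polyC {1}(size1_polyC s1); congr _%:P.
  by rewrite lead_coefE; case: (size p) s1 => [|[]].
have [x px] := h p (dvdpp p) s1.
have /factor_theorem[q pE] := px.
have q0 : q != 0 by apply: contraTneq s1 => q0; rewrite pE q0 mul0r size_poly0.
have sq : size p = (size q).+1 by rewrite pE size_Mmonic ?monicXsubC // size_XsubC addn2.
have [||s qE] := IH q; first by rewrite sq ltnS in sp.
  by move=> g gq; apply: h; rewrite pE dvdp_mulr.
exists (x :: s); rewrite big_cons pE lead_coefM lead_coefXsubC mulr1 {1}qE.
by rewrite -scalerAl mulrC.
Qed.

(** * Perfect closures and polynomials with algebraic coefficients *)

Section PerfectClosure.
Context (C : fieldType) (S : set C) (p : nat).
Hypothesis pC : p \in [pchar C].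
Hypothesis S1 : S 1.
Hypothesis SB : forall x y, S x -> S y -> S (x - y).
Hypothesis SV : forall x y, S x -> S y -> S (x / y).
Hypothesis S_inf : exists e : nat -> C, injective e /\ forall n, S (e n).
Hypothesis S_root : forall f, poly_over S f -> (1 < size f)%N -> exists x, root f x.

Let p_gt0 : (0 < p)%N := prime_gt0 (pcharf_prime pC).

(** The purely inseparable closure of S in C. Over it irreducible polynomials are separable, and a
    polynomial over it has a [p ^ N]-th power with coefficients in S, where [S_root] applies. *)
Definition perfect : {pred C} := fun x => `[< exists n, S (x ^+ (p ^ n)) >].

Lemma S0 : S 0. Proof. by have := SB S1 S1; rewrite subrr. Qed.

Lemma SM x y : S x -> S y -> S (x * y).
Proof.
by move=> Sx Sy; rewrite -[y]invrK; apply: SV => //; rewrite -[_^-1]mul1r; apply: SV.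
Qed.

Lemma SX x n : S x -> S (x ^+ n).
Proof. by move=> Sx; elim: n => // n IH; rewrite exprS; apply: SM. Qed.

Lemma exprB_pchar (x y : C) n : (x - y) ^+ (p ^ n) = x ^+ (p ^ n) - y ^+ (p ^ n).
Proof.
apply/eqP; rewrite eq_sym subr_eq -exprDn_pchar ?subrK //.
by rewrite pnatX pnatE ?(pcharf_prime pC) // pC.
Qed.

Lemma perfect_exp x m n : S (x ^+ (p ^ m)) -> S (x ^+ (p ^ (n + m))).
Proof. by move=> h; rewrite addnC expnD exprM; apply: SX. Qed.

Lemma perfect_divring : divring_closed perfect.
Proof.
split; first by apply/asboolP; exists 0%N; rewrite expr1n.
- move=> x y /asboolP[m hm] /asboolP[n hn]; apply/asboolP; exists (m + n)%N.
  rewrite exprB_pchar; apply: SB; last exact: perfect_exp.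
  by rewrite addnC; apply: perfect_exp.
- move=> x y /asboolP[m hm] /asboolP[n hn]; apply/asboolP; exists (m + n)%N.
  rewrite expr_div_n; apply: SV; last exact: perfect_exp.
  by rewrite addnC; apply: perfect_exp.
Qed.

HB.instance Definition _ := GRing.isDivringClosed.Build C perfect perfect_divring.

Local Notation K := (subfield_of perfect).
Local Notation i := (@subfield_val C perfect).

Lemma subS x : S x -> x \in perfect.
Proof. by move=> Sx; apply/asboolP; exists 0%N. Qed.

Lemma perfect_root (f : {poly K}) : (1 < size f)%N -> exists x, root (map_poly i f) x.
Proof.
move=> sf; have [N hN] : exists N, forall j, S (i f`_j ^+ (p ^ N)).
  have [N hN] : exists N, forall j, (j < size f)%N -> S (i f`_j ^+ (p ^ N)).
    elim: (size f) => [|n [N IH]]; first by exists 0%N.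
    have /asboolP[m hm] := subfield_valP f`_n; exists (N + m)%N => j.
    rewrite ltnS leq_eqVlt => /orP[/eqP->|/IH h]; first exact: perfect_exp.
    by rewrite addnC; apply: perfect_exp.
  exists N => j; have [/hN//|sj] := ltnP j (size f).
  by rewrite nth_default // rmorph0 expr0n expn_eq0 (gtn_eqF p_gt0) /=; exact: S0.
have N0 : (0 < p ^ N)%N by rewrite expn_gt0 p_gt0.
have [||x] := S_root (f := map_poly i f ^+ (p ^ N)).
- move=> j; rewrite expr_pchar_poly // coef_sum.
  apply: (big_ind S); [exact: S0| |].
    by move=> x y Sx Sy; rewrite -[y]opprK; apply: SB => //; rewrite -sub0r; apply: SB => //; exact: S0.
  move=> k _; rewrite coefZ coefXn coef_map; apply: SM; first exact: hN.
  by case: (_ == _); rewrite ?S1 //; exact: S0.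
- have := size_exp (map_poly i f) (p ^ N); rewrite size_map_poly.
  move: (size _) (size f) sf N0 => a b; nia.
by rewrite rootE horner_exp expf_eq0 => /andP[_ ?]; exists x.
Qed.

Lemma perfect_surj (x : K) : exists y : K, y ^+ p = x.
Proof.
have /asboolP[n hn] := subfield_valP x.
have q0 : (0 < p ^ n.+1)%N by rewrite expn_gt0 p_gt0.
have [||y] := S_root (f := 'X^(p ^ n.+1) - (i x ^+ (p ^ n))%:P).
- move=> j; rewrite coefB coefXn coefC; apply: SB.
    by case: (_ == _); [exact: S1|exact: S0].
  by case: (_ == _) => //; exact: S0.
- by rewrite size_XnsubC.
rewrite rootE !hornerE subr_eq0 expnS exprM -subr_eq0 -exprB_pchar.
rewrite expf_eq0 => /andP[_]; rewrite subr_eq0 => /eqP yx.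
have yK : y \in perfect.
  by apply/asboolP; exists n.+1; rewrite expnS exprM yx.
by exists (SubfieldOf yK); apply: (fmorph_inj i); rewrite rmorphXn.
Qed.

Lemma pchar_perfect : p \in [pchar K].
Proof.
by rewrite -(fmorph_pchar (i : {rmorphism K -> C})).
Qed.

(** If f shared a factor with its derivative, the derivative would be 0; taking p-th roots of the
    coefficients then gives f = h^p, against irreducibility. *)
Lemma perfect_separable (f : {poly K}) : irreducible_poly f -> separable_poly f.
Proof.
move=> irr; have [f1 min] := irr; have f0 : f != 0 by rewrite -size_poly_gt0 ltnW.
have pK := pchar_perfect.
rewrite unlock; apply: irreducible_coprimep => //; apply/negP => fd.
have d0 : f^`() = 0.
  by apply/eqP; apply: contraTT (lt_size_deriv f0) => d0; rewrite -leqNgt dvdp_leq.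
have [g hg] := choice perfect_surj.
pose h := \poly_(j < size f) g f`_(j * p).
have fE : f = h ^+ p.
  apply/polyP => k; rewrite -[p]expn1 expr_pchar_poly // coef_sum expn1.
  have [/dvdnP[j ->]|npk] := boolP (p %| k)%N.
    have hj l : (h`_l) ^+ p = f`_(l * p).
      rewrite coef_poly; case: ltnP => [_|sl]; first exact: hg.
      by rewrite nth_default ?expr0n ?(gtn_eqF p_gt0) // (leq_trans sl) // leq_pmulr.
    have [sj|sj] := ltnP j (size h).
      rewrite (bigD1 (Ordinal sj)) //= coefZ coefXn eqxx mulr1 hj big1 ?addr0 // => l.
      by rewrite coefZ coefXn eqn_mul2r (gtn_eqF p_gt0) /= eq_sym -val_eqE /= => /negbTE->; rewrite mulr0.
    rewrite big1 => [|l _].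
      by rewrite -hj nth_default // expr0n (gtn_eqF p_gt0).
    rewrite coefZ coefXn eqn_mul2r (gtn_eqF p_gt0) /= gtn_eqF ?mulr0 //.
    exact: leq_trans sj.
  rewrite big1 => [|l _]; last first.
    rewrite coefZ coefXn; case: eqP => [e|_]; last by rewrite mulr0.
    by move: npk; rewrite e dvdn_mull.
  case: k npk => [|k npk]; first by rewrite dvdn0.
  have := congr1 (fun q : {poly K} => q`_k) d0; rewrite coef_deriv coef0 -mulr_natr.
  move=> /eqP; rewrite mulf_eq0 => /orP[/eqP//|].
  by rewrite -(dvdn_pcharf pK) (negbTE npk).
have hf : h %| f by rewrite fE -(prednK p_gt0) exprS dvdp_mulr.
have sz : (size f).-1 = ((size h).-1 * p)%N by rewrite {1}fE size_exp.
have p2 := prime_gt1 (pcharf_prime pC).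
have h1 : size h != 1%N by apply/eqP => e; move: sz; rewrite e /=; move: f1; move: (size f) => a; lia.
have /eqp_size := min _ h1 hf; move: sz f1 h1; move: (size f) (size h) => a b; nia.
Qed.

Lemma perfect_inf : exists e : nat -> K, injective e.
Proof.
have [e [eI eS]] := S_inf; exists (fun n => SubfieldOf (subS (eS n))).
by move=> a b /(congr1 i)/eI.
Qed.

Lemma algebraic_over_perfect (L : fieldType) (io : {rmorphism C -> L}) x :
  algebraic_over S x -> algebraicOver (io \o i) (io x).
Proof.
move=> [f [fS f0 fx]].
have [g hg] : exists g : nat -> K, forall j, i (g j) = f`_j.
  by exists (fun j => SubfieldOf (subS (fS j))).
have fE : map_poly i (\poly_(j < size f) g j) = f.
  apply/polyP => j; rewrite coef_map coef_poly; case: ltnP => [_|sj]; first exact: hg.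
  by rewrite nth_default // rmorph0.
exists (\poly_(j < size f) g j).
  by apply: contraNneq f0 => e; rewrite -fE e rmorph0.
by rewrite map_poly_comp /= fE fmorph_root.
Qed.

(** Adjoin to C a root z of an irreducible factor of h. As a root of f it is algebraic over the
    perfect closure of S, so [algebraic_in] places it in C. *)
Lemma algebraic_coef_root (f h : {poly C}) : f != 0 ->
  (forall j, algebraic_over S f`_j) -> h %| f -> (1 < size h)%N -> exists x, root h x.
Proof.
move=> f0 fS hf sh; have h0 : h != 0 by rewrite -size_poly_gt0 ltnW.
have [m [irr [mh sm]]] : exists m, irreducible_poly m /\ (m %| h /\ (1 < size m)%N).
  apply: (@irreducible_min _ (fun q => q %| h /\ (1 < size q)%N) h) => //.
  - by rewrite size_poly1 => -[].
  - by move=> q c c0; rewrite dvdpZl // size_scale.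
  - move=> q r [qr]; have qr0 := dvdpN0 qr h0.
    move: (qr0); rewrite mulf_eq0 negb_or => /andP[q0 r0].
    rewrite size_mul // => s; have [sq|sq] := leqP (size q) 1.
      right; split; first by apply: dvdp_trans qr; exact: dvdp_mull.
      by move: s sq; move: (size q) (size r) => a b; lia.
    by left; split=> //; apply: dvdp_trans qr; exact: dvdp_mulr.
have [L _ [z mz _]] := irredp_FAdjoin irr.
have [||||c cz] := @algebraic_in K C L i (in_alg L) _ _ _ z.
- exact: perfect_root.
- exact: perfect_inf.
- exact: perfect_separable.
- apply/integral_algebraic; apply: (@integral_root _ _ _ (map_poly (in_alg L) f)).
  + by rewrite map_poly_eq0.
  + move: mz; rewrite -!dvdp_XsubCl => /dvdp_trans; apply.
    by rewrite dvdp_map; apply: dvdp_trans hf.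
  + move=> _ /(nthP 0)[j _ <-]; rewrite coef_map; apply/integral_algebraic.
    exact: algebraic_over_perfect.
exists c; move: mz; rewrite -cz fmorph_root -!dvdp_XsubCl => /dvdp_trans.
exact.
Qed.

End PerfectClosure.

Section Closed.
Context {R : realType} {C : fieldType} (v : C -> \bar R) (S : set C).
Hypothesis vv : is_valuation v.
Hypothesis vcomp : vcomplete v.
Hypothesis S_dense : vclosure v (algebraic_over S) = setT.
Hypothesis S_root : forall f h : {poly C}, f != 0 ->
  (forall j, algebraic_over S f`_j) -> h %| f -> (1 < size h)%N -> exists x, root h x.
Hypothesis S1 : S 1.
Hypothesis SB : forall x y, S x -> S y -> S (x - y).

Local Notation vl := (vl v).
Local Notation vge := (vge v).

Lemma algebraic_over_in x : (exists2 f, f != 0 & poly_over S f /\ root f x) ->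
  algebraic_over S x.
Proof. by move=> [f f0 [fS fx]]; exists f. Qed.

Lemma algebraic_over_id x : S x -> algebraic_over S x.
Proof.
move=> Sx; have S0 : S 0 by have := SB S1 S1; rewrite subrr.
apply: algebraic_over_in; exists ('X - x%:P); first by rewrite polyXsubC_eq0.
split; last by rewrite root_XsubC.
by move=> [|[|k]]; rewrite coefB coefX coefC /= ?subr0 //; apply: SB.
Qed.

Lemma vcvg_horner (p : {poly C}) (x : nat -> C) l :
  vcvg v x l -> vcvg v (fun n => p.[x n]) p.[l].
Proof.
move=> h; elim/poly_ind: p => [|p c IH].
  apply: vcvg_ext (vcvg_cst vv _); exists 0%N => n _; rewrite !horner0 //.
rewrite !hornerE; apply: vcvg_ext (vcvgD vv (vcvgM vv IH h) (vcvg_cst vv c)).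
by exists 0%N => n _; rewrite !hornerE.
Qed.

Lemma monic_root_bound (B : R) (p : {poly C}) x : 0 <= B -> p \is monic ->
  (forall j, vge (- B) p`_j) -> root p x -> vge (- B) x.
Proof.
move=> B0 pm pB px; have [->|x0] := eqVneq x 0; first by left.
right; rewrite leNgt; apply/negP => lt.
have [n sp] : exists n, size p = n.+1.
  by exists (size p).-1; rewrite prednK // lt0n size_poly_eq0 monic_neq0.
have pn : p`_n = 1 by move/monicP: pm; rewrite lead_coefE sp.
have := rootP px; rewrite horner_coef sp big_ord_recr /= pn mul1r addrC => /eqP.
apply/negP; have xn0 : x ^+ n != 0 by rewrite expf_neq0.
case: n sp pn xn0 => [|n] sp pn xn0; first by rewrite big_ord0 addr0 expr0 oner_neq0.
have sm : vge (- B + vl x * n%:R) (\sum_(i < n.+1) p`_i * x ^+ i).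
  apply: vge_sum => // i _; have := vgeM vv (pB i) (vgeX vv i (vge_val v x)).
  apply: vgeW; rewrite lerD2l; apply: ler_wnM2l; first by lra.
  by rewrite ler_nat -ltnS.
have [|nz _] := vl_add_eq vv (y := \sum_(i < n.+1) p`_i * x ^+ i) xn0; last exact: nz.
case: sm => [->|h]; [by left|right; apply: lt_le_trans h].
rewrite vlX // -natr1; lra.
Qed.

Lemma vge_horner (B : R) (p : {poly C}) x (M : R) : 0 <= B -> vge (- B) x ->
  (forall j, vge M p`_j) -> vge (M - B * (size p)%:R) p.[x].
Proof.
move=> B0 hx hp; rewrite horner_coef; apply: vge_sum => // i _.
apply: vgeW (vgeM vv (hp i) (vgeX vv i hx)).
have : B * i%:R <= B * (size p)%:R by rewrite ler_wpM2l // ler_nat ltnW.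
lra.
Qed.

(** The valuation of the product is a sum of n + 1 terms, one of which reaches the mean. *)
Lemma root_near (n : nat) (s : seq C) x M : (size s = n.+1)%N ->
  vge M (\prod_(a <- s) (x - a)) -> exists2 a, a \in s & vge (M / n.+1%:R) (x - a).
Proof.
move=> ss h; apply: contrapT => no.
have lt a : a \in s -> x - a != 0 /\ vl (x - a) < M / n.+1%:R.
  move=> ia; split; first by apply/eqP => e; apply: no; exists a => //; left.
  by rewrite ltNge; apply/negP => h'; apply: no; exists a => //; right.
have nz : \prod_(a <- s) (x - a) != 0.
  by rewrite prodf_seq_neq0; apply/allP => a /lt[->].
have := vge_nz nz h; apply/negP; rewrite -ltNge.
rewrite big_seq vl_prod //; last by move=> a /lt[].
have -> : M = \sum_(a <- s | a \in s) (M / n.+1%:R).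
  rewrite -big_seq big_const_seq count_predT ss iter_addr_0 -(mulr_natr (M / _)).
  by rewrite divfK // pnatr_eq0.
rewrite -!big_seq; case: s ss lt {h nz no} => // a s _ lt.
rewrite !big_cons; apply: ltr_leD; first by case: (lt a (mem_head _ _)).
rewrite big_seq [leRHS]big_seq; apply: ler_sum => b ib; apply: ltW.
by case: (lt b); rewrite // in_cons ib orbT.
Qed.

(* A root of p is a limit of roots of nearby polynomials, chosen so that the
   root at each step is close to the previous one. *)
Lemma closed_root (p : {poly C}) : (1 < size p)%N -> exists x, root p x.
Proof.
wlog pm : p / p \is monic.
  move=> W sp; have p0 : p != 0 by rewrite -size_poly_gt0 ltnW.
  have lp : (lead_coef p)^-1 != 0 by rewrite invr_eq0 lead_coef_eq0.
  have [||x] := W ((lead_coef p)^-1 *: p).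
  - by rewrite monicE lead_coefZ mulVf // lead_coef_eq0.
  - by rewrite size_scale.
  by rewrite rootZ // => px; exists x.
move=> sp; have [n sn] : exists n, size p = n.+2.
  by exists (size p).-2; move: sp; case: (size p) => [|[]].
have pn : p`_n.+1 = 1 by move/monicP: pm; rewrite lead_coefE sn.
have [a ha] : exists a : nat -> nat -> C, forall m j, algebraic_over S (a m j) /\
    vge m%:R (p`_j - a m j).
  have /choice[f hf] : forall mj : nat * nat, exists y, algebraic_over S y /\
     vge mj.1%:R (p`_mj.2 - y).
    move=> mj; have : vclosure v (algebraic_over S) p`_mj.2.
      by rewrite S_dense.
    by move=> /(_ mj.1%:R) [y Sy /(vgt_vge vv) h]; exists y.
  by exists (fun m j => f (m, j)) => m j; exact: (hf (m, j)).
pose P m : {poly C} := 'X^(n.+1) + \poly_(j < n.+1) a m j.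
have coefP m j : (P m)`_j = if (j < n.+1)%N then a m j else (j == n.+1)%:R.
  rewrite coefD coefXn coef_poly; case: ltnP => [h|_]; last by rewrite addr0.
  by rewrite ltn_eqF // add0r.
have Pm m : P m \is monic /\ size (P m) = n.+2.
  have sz : (size (\poly_(j < n.+1) a m j) < size ('X^(n.+1) : {poly C}))%N.
    by rewrite size_polyXn ltnS size_poly.
  by rewrite monicE lead_coefDl // lead_coefXn size_polyDl // size_polyXn.
have close m j : vge m%:R (p - P m)`_j.
  rewrite coefB coefP; case: ltnP => [_|h]; first by case: (ha m j).
  case: eqP => [->|/eqP ne]; first by rewrite pn subrr; left.
  by rewrite nth_default ?subrr; [left|rewrite sn ltn_neqAle eq_sym ne].
have splitP m : exists s, P m = \prod_(b <- s) ('X - b%:P) /\ size s = n.+1.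
  have [Pmm sP] := Pm m.
  have [h hd sh|s Ps] := @splits_of_roots _ (P m).
    apply: (S_root (monic_neq0 Pmm)) hd sh => j; rewrite coefP.
    case: ltnP => _; first by case: (ha m j).
    case: (_ == _); apply: algebraic_over_id => //.
    by have := SB S1 S1; rewrite subrr.
  exists s; move: Ps; rewrite (monicP Pmm) scale1r => Ps; split=> //.
  by apply: succn_inj; rewrite -sP Ps size_prod_XsubC.
have [B B0 hB] : exists2 B, 0 <= B & forall j, vge (- B) p`_j.
  have [B B0 hB] : exists2 B, 0 <= B & forall j, (j < size p)%N -> vge (- B) p`_j.
    elim: (size p) => [|k [B B0 IH]]; first by exists 0.
    exists (Order.max B (- vl p`_k)); first by rewrite le_max B0.
    move=> j; rewrite ltnS leq_eqVlt => /orP[/eqP->|/IH]; last first.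
      by apply: vgeW; rewrite lerN2 le_max lexx.
    by right; rewrite lerNl le_max lexx orbT.
  exists B => // j; have [/hB//|sj] := ltnP j (size p).
  by rewrite nth_default //; left.
have hBa m j : vge (- B) (P m)`_j.
  have -> : (P m)`_j = p`_j - (p - P m)`_j by rewrite coefB; ring.
  apply: vgeB => //; apply: vgeW (close m j); rewrite (le_trans _ (ler0n _ _)) //; lra.
have rootB m x : root (P m) x -> vge (- B) x.
  by apply: monic_root_bound => //; case: (Pm m).
have evalB m (q : {poly C}) x : (size q <= n.+2)%N -> vge (- B) x ->
    (forall j, vge m q`_j) -> vge (m - B * n.+2%:R) q.[x].
  move=> sq xB qm; apply: vgeW (vge_horner B0 xB qm).
  by rewrite lerD2l lerN2 ler_wpM2l // ler_nat.
have evalpP m x : vge (- B) x -> vge (m%:R - B * n.+2%:R) (p - P m).[x].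
  move=> xB; apply: evalB => //; rewrite (leq_trans (size_polyD _ _)) // geq_max size_polyN.
  by case: (Pm m) => _ ->; rewrite sn leqnn.
(* At a root x of P m the polynomial P m.+1 takes the value of (p - P m) - (p - P m.+1), whose
   coefficients have valuation at least m; evaluation at x loses at most B (n + 2). The root of P
   m.+1 nearest to x then satisfies the bound of [root_near]. *)
have next m x : root (P m) x -> exists y, root (P m.+1) y /\
    vge ((m%:R - B * n.+2%:R) / n.+1%:R) (x - y).
  move=> px; have xB := rootB _ _ px; have [s [Ps ss]] := splitP m.+1.
  have : vge (m%:R - B * n.+2%:R) (P m.+1).[x].
    have -> : (P m.+1).[x] = (p - P m).[x] - (p - P m.+1).[x].
      by rewrite !(hornerD p) !hornerN (rootP px); ring.
    apply: vgeB => //; first exact: evalpP.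
    by apply: vgeW (evalpP m.+1 x xB); rewrite lerD2r ler_nat.
  rewrite {1}Ps horner_prod.
  under eq_bigr do rewrite hornerXsubC.
  move=> /(root_near ss)[b bs hb]; exists b; split=> //.
  by rewrite Ps root_prod_XsubC.
have [x0 px0] : exists x0, root (P 0%N) x0.
  have [[|b s] [Ps ss]] := splitP 0%N; first by [].
  by exists b; rewrite Ps root_prod_XsubC mem_head.
pose nx m x := xget 0 [set y | root (P m.+1) y /\
    vge ((m%:R - B * n.+2%:R) / n.+1%:R) (x - y)].
pose al := fix f m := if m is m'.+1 then nx m' (f m') else x0.
have alP m : root (P m) (al m).
  by elim: m => //= m /next/(xgetPex 0)[].
have alC m : vge ((m%:R - B * n.+2%:R) / n.+1%:R) (al m - al m.+1).
  by have /(xgetPex 0)[] := next _ _ (alP m).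
have big (M : R) : exists N : nat, M <= N%:R.
  by exists (Num.bound `|M|); rewrite (le_trans (ler_norm _)) // ltW // archi_boundP.
have [l hl] : exists l, vcvg v al l.
  apply: cauchy_succ => // M; have [N hN] := big (M * n.+1%:R + B * n.+2%:R).
  exists N => m Nm; apply/vgeBC => //; apply: vgeW (alC m).
  rewrite ler_pdivlMr ?ltr0n // lerBrDr (le_trans hN) // ler_nat //.
exists l; apply/eqP/(@vcvg_uniq _ _ v vv (fun m => p.[al m])).
  exact: vcvg_horner.
apply/vcvgP => // M; have [N hN] := big (M + B * n.+2%:R); exists N => m Nm.
have -> : p.[al m] - 0 = (p - P m).[al m].
  by rewrite (hornerD p) hornerN (rootP (alP m)).
apply: vgeW (evalpP m (al m) (rootB _ _ (alP m))).
by rewrite lerBrDr (le_trans hN) // ler_nat.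
Qed.

End Closed.

(** * The field K_infty *)

Section Closure.
Context {R : realType} {C : fieldType} (v : C -> \bar R) (S : set C).
Hypothesis vv : is_valuation v.

Local Notation vl := (vl v).
Local Notation vge := (vge v).

Lemma vclosureP x : vclosure v S x <-> forall M, exists2 y, S y & vge M (x - y).
Proof.
split=> h M; first by have [y Sy /(vgt_vge vv) hy] := h M; exists y.
have [y Sy hy] := h (M + 1); exists y => //; apply: vge_vgt hy => //; lra.
Qed.

Lemma vclosure_id x : S x -> vclosure v S x.
Proof. by move=> Sx; apply/vclosureP => M; exists x => //; left; rewrite subrr. Qed.

Hypothesis SB : forall x y, S x -> S y -> S (x - y).
Hypothesis SM : forall x y, S x -> S y -> S (x * y).
Hypothesis SV : forall x, S x -> S x^-1.

Lemma vclosureB x y : vclosure v S x -> vclosure v S y -> vclosure v S (x - y).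
Proof.
move=> /vclosureP hx /vclosureP hy; apply/vclosureP => M.
have [x' Sx' hx'] := hx M; have [y' Sy' hy'] := hy M.
exists (x' - y'); first exact: SB.
by have -> : x - y - (x' - y') = (x - x') - (y - y') by [ring]; apply: vgeB.
Qed.

Lemma vclosureM x y : vclosure v S x -> vclosure v S y -> vclosure v S (x * y).
Proof.
move=> /vclosureP hx /vclosureP hy; apply/vclosureP => M.
have [y' Sy' hy'] := hy (M - vl x).
have [x' Sx' hx'] := hx (M - vl y').
exists (x' * y'); first exact: SM.
have -> : x * y - x' * y' = x * (y - y') + (x - x') * y' by ring.
apply: vgeD => //.
  by have -> : M = vl x + (M - vl x) by [ring]; apply: vgeM => //; apply: vge_val.
by have -> : M = (M - vl y') + vl y' by [ring]; apply: vgeM => //; apply: vge_val.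
Qed.

Lemma vclosureV x : vclosure v S x -> vclosure v S x^-1.
Proof.
have [->|x0] := eqVneq x 0; first by rewrite invr0.
move=> /vclosureP hx; apply/vclosureP => M.
(* The first bound forces vl y = vl x; the second absorbs the denominator x y of x^-1 - y^-1. *)
have [y Sy hy] := hx (Order.max (vl x + 1) (M + vl x + vl x)).
exists y^-1; first exact: SV.
have [||y0 vy] := vge_near vv (y := y) (M := vl x + 1) x0; first by lra.
  by apply/vgeBC => //; apply: vgeW hy; rewrite le_max lexx.
have -> : x^-1 - y^-1 = - ((x - y) * (x^-1 * y^-1)) by field; rewrite x0 y0.
apply/vgeN => //.
have -> : M = (M + vl x + vl x) + (vl x^-1 + vl y^-1) by rewrite !vlV // vy; ring.
apply: vgeM => //; first by apply: vgeW hy; rewrite le_max lexx orbT.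
by apply: vgeM => //; apply: vge_val.
Qed.

End Closure.

Definition coefA {F : finFieldType} {C : fieldType}
    (emb : {rmorphism {fraction {poly F}} -> C}) : {rmorphism {poly F} -> C} :=
  emb \o @FracField.tofrac {poly F}.

Section Infinity.
Context {R : realType} {F : finFieldType} {C : fieldType}.
Variables (emb : {rmorphism {fraction {poly F}} -> C}) (v : C -> \bar R).
Hypothesis hC : completed_algebraic_closure v (range emb).
Hypothesis hv : extends_infty_valuation emb v.

Local Notation vl := (vl v).
Local Notation vge := (vge v).
Local Notation Kinf := (Kinfty emb v).
Local Notation io := (coefA emb).

Lemma vv : is_valuation v. Proof. by case: hC. Qed.
Hint Resolve vv : core.
Lemma vcomp : vcomplete v. Proof. by case: hC. Qed.

Lemma io_eq0 a : (io a == 0) = (a == 0).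
Proof. by rewrite /= fmorph_eq0 tofrac_eq0. Qed.

Lemma io_inj : injective io.
Proof. by move=> a b /eqP; rewrite -subr_eq0 -rmorphB io_eq0 subr_eq0 => /eqP. Qed.

Lemma vl_io a : a != 0 -> vl (io a) = - (size a).-1%:R.
Proof. by move=> a0; rewrite [LHS]/(fine (v _)) /= hv. Qed.

Lemma vl_ioC (c : F) : c != 0 -> vl (io c%:P) = 0.
Proof. by move=> c0; rewrite vl_io ?polyC_eq0 // size_polyC c0 /= oppr0. Qed.

Lemma frac_repr (x : {fraction {poly F}}) :
  exists a b : {poly F}, b != 0 /\ x = FracField.tofrac a / FracField.tofrac b.
Proof.
exists (frac (generic_quotient.repr x)).1, (frac (generic_quotient.repr x)).2.
have d0 := denom_ratioP (generic_quotient.repr x); split=> //.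
apply: (mulIf (x := FracField.tofrac (frac (generic_quotient.repr x)).2)); first by rewrite tofrac_eq0.
rewrite divfK ?tofrac_eq0 //.
rewrite -{1}[x]generic_quotient.reprK; unlock FracField.tofrac.
rewrite -[LHS]FracField.pi_mul; apply/generic_quotient.eqmodP.
by rewrite /= FracField.equivfE /FracField.mulf !numden_Ratio ?oner_neq0 ?mulr1 // mulrC.
Qed.

Lemma Kinf_emb x : Kinf (emb x).
Proof. by apply: vclosure_id => //; exists x. Qed.

Lemma Kinf_io a : Kinf (io a). Proof. exact: Kinf_emb. Qed.

Lemma KinfB x y : Kinf x -> Kinf y -> Kinf (x - y).
Proof.
by apply: vclosureB => // _ _ [a _ <-] [b _ <-]; exists (a - b); rewrite // rmorphB.
Qed.

Lemma KinfM x y : Kinf x -> Kinf y -> Kinf (x * y).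
Proof.
by apply: vclosureM => // _ _ [a _ <-] [b _ <-]; exists (a * b); rewrite // rmorphM.
Qed.

Lemma KinfV x : Kinf x -> Kinf x^-1.
Proof.
by apply: vclosureV => // _ [a _ <-]; exists (a^-1); rewrite // fmorphV.
Qed.

Lemma Kinf0 : Kinf 0. Proof. by rewrite -(rmorph0 emb); apply: Kinf_emb. Qed.
Lemma Kinf1 : Kinf 1. Proof. by rewrite -(rmorph1 emb); apply: Kinf_emb. Qed.

Lemma KinfN x : Kinf x -> Kinf (- x).
Proof. by move=> h; rewrite -sub0r; apply: KinfB => //; exact: Kinf0. Qed.

Lemma KinfD x y : Kinf x -> Kinf y -> Kinf (x + y).
Proof. by move=> hx /KinfN hy; rewrite -[y]opprK; apply: KinfB. Qed.

Lemma Kinf_div x y : Kinf x -> Kinf y -> Kinf (x / y).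
Proof. by move=> hx /KinfV; apply: KinfM. Qed.

Lemma Kinf_dense x M : Kinf x -> exists a b : {poly F}, b != 0 /\ vge M (x - io a / io b).
Proof.
move=> /(vclosureP _ vv) /(_ M) [_ [y _ <-] h]; have [a [b [b0 yE]]] := frac_repr y.
by exists a, b; split=> //; move: h; rewrite yE fmorph_div.
Qed.

Lemma Kinf_round x : Kinf x -> exists a, vge 1 (x - io a).
Proof.
move=> /(Kinf_dense 1) [a [b [b0 h]]]; exists (a %/ b).
have -> : x - io (a %/ b) = (x - io a / io b) + io (a %% b) / io b.
  rewrite {2}(divp_eq a b) rmorphD rmorphM /=; field.
  by rewrite -[emb _]/(io b) io_eq0.
apply: vgeD => //.
have [->|m0] := eqVneq (a %% b) 0; first by left; rewrite rmorph0 mul0r.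
right; rewrite vl_div ?io_eq0 // !vl_io //.
have : (size (a %% b)%R < size b)%N by rewrite ltn_modp.
move: m0; rewrite -size_poly_gt0; case: (size _) => // n _; case: (size b) => //= m.
rewrite ltnS => nm; have : n.+1%:R <= m%:R :> R by rewrite ler_nat.
by rewrite -natr1; lra.
Qed.

Lemma Kinf_int x : Kinf x -> x != 0 -> exists n : int, vl x = n%:~R.
Proof.
move=> Kx x0; have [a [b [b0 h]]] := Kinf_dense (vl x + 1) Kx.
have [||y0 <-] := vge_near (vv) (y := io a / io b) (M := vl x + 1) x0; first by lra.
  by apply/vgeBC.
have a0 : a != 0.
  by apply: contraNneq y0 => ->; rewrite rmorph0 mul0r.
exists ((size b).-1%:Z - (size a).-1%:Z).
by rewrite vl_div ?io_eq0 // !vl_io // rmorphB /=; ring.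
Qed.

Lemma Kinf_residue x : Kinf x -> vge 0 x -> exists c : F, vge 1 (x - io c%:P).
Proof.
move=> /Kinf_round[a ha] x0; exists a`_0; suff -> : (a`_0)%:P = a by [].
apply/esym/size1_polyC; have [->|a0] := eqVneq a 0; first by rewrite size_poly0.
have : vge 0 (io a).
  have -> : io a = x - (x - io a) by ring.
  by apply: vgeB => //; apply: vgeW ha; lra.
move=> /vge_nz; rewrite io_eq0 => /(_ a0); rewrite vl_io // oppr_ge0 lern0.
by case: (size a) => [|[]].
Qed.

Lemma Omega_far z : Omega emb v z -> exists m : nat, forall x, Kinf x -> (v (z - x)%R <= (m%:R)%:E)%E.
Proof.
move=> Oz; have [M hM] : exists M, forall y, range emb y -> ~ vge M (z - y).
  apply: contrapT => no; apply: Oz; apply/(vclosureP _ vv) => M.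
  by apply: contrapT => no'; apply: no; exists M => y Ky h; apply: no'; exists y.
have [m hm] : exists m : nat, M <= m%:R.
  by exists (Num.bound `|M|); rewrite (le_trans (ler_norm _)) // ltW // archi_boundP.
exists m => x Kx; apply: contrapT => /vge_gt /(vgt_vge vv) h.
have /(vclosureP _ vv) /(_ m%:R) [y Ky h'] := Kx; apply: (hM y Ky).
have -> : z - y = (z - x) + (x - y) by ring.
by apply: (vgeW hm); apply: vgeD.
Qed.

Lemma pchar_C p : p \in [pchar F] -> p \in [pchar C].
Proof.
move=> h; have : p \in [pchar {poly F}] by rewrite pchar_poly.
move=> h'; have := rmorph_pchar io h'; exact.
Qed.

Lemma C_closed (p : {poly C}) : (1 < size p)%N -> exists x, root p x.
Proof.
have [_ vc rt ds] := hC; have [q _ /pchar_C qC] := finPcharP F.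
have Kdiv x y : Kinf x -> Kinf y -> Kinf (x / y) by exact: Kinf_div.
apply: (closed_root vv vc ds).
- move=> f h f0 fS hf sh.
  apply: (algebraic_coef_root qC Kinf1 KinfB Kdiv _ rt f0 fS hf sh).
  exists (fun n => io ('X ^+ n)); split; last by move=> n; exact: Kinf_io.
  move=> a b /io_inj /(congr1 (fun q : {poly F} => size q)).
  by rewrite !size_polyXn => -[].
- exact: Kinf1.
- exact: KinfB.
Qed.

Lemma C_splits (p : {poly C}) : exists s, p = lead_coef p *: \prod_(a <- s) ('X - a%:P).
Proof. by apply: splits_of_roots => h _; apply: C_closed. Qed.

End Infinity.

(** * Mean value inequalities *)

Section Harmonic.
Context {R : realType} {F : finFieldType} {C : fieldType}.
Variables (emb : {rmorphism {fraction {poly F}} -> C}) (v : C -> \bar R).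
Hypothesis hC : completed_algebraic_closure v (range emb).
Hypothesis hv : extends_infty_valuation emb v.

Local Notation vl := (vl v).
Local Notation vge := (vge v).
Local Notation Kinf := (Kinfty emb v).
Local Notation io := (coefA emb).
Let vv := vv hC.
Hint Resolve vv : core.

(** In multiplicative terms |z|_i >= q^(-s), where |z|_i, the distance from z to K_infty, plays the
    role of the imaginary part. *)
Definition level (s : R) (z : C) : Prop :=
  forall x, Kinf x -> z - x != 0 /\ vl (z - x) <= s.

(* |z| = |z|_i, with valuation s *)
Definition apartment (s : R) (z : C) : Prop := vl z = s /\ level s z.

Lemma level_le s s' z : s <= s' -> level s z -> level s' z.
Proof. by move=> le h x /h[nz l]; split=> //; apply: le_trans le. Qed.

Lemma level_n0 s z : level s z -> z != 0 /\ vl z <= s.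
Proof. by move=> /(_ 0 (Kinf0 hC)); rewrite subr0. Qed.

Lemma affinoidP m z : Omega_affinoid emb v m z <-> vge (- m%:R) z /\ level m%:R z.
Proof.
split=> -[h1 h2]; split.
- by apply/vgeP.
- by move=> x Kx; apply/vleP => //; apply: h2.
- by apply/vgeP.
- by move=> x /h2 [nz h]; apply/vleP.
Qed.

Lemma level_Omega s z : level s z -> Omega emb v z.
Proof. by move=> h /h[]; rewrite subrr eqxx. Qed.

Lemma Omega_level z : Omega emb v z -> exists m : nat, level m%:R z.
Proof. by move=> /(Omega_far hC)[m h]; exists m => x /h /(vleP vv). Qed.

Lemma finF_expC (c : F) N : io c%:P ^+ (#|F| ^ N) = io c%:P.
Proof.
by elim: N => // N IH; rewrite expnSr exprM IH -rmorphXn -polyC_exp expf_card.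
Qed.

(** These are the elements outside F of a finite subfield of C containing F. The nonzero elements of
    a finite field are roots of unity, so they and their nonzero differences have valuation 0. *)
Lemma unit_family (n : nat) : exists s : seq C,
  [/\ (n <= size s)%N, forall u, u \in s -> u != 0 /\ vl u = 0,
      forall u u', u \in s -> u' \in s -> u != u' -> vl (u - u') = 0,
      forall u c, u \in s -> u - io c%:P != 0 /\ vl (u - io c%:P) = 0 & uniq s].
Proof.
have q1 : (1 < #|F|)%N by apply: finNzRing_gt1.
(* The subfield of order #|F|^N keeps at least n elements after those of F are removed. *)
pose N := (n + #|F|)%N; pose q := (#|F| ^ N)%N.
have qN : (n + #|F| <= q)%N by rewrite ltnW // ltn_expl.
have q2 : (1 < q)%N by rewrite (leq_trans q1) // (leq_trans _ qN) // leq_addl.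
have [p pr pF] := finPcharP F; have pC := pchar_C emb pF.
have qpow : exists k, q = (p ^ k)%N.
  have [k ek] : exists k, #|F| = (p ^ k)%N by rewrite (card_pprimeChar pF); eexists.
  by exists (k * N)%N; rewrite /q ek expnM.
pose P : {poly C} := 'X^q - 'X.
have szP : size P = q.+1 by rewrite size_polyDl size_polyXn // size_polyN size_polyX.
have monP : lead_coef P = 1.
  by rewrite lead_coefDl ?lead_coefXn // size_polyXn size_polyN size_polyX.
have [s] := C_splits hC P; rewrite monP scale1r => Ps.
have us : uniq s.
  rewrite -separable_prod_XsubC -Ps unlock derivB derivXn derivX.
  rewrite -mulr_natl -polyC_natr.
  have -> : q%:R = 0 :> C.
    have [k qk] := qpow; case: k qk => [|k] qk; first by rewrite qk in q2.
    by rewrite qk natrX (pcharf0 pC) expr0n.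
  by rewrite mul0r sub0r -scaleN1r coprimepZr ?oppr_eq0 ?oner_neq0 // coprimep1.
have sz : size s = q by apply: succn_inj; rewrite -szP Ps size_prod_XsubC.
have rootE u : (u \in s) = (u ^+ q == u).
  by rewrite -root_prod_XsubC -Ps rootE !hornerE subr_eq0.
have unit u : u \in s -> u != 0 -> vl u = 0.
  rewrite rootE => /eqP uq u0; have := congr1 vl uq; rewrite vlX //.
  have : 2%:R <= q%:R :> R by rewrite ler_nat.
  move=> h e; have : vl u * (q%:R - 1) = 0 by rewrite mulrBr e mulr1 subrr.
  by move/eqP; rewrite mulf_eq0 => /orP[/eqP//|/eqP]; lra.
have sub u u' : u \in s -> u' \in s -> u - u' \in s.
  have [k qk] := qpow.
  by rewrite !rootE => /eqP e /eqP e'; rewrite {1}qk exprB_pchar // -qk e e'.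
have ioS c : io c%:P \in s by rewrite rootE finF_expC.
pose T := [seq io c%:P | c <- enum F].
have sT : size T = #|F| by rewrite size_map -cardE.
exists [seq u <- s | u \notin T]; split.
- rewrite size_filter; move: sz; rewrite -(count_predC (mem T)).
  have : (count (mem T) s <= size T)%N.
    rewrite -size_filter; apply: uniq_leq_size; first exact: filter_uniq.
    by move=> u; rewrite mem_filter => /andP[].
  rewrite sT; move: qN; rewrite -[count [predC mem T] s]/(count (fun u => u \notin T) s).
  by move: (count _ s) (count _ s) => a b; lia.
- move=> u; rewrite mem_filter => /andP[nT us']; have u0 : u != 0.
    apply: contraNneq nT => ->; apply/mapP; exists 0; rewrite ?mem_enum //.
    by rewrite polyC0 rmorph0.
  by split=> //; exact: unit.
- move=> u u'; rewrite !mem_filter => /andP[_ h] /andP[_ h'] ne.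
  by apply: unit; [exact: sub|rewrite subr_eq0].
- move=> u c; rewrite mem_filter => /andP[nT us'].
  have nz : u - io c%:P != 0.
    rewrite subr_eq0; apply: contraNneq nT => ->; apply/mapP.
    by exists c; rewrite ?mem_enum.
  by split=> //; apply: unit => //; apply: sub.
- exact: filter_uniq.
Qed.

(** The residue field of K_infty is F, so a unit with residue outside F is at distance 1 from
    K_infty. *)
Lemma residue_level u : u != 0 -> vl u = 0 ->
  (forall c : F, u - io c%:P != 0 /\ vl (u - io c%:P) = 0) -> level 0 u.
Proof.
move=> u0 vu h x Kx.
have [[x0 lt]|ge] : (x != 0 /\ vl x < 0) \/ vge 0 x.
  have [->|x0] := eqVneq x 0; first by right; left.
  by have [lt|ge] := ltP (vl x) 0; [left|right; right].
- have [|nz e] := vl_sub_eq vv (y := u) x0; first by right; rewrite vu.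
  by rewrite -oppr_eq0 opprB nz -vlN // opprB e; split=> //; exact: ltW.
have [c hc] := Kinf_residue hC hv Kx ge; have [nz e] := h c.
have [||nz' e'] := vge_near vv (y := u - x) (M := 1) nz; first by rewrite e.
  by have -> : u - x - (u - io c%:P) = - (x - io c%:P) by [ring]; apply/vgeN.
by rewrite nz' e' e.
Qed.

(* A point at distance exactly |r| from c which is at least as far from K_infty
   and from the points of A as c is, up to the radius |r|. *)
Lemma generic_point (A : seq C) c r : Kinf c -> Kinf r -> r != 0 ->
  exists w, [/\ apartment (vl r) (w - c), level (vl r) w &
    forall al, al \in A -> [/\ w - al != 0, vl (w - al) <= vl r &
      al - c != 0 -> vl (w - al) <= vl (al - c)]].
Proof.
move=> Kc Kr r0; have [s [ss s0 sd sF us]] := unit_family (size A).+1.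
pose y al := (al - c) / r.
(* Pigeonhole: an element al excludes at most one u, as two excluded ones would have the same
   residue, and s has more elements than A. *)
have [u us' hu] : exists2 u, u \in s & forall al, al \in A ->
    u - y al != 0 /\ vl (u - y al) <= 0.
  apply: contrapT => no.
  have bad u : u \in s -> exists al, al \in A /\ vge 0 (u - y al) /\
      ~ (u - y al != 0 /\ vl (u - y al) <= 0).
    move=> us'; apply: contrapT => h; apply: no; exists u => // al alA.
    apply: contrapT => n; apply: h; exists al; split=> //; split=> //.
    have [->|nz] := eqVneq (u - y al) 0; first by left.
    right; rewrite ltW // ltNge; apply/negP => le; exact: n.
  have [f hf] : exists f, forall u, u \in s -> f u \in A /\
      ~ (u - y (f u) != 0 /\ vl (u - y (f u)) <= 0).
    have /choice[f hf] : forall u, exists al, u \in s -> al \in A /\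
      ~ (u - y al != 0 /\ vl (u - y al) <= 0).
      move=> u; have [us'|_] := boolP (u \in s); last by exists 0.
      by have [al [? [_ ?]]] := bad _ us'; exists al.
    by exists f.
  have fI : {in s &, injective f}.
    move=> u u' us1 us2 e; apply/eqP; apply: contrapT => /negP ne.
    have pos w z : ~ (w - z != 0 /\ vl (w - z) <= 0) -> w - z = 0 \/ 0 < vl (w - z).
      have [->|nz] := eqVneq (w - z) 0; first by left.
      by move=> n; right; rewrite ltNge; apply/negP => le; apply: n.
    have vu := sd _ _ us1 us2 ne; have nz : u - u' != 0 by rewrite subr_eq0.
    have [_ /pos p1] := hf _ us1; have [_ /pos p2] := hf _ us2.
    rewrite e in p1; have E : u - u' = (u - y (f u')) - (u' - y (f u')) by ring.
    move: p1 p2 E; move: (u - y _) (u' - y _) => a b pa pb E.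
    have [M M0 [Ma Mb]] : exists2 M, 0 < M & vge M a /\ vge M b.
      case: pa pb => [->|pa] [->|pb].
      - by exists 1 => //; split; left.
      - by exists (vl b) => //; split; [left|right].
      - by exists (vl a) => //; split; [right|left].
      - exists (Order.min (vl a) (vl b)); first by rewrite lt_min pa pb.
        by split; right; rewrite ge_min lexx ?orbT.
    have h : vge M (u - u') by rewrite E; apply: vgeB.
    by exfalso; have := vge_nz nz h; rewrite vu; lra.
  have : (size [seq f u | u <- s] <= size A)%N.
    apply: uniq_leq_size; first by rewrite map_inj_in_uniq.
    by move=> _ /mapP[u us1 ->]; have [] := hf _ us1.
  by rewrite size_map leqNgt (leq_trans _ ss).
have [u0 vu] := s0 _ us'.
have lu : level 0 u by apply: residue_level => // c'; apply: sF.
exists (c + r * u).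
have scale x : x = r * (x / r) by rewrite mulrCA divff // mulr1.
have lev d : Kinf d -> level (vl r) (d + r * u).
  move=> Kd x Kx; have [nz le] := lu ((x - d) / r) (Kinf_div hC (KinfB hC Kx Kd) Kr).
  have -> : d + r * u - x = r * (u - (x - d) / r) by field.
  by rewrite mulf_neq0 // vlM //; split=> //; lra.
split.
- rewrite addrAC subrr; split; first by rewrite add0r vlM // vu addr0.
  by have := lev 0 (Kinf0 hC).
- exact: lev.
move=> al alA; have [nz le] := hu _ alA.
have E : c + r * u - al = r * (u - y al) by rewrite /y; field.
rewrite E mulf_neq0 // vlM //; split=> //; first by lra.
move=> ac; have y0 : y al != 0 by rewrite mulf_neq0 // invr_eq0.
have -> : vl (al - c) = vl r + vl (y al) by rewrite /y vl_div //; ring.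
rewrite lerD2l leNgt; apply/negP => lt.
have [h|h] := ltP 0 (vl (y al)); first by lra.
have E2 : u = y al + (u - y al) by ring.
have [|_ e2] := vl_add_eq vv (y := u - y al) (x := y al) y0; first by right.
by move: e2; rewrite -E2 vu; lra.
Qed.

End Harmonic.

(** * Rational functions without poles on an affinoid *)

Section Rational.
Context {R : realType} {F : finFieldType} {C : fieldType}.
Variables (emb : {rmorphism {fraction {poly F}} -> C}) (v : C -> \bar R).
Hypothesis hC : completed_algebraic_closure v (range emb).
Hypothesis hv : extends_infty_valuation emb v.

Local Notation vl := (vl v).
Local Notation vge := (vge v).
Local Notation Kinf := (Kinfty emb v).
Local Notation aff := (Omega_affinoid emb v).
Let vv := vv hC.
Hint Resolve vv : core.

(* Elements at which a function without poles on the m-th affinoid may have a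
   pole. *)
Definition outside (m : nat) (be : C) : Prop :=
  (be != 0 /\ vl be < - m%:R) \/
  exists x, Kinf x /\ (be = x \/ m%:R < vl (be - x)).

Lemma not_affinoid m be : ~ aff m be -> outside m be.
Proof.
move=> na; apply: contrapT => no; apply: na; apply/(affinoidP hC); split.
  have [->|b0] := eqVneq be 0; first by left.
  by right; rewrite leNgt; apply/negP => lt; apply: no; left.
move=> x Kx; split.
  by apply/eqP => /eqP; rewrite subr_eq0 => /eqP e; apply: no; right; exists x; split=> //; left.
by rewrite leNgt; apply/negP => lt; apply: no; right; exists x; split=> //; right.
Qed.

Lemma outside_sub m be z : aff m z -> outside m be -> z - be != 0 /\ vl (z - be) <= m%:R.
Proof.
move=> /(affinoidP hC)[zm lz] [[b0 lt]|[x [Kx h]]].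
  rewrite -opprB oppr_eq0 vlN //.
  have [|-> ->] := vl_sub_eq vv (y := z) b0.
    by case: zm => [->|h]; [left|right; apply: lt_le_trans h].
  by split=> //; have := ler0n R m; lra.
have [nz le] := lz _ Kx; have -> : z - be = (z - x) - (be - x) by ring.
have [|-> ->] := vl_sub_eq vv (y := be - x) nz; last by [].
by case: h => [->|h]; [left; rewrite subrr|right; apply: le_lt_trans h].
Qed.

Definition no_pole (m : nat) (Q : {poly C}) : Prop := forall z, aff m z -> Q.[z] != 0.

Lemma horner_splits (P : {poly C}) s z :
  P = lead_coef P *: \prod_(a <- s) ('X - a%:P) ->
  P.[z] = lead_coef P * \prod_(a <- s) (z - a).
Proof.
move=> ->; rewrite hornerZ horner_prod lead_coefZ.
rewrite (monicP (monic_prod_XsubC _ _ _)) mulr1.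
by under eq_bigr do rewrite hornerXsubC.
Qed.

Lemma no_pole_outside m Q s : no_pole m Q ->
  Q = lead_coef Q *: \prod_(a <- s) ('X - a%:P) ->
  forall be, be \in s -> outside m be.
Proof.
move=> np Qs be bs; apply: not_affinoid => /np; rewrite (horner_splits be Qs).
rewrite mulf_eq0 negb_or => /andP[_]; rewrite prodf_seq_neq0 => /allP/(_ _ bs).
by rewrite subrr eqxx.
Qed.

Lemma rational_bounded m (P Q : {poly C}) : no_pole m Q ->
  exists B, forall z, aff m z -> vge B (P.[z] / Q.[z]).
Proof.
move=> np; have [s Qs] := C_splits hC Q.
have [M hM] : exists M, forall j, vge M P`_j.
  have [M hM] : exists M, forall j, (j < size P)%N -> vge M P`_j.
    elim: (size P) => [|k [M IH]]; first by exists 0.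
    exists (Order.min M (vl P`_k)) => j; rewrite ltnS leq_eqVlt => /orP[/eqP->|/IH].
      by right; rewrite ge_min lexx orbT.
    by apply: vgeW; rewrite ge_min lexx.
  exists M => j; have [/hM//|sj] := ltnP j (size P).
  by rewrite nth_default //; left.
exists ((M - m%:R * (size P)%:R) - (vl (lead_coef Q) + m%:R * (size s)%:R)) => z az.
have [zm lz] := (affinoidP hC m z).1 az.
apply: vgeM => //; first by apply: vge_horner.
have Qz := np _ az; right; rewrite vlV // lerN2; move: (Qz); rewrite (horner_splits z Qs).
rewrite mulf_eq0 negb_or => /andP[l0 p0]; rewrite vlM // lerD2l.
move: p0; rewrite prodf_seq_neq0 => /allP p0.
rewrite big_seq vl_prod //.
have -> : m%:R * (size s)%:R = \sum_(i <- s) m%:R :> R.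
  by rewrite big_const_seq count_predT iter_addr_0 mulr_natr.
rewrite [leRHS]big_seq; apply: ler_sum => be bs.
by have [] := outside_sub az (no_pole_outside np Qs bs).
Qed.

Section Weights.
Variables (I : finType) (e : I -> R) (m : nat) (z0 : C) (T : I -> C -> Prop).
Hypothesis e1 : \sum_o e o = 1.
Hypothesis e0 : forall o, 0 <= e o.
Hypothesis az0 : aff m z0.

(* Test points W o in T o, where a rational function without poles on the m-th
   affinoid has a weighted mean valuation at most its valuation at z0; these are
   produced by treating one root at a time. *)
Hypothesis test : forall A : seq C, exists W : I -> C,
  [/\ forall o, T o (W o) /\ aff m (W o),
      forall al, al \in A -> z0 - al != 0 ->
        (forall o, W o - al != 0) /\ \sum_o e o * vl (W o - al) <= vl (z0 - al) &
      forall be, outside m be -> vl (z0 - be) <= \sum_o e o * vl (W o - be)].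

Lemma rational_mean (P Q : {poly C}) : no_pole m Q -> exists W : I -> C,
  (forall o, T o (W o) /\ aff m (W o)) /\
  (P.[z0] = 0 \/ (forall o, P.[W o] != 0) /\
     \sum_o e o * vl (P.[W o] / Q.[W o]) <= vl (P.[z0] / Q.[z0])).
Proof.
move=> np; have [sP Ps] := C_splits hC P; have [sQ Qs] := C_splits hC Q.
have [W [hT hr hp]] := test sP; exists W; split=> //.
have [->|Pz0] := eqVneq P.[z0] 0; [by left|right].
have Qz0 := np _ az0; have QW o : Q.[W o] != 0 by apply: np; case: (hT o).
have /andP[lP] : (lead_coef P != 0) && (\prod_(a <- sP) (z0 - a) != 0).
  by rewrite -negb_or -mulf_eq0 -(horner_splits z0 Ps).
rewrite prodf_seq_neq0 => /allP /= pP.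
have PW o : P.[W o] != 0.
  rewrite (horner_splits _ Ps) mulf_neq0 // prodf_seq_neq0; apply/allP => al als /=.
  by case: (hr al als (pP _ als)).
split=> //.
have vP z : P.[z] != 0 -> vl P.[z] = vl (lead_coef P) + \sum_(a <- sP) vl (z - a).
  rewrite (horner_splits z Ps) mulf_eq0 negb_or => /andP[l0 p0]; rewrite vlM //.
  congr (_ + _); move: p0; rewrite prodf_seq_neq0 => /allP p0.
  by rewrite big_seq vl_prod // -big_seq.
have vQ z : Q.[z] != 0 -> vl Q.[z] = vl (lead_coef Q) + \sum_(a <- sQ) vl (z - a).
  rewrite (horner_splits z Qs) mulf_eq0 negb_or => /andP[l0 p0]; rewrite vlM //.
  congr (_ + _); move: p0; rewrite prodf_seq_neq0 => /allP p0.
  by rewrite big_seq vl_prod // -big_seq.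
rewrite vl_div // vP // vQ //.
have -> : \sum_o e o * vl (P.[W o] / Q.[W o]) =
    (vl (lead_coef P) + \sum_(a <- sP) \sum_o e o * vl (W o - a)) -
    (vl (lead_coef Q) + \sum_(a <- sQ) \sum_o e o * vl (W o - a)).
  rewrite -[vl (lead_coef P)]mul1r -[vl (lead_coef Q)]mul1r -e1 !mulr_suml.
  rewrite ![\sum_(a <- _) \sum_o _]exchange_big /= -!big_split /= -sumrB.
  apply: eq_bigr => o _; rewrite vl_div // vP // vQ // -!mulr_sumr; ring.
apply: lerB; rewrite lerD2l big_seq [leRHS]big_seq; apply: ler_sum => a ia.
  by case: (hr a ia (pP _ ia)).
exact: hp (no_pole_outside np Qs ia).
Qed.

Lemma analytic_mean (h : C -> C) (b : I -> R) :
  (forall M, exists P Q, forall z, aff m z -> Q.[z] != 0 /\ vge M (h z - P.[z] / Q.[z])) ->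
  (forall o w, T o w -> aff m w -> vge (b o) (h w)) ->
  vge (\sum_o e o * b o) (h z0).
Proof.
(* The precision M is at least the bound claimed at z0 and at least every [b o], so h may be
   replaced by P / Q at z0 and at the test points. *)
move=> happ hb; pose M := Order.max (\sum_o e o * b o) (\sum_o `|b o|).
have [P [Q hPQ]] := happ M.
have np : no_pole m Q by move=> z /hPQ[].
have [W [hT hW]] := rational_mean P np.
have Mb o : b o <= M.
  rewrite le_max; apply/orP; right; rewrite (le_trans (ler_norm _)) //.
  by rewrite (bigD1 o) //= lerDl sumr_ge0.
have -> : h z0 = (h z0 - P.[z0] / Q.[z0]) + P.[z0] / Q.[z0] by ring.
apply: vgeD => //.
  by have [_] := hPQ _ az0; apply: vgeW; rewrite le_max lexx.
case: hW => [->|[PW hW]]; first by rewrite mul0r; left.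
right; apply: le_trans hW; apply: ler_sum => o _; apply: ler_wpM2l => //.
have [To aW] := hT o; have [QW hM] := hPQ _ aW.
apply: vge_nz; first by rewrite mulf_neq0 ?invr_eq0.
have -> : P.[W o] / Q.[W o] = h (W o) - (h (W o) - P.[W o] / Q.[W o]) by ring.
apply: vgeB => //; first exact: hb.
exact: vgeW (Mb o) hM.
Qed.

End Weights.

Definition approximable (m : nat) (h : C -> C) : Prop :=
  forall M, exists P Q : {poly C}, forall z, aff m z ->
    Q.[z] != 0 /\ vge M (h z - P.[z] / Q.[z]).

Lemma rigid_approximable h m : rigid_analytic emb v h -> approximable m h.
Proof.
move=> ra M; have [P [Q hPQ]] := ra m M; exists P, Q => z /hPQ[nz lt]; split=> //.
exact: (vgt_vge vv).
Qed.

Lemma approximable_rigid h : (forall m, approximable m h) -> rigid_analytic emb v h.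
Proof.
move=> ra m M; have [P [Q hPQ]] := ra m (M + 1); exists P, Q => z /hPQ[nz ge].
by split=> //; apply: vge_vgt ge => //; lra.
Qed.

Lemma approximable_bounded m h : approximable m h ->
  exists B, forall z, aff m z -> vge B (h z).
Proof.
move=> /(_ 0)[P [Q hPQ]]; have [|B hB] := @rational_bounded m P Q.
  by move=> z /hPQ[].
exists (Order.min 0 B) => z az; have [_ h0] := hPQ _ az.
have -> : h z = (h z - P.[z] / Q.[z]) + P.[z] / Q.[z] by ring.
apply: vgeD => //; first by apply: vgeW h0; rewrite ge_min lexx.
by apply: vgeW (hB _ az); rewrite ge_min lexx orbT.
Qed.

Lemma approximableD m h h' : approximable m h -> approximable m h' ->
  approximable m (fun z => h z + h' z).
Proof.
move=> ah ah' M; have [P [Q hPQ]] := ah M; have [P' [Q' hPQ']] := ah' M.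
exists (P * Q' + P' * Q), (Q * Q') => z az.
have [nz g] := hPQ _ az; have [nz' g'] := hPQ' _ az.
rewrite hornerD !hornerM mulf_neq0 //; split=> //.
have -> : h z + h' z - (P.[z] * Q'.[z] + P'.[z] * Q.[z]) / (Q.[z] * Q'.[z]) =
  (h z - P.[z] / Q.[z]) + (h' z - P'.[z] / Q'.[z]) by field; rewrite nz nz'.
exact: vgeD.
Qed.

Lemma approximableZ m c h : approximable m h -> approximable m (fun z => c * h z).
Proof.
move=> ah M; have [P [Q hPQ]] := ah (M - vl c).
exists (c *: P), Q => z /hPQ[nz g]; split=> //; rewrite hornerZ.
have -> : c * h z - c * P.[z] / Q.[z] = c * (h z - P.[z] / Q.[z]) by ring.
by have -> : M = vl c + (M - vl c) by [ring]; apply: vgeM => //; apply: vge_val.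
Qed.

End Rational.

(** * Mean values at the vertices and on the edges of the apartment *)

Section MeanValue.
Context {R : realType} {F : finFieldType} {C : fieldType}.
Variables (emb : {rmorphism {fraction {poly F}} -> C}) (v : C -> \bar R).
Hypothesis hC : completed_algebraic_closure v (range emb).
Hypothesis hv : extends_infty_valuation emb v.

Local Notation vl := (vl v).
Local Notation vge := (vge v).
Local Notation Kinf := (Kinfty emb v).
Local Notation io := (coefA emb).
Local Notation level := (level emb v).
Local Notation apartment := (apartment emb v).
Local Notation aff := (Omega_affinoid emb v).
Let vv := vv hC.
Hint Resolve vv : core.

Local Notation t := (io 'X).

Lemma t_neq0 : t != 0. Proof. by rewrite io_eq0 polyX_eq0. Qed.

Lemma vl_t : vl t = -1.
Proof. by rewrite (vl_io hv) ?polyX_eq0 // size_polyX. Qed.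

Lemma Kinf_t : Kinf t. Proof. exact: Kinf_io. Qed.

Lemma vl_sub_same M w be x : w - x != 0 -> vl (w - x) <= M ->
  be = x \/ M < vl (be - x) -> w - be != 0 /\ vl (w - be) = vl (w - x).
Proof.
move=> nz le h; have -> : w - be = (w - x) - (be - x) by ring.
apply: vl_sub_eq => //; case: h => [->|h]; first by left; rewrite subrr.
by right; apply: le_lt_trans h.
Qed.

(* Relative to r in K_infty, the nonzero valuations of elements of K_infty are
   at most vl r - 1 or at least vl r. *)
Lemma Kinf_gap r x : Kinf r -> r != 0 -> Kinf x ->
  (x != 0 /\ vl x <= vl r - 1) \/ vge (vl r) x.
Proof.
move=> Kr r0 Kx; have [->|x0] := eqVneq x 0; first by right; left.
have [n hn] := Kinf_int hC hv (Kinf_div hC Kx Kr) (mulf_neq0 x0 (invr_neq0 r0)).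
rewrite vl_div // in hn; have [n0|n0] := ltP n 0.
  left; split=> //; have : n%:~R <= (-1)%:~R :> R by rewrite ler_int; lia.
  by rewrite -hn; lra.
right; right; have : 0%:~R <= n%:~R :> R by rewrite ler_int.
by rewrite -hn; lra.
Qed.

Lemma sum_option (f : option F -> R) : \sum_o f o = f None + \sum_c f (Some c).
Proof.
rewrite (bigD1 None) //=; congr (_ + _).
rewrite (reindex_omap Some id) /=; last by case.
by apply: eq_bigl => c; rewrite eqxx.
Qed.

Section Vertex.
Variables (r z0 : C) (m : nat).
Hypotheses (Kr : Kinf r) (r0 : r != 0).
Hypothesis hz0 : apartment (vl r) z0.
Hypotheses (hm1 : - m%:R <= vl r - 1) (hm2 : vl r + 1 <= m%:R).

(** The q + 1 neighbours of the vertex |z| = |r| in the tree: [None] points to the end at infinity,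
    [Some c] to the disc about c r. *)
Let T (o : option F) (w : C) : Prop :=
  if o is Some c then apartment (vl r + 1) (w - io c%:P * r)
  else apartment (vl r - 1) w.

Lemma apartment_aff s z : apartment s z -> - m%:R <= s -> s <= m%:R -> aff m z.
Proof.
move=> [vz lz] h1 h2; apply/(affinoidP hC); split; last exact: level_le lz.
by right; rewrite vz.
Qed.

Lemma vge_cr (c : F) : vge (vl r) (io c%:P * r).
Proof.
have [->|c0] := eqVneq c 0; first by left; rewrite polyC0 rmorph0 mul0r.
by right; rewrite vlM ?io_eq0 ?polyC_eq0 // (vl_ioC hv) // add0r.
Qed.

(** The test points are generic in the neighbouring discs. For a zero no larger than r the neighbour
    towards infinity loses 1 and at most one other gains 1. A pole is either far from 0, where
    nothing varies, or so close to some x in K_infty that it may be replaced by x, for which the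
    gain of 1 does occur if |x| <= |r|. *)
Lemma vertex_test (A : seq C) : exists W : option F -> C,
  [/\ forall o, T o (W o) /\ aff m (W o),
      forall al, al \in A -> z0 - al != 0 ->
        (forall o, W o - al != 0) /\
        \sum_o (#|F|.+1%:R)^-1 * vl (W o - al) <= vl (z0 - al) &
      forall be, outside emb v m be ->
        vl (z0 - be) <= \sum_o (#|F|.+1%:R)^-1 * vl (W o - be)].
Proof.
have [km1 km2] := (hm1, hm2).
pose cen (o : option F) := if o is Some c then io c%:P * r else 0.
pose rad (o : option F) := if o is Some c then r / t else r * t.
pose s (o : option F) := if o is Some c then vl r + 1 else vl r - 1.
have t0 := t_neq0; have vt := vl_t.
have Kcen o : Kinf (cen o).
  by case: o => [c|]; [apply: KinfM => //; apply: Kinf_io|exact: Kinf0].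
have rad0 o : rad o != 0 by case: o => [c|]; rewrite mulf_neq0 ?invr_eq0.
have vrad o : vl (rad o) = s o.
  by case: o => [c|]; rewrite /= ?vl_div // ?vlM // vt; ring.
have Krad o : Kinf (rad o).
  by case: o => [c|]; [apply: Kinf_div|apply: KinfM] => //; exact: Kinf_t.
have /choice[W hW] : forall o, exists w, [/\ apartment (s o) (w - cen o), level (s o) w &
    forall al, al \in A -> [/\ w - al != 0, vl (w - al) <= s o &
      al - cen o != 0 -> vl (w - al) <= vl (al - cen o)]].
  by move=> o; have := generic_point hC hv A (Kcen o) (Krad o) (rad0 o); rewrite vrad.
have vcen o : vge (vl r) (cen o) by case: o => [c|]; [exact: vge_cr|left].
have so o : s o <= m%:R by rewrite /s; case: o => [c|] /=; lra.
have Wge o : vge (Order.min (vl r) (s o)) (W o).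
  have [[e lc] _ _] := hW o.
  have -> : W o = (W o - cen o) + cen o by ring.
  apply: vgeD => //; first by right; rewrite e ge_min lexx orbT.
  by apply: vgeW (vcen o); rewrite ge_min lexx.
have aW o : aff m (W o).
  have [_ lw _] := hW o; apply/(affinoidP hC); split; last exact: level_le lw.
  apply: vgeW (Wge o); rewrite le_min; apply/andP; split; first by lra.
  by rewrite /s; case: (o) => [c|] /=; lra.
have [vz lz] := hz0; have [z00 _] := level_n0 hC lz.
have q0 : 0 < #|F|.+1%:R :> R by rewrite ltr0n.
have sumT := sum_option.
have sumC (a : R) : \sum_(c : F) a = a * #|F|%:R by rewrite sumr_const mulr_natr.
have cardS : #|F|.+1%:R = #|F|%:R + 1 :> R by rewrite -natr1.
have sep M x (c c' : F) : vl r < M -> vge M (x - io c%:P * r) ->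
    vge M (x - io c'%:P * r) -> c = c'.
  move=> lt h h'; apply/eqP; rewrite -subr_eq0; apply/negP => /negP d.
  have : vge M (io (c - c')%:P * r).
    have -> : io (c - c')%:P * r = (x - io c'%:P * r) - (x - io c%:P * r).
      by rewrite polyCB rmorphB; ring.
    exact: vgeB.
  move=> /vge_nz; rewrite mulf_neq0 ?io_eq0 ?polyC_eq0 // => /(_ isT).
  by rewrite vlM ?io_eq0 ?polyC_eq0 // (vl_ioC hv) // add0r; lra.
exists W; split.
- move=> o; split=> //; have [h _ _] := hW o; move: h.
  by case: o => [c|] //=; rewrite subr0.
- move=> al alA z0al; have nW o : W o - al != 0 by have [_ _ /(_ _ alA)[]] := hW o.
  split=> //; rewrite -mulr_sumr mulrC ler_pdivrMr // sumT.
  have leW o : vl (W o - al) <= s o by have [_ _ /(_ _ alA)[]] := hW o.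
  have leW' o : al - cen o != 0 -> vl (W o - al) <= vl (al - cen o).
    by have [_ _ /(_ _ alA)[]] := hW o.
  have [[al0 lt]|ge] : (al != 0 /\ vl al < vl r) \/ vge (vl r) al.
    have [->|al0] := eqVneq al 0; first by right; left.
    by have [lt|ge] := ltP (vl al) (vl r); [left|right; right].
  + have [|_ e] := vl_sub_eq vv (y := z0) al0; first by right; rewrite vz.
    rewrite -vlB // in e; rewrite e.
    have hc o : vl (W o - al) <= vl al.
      have [|nz <-] := vl_sub_eq vv (y := cen o) al0; last exact: leW'.
      by case: (vcen o) => [->|h]; [left|right; apply: lt_le_trans h].
    rewrite cardS mulrDr mulr1 addrC; apply: lerD => //.
    by rewrite -sumC; apply: ler_sum.
  have le0 : vl r <= vl (z0 - al).
    apply: vge_nz => //; apply: vgeB => //; right; by rewrite vz.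
  apply: (@le_trans _ _ (vl r * #|F|.+1%:R)); last by rewrite ler_pM2r.
  (* A gain at c puts al at distance less than |r| from c r. The points c r are |r| apart, so by
     [sep] only one c can gain. *)
  have bad c : vl r < vl (W (Some c) - al) ->
      vge (vl (W (Some c) - al)) (al - io c%:P * r).
    move=> lt; have [->|nz] := eqVneq (al - io c%:P * r) 0; first by left.
    by right; exact: (leW' (Some c)).
  rewrite cardS mulrDr mulr1 addrC.
  have leN := leW None; rewrite /= in leN.
  have [[c hc]|no] := pselect (exists c : F, vl r < vl (W (Some c) - al)).
    rewrite (bigD1 c) //=.
    have : \sum_(c' | c' != c) vl (W (Some c') - al) <= \sum_(c' : F | c' != c) vl r.
      apply: ler_sum => c' ne; rewrite leNgt; apply/negP => lt.
      move/negP: ne; apply; apply/eqP.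
      apply: (sep (Order.min (vl (W (Some c) - al)) (vl (W (Some c') - al))) al).
      + by rewrite lt_min hc lt.
      + by apply: vgeW (bad _ lt); rewrite ge_min lexx orbT.
      + by apply: vgeW (bad _ hc); rewrite ge_min lexx.
    have := sumC (vl r); rewrite (bigD1 c) //=.
    have leS := leW (Some c); rewrite /= in leS.
    move: (\sum_(c' | c' != c) vl (W (Some c') - al)) (\sum_(c' | c' != c) vl r).
    move: leS leN; rewrite /s; move: (vl r * _) => x0 l1 l2 x1 x2; lra.
  have : \sum_c vl (W (Some c) - al) <= \sum_(c : F) vl r.
    by apply: ler_sum => c _; rewrite leNgt; apply/negP => lt; apply: no; exists c.
  by rewrite sumC; move: leN; rewrite /s; lra.
- move=> be ob; rewrite -mulr_sumr mulrC ler_pdivlMr // sumT cardS mulrDr mulr1 addrC -sumC.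
  case: ob => [[b0 lt]|hx].
    have eqb w : vge (- m%:R) w -> vl (w - be) = vl be.
      move=> hw; rewrite -vlB //; have [|_ ->//] := vl_sub_eq vv (y := w) b0.
      by case: hw => [->|h]; [left|right; lra].
    rewrite (eqb z0); last by right; rewrite vz; lra.
    rewrite (eqb (W None)); last by case/(affinoidP hC): (aW None).
    apply: lerD => //; apply: ler_sum => c _; rewrite eqb //.
    by case/(affinoidP hC): (aW (Some c)).
  have [x [Kx h]] := hx.
  have eqx w s' : level s' w -> s' <= m%:R -> vl (w - be) = vl (w - x).
    move=> lw le; have [nz le'] := lw _ Kx.
    by have [_ ->] := vl_sub_same nz (le_trans le' le) h.
  have eqW o : vl (W o - be) = vl (W o - x).
    by have [_ lw _] := hW o; apply: eqx lw (so o).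
  have nzW o : W o - x != 0 by have [_ lw _] := hW o; case: (lw _ Kx).
  rewrite eqW (eqx _ (vl r)) //; last by lra.
  under [X in _ <= _ + X]eq_bigr do rewrite eqW.
  have [nz0 le0] := lz _ Kx.
  have [[x0 ltx]|gex] := Kinf_gap Kr r0 Kx.
    have ex w : vge (vl r) w -> vl (w - x) = vl x.
      move=> hw; rewrite -vlB //; have [|_ ->//] := vl_sub_eq vv (y := w) x0.
      by case: hw => [->|hw]; [left|right; lra].
    rewrite ex; last by right; rewrite vz.
    have geW o : vl x <= vl (W o - x).
      apply: vge_nz => //; apply: vgeB => //; last exact: vge_val.
      apply: vgeW (Wge o); rewrite le_min; apply/andP; split; first by lra.
      by rewrite /s; case: (o) => [c|] /=; lra.
    by apply: lerD => //; apply: ler_sum.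
  (* The residue c of x / r lies in F. The neighbour at c gains 1, which compensates the loss of at
     most 1 towards infinity, and no other neighbour loses. *)
  have [c hc] : exists c : F, vge (vl r + 1) (x - io c%:P * r).
    have xr : vge 0 (x / r).
      case: gex => [->|h0]; first by left; rewrite mul0r.
      have [->|x0] := eqVneq x 0; first by left; rewrite mul0r.
      by right; rewrite vl_div //; lra.
    have [c hc] := Kinf_residue hC hv (Kinf_div hC Kx Kr) xr; exists c.
    have -> : x - io c%:P * r = r * (x / r - io c%:P) by field.
    by apply: vgeM => //; apply: vge_val.
  have h1 : vl r - 1 <= vl (W None - x).
    apply: vge_nz => //; apply: vgeB => //; last by apply: vgeW gex; lra.
    by apply: vgeW (Wge None); rewrite /s le_min; apply/andP; split; lra.
  have h2 : vl r + 1 <= vl (W (Some c) - x).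
    apply: vge_nz => //.
    have -> : W (Some c) - x = (W (Some c) - cen (Some c)) - (x - io c%:P * r).
      by rewrite /cen; ring.
    apply: vgeB => //; have [[e _] _ _] := hW (Some c).
    by right; rewrite e.
  have h3 c' : vl r <= vl (W (Some c') - x).
    apply: vge_nz => //; apply: vgeB => //.
    by apply: vgeW (Wge (Some c')); rewrite /s le_min; apply/andP; split; lra.
  apply: (@le_trans _ _ (vl r + \sum_(c : F) vl r)); first by apply: lerD => //; apply: ler_sum.
  rewrite (bigD1 c) //= [in leRHS](bigD1 c) //=.
  have : \sum_(c' | c' != c) vl r <= \sum_(c' | c' != c) vl (W (Some c') - x).
    exact: ler_sum.
  move: (\sum_(c' | c' != c) vl (W (Some c') - x)) (\sum_(c' | c' != c) vl r) => a1 a2; lra.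
Qed.

Lemma vertex_mean (h : C -> C) b b' : approximable emb v m h ->
  (forall w, apartment (vl r - 1) w -> vge b (h w)) ->
  (forall (c : F) w, apartment (vl r + 1) (w - io c%:P * r) -> vge b' (h w)) ->
  vge ((b + b' * #|F|%:R) / #|F|.+1%:R) (h z0).
Proof.
have [km1 km2] := (hm1, hm2); move=> ah hb hb'.
have q0 : #|F|.+1%:R != 0 :> R by rewrite pnatr_eq0.
have cardO : #|{: option F}| = #|F|.+1 by rewrite card_option.
have key : vge (\sum_(o : option F) (#|F|.+1%:R)^-1 * (if o is Some _ then b' else b)) (h z0).
  apply: (analytic_mean hC (T := T) _ _ _ vertex_test ah).
  - by rewrite sumr_const cardO -[_ *+ _]mulr_natr mulVf.
  - by move=> o; rewrite invr_ge0.
  - by apply: (apartment_aff hz0); lra.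
  - by move=> [c|] w /= hw _; [exact: hb' hw|exact: hb].
by move: key; rewrite -mulr_sumr sum_option sumr_const -(mulr_natr b') mulrC.
Qed.

End Vertex.

Section Edge.
Variables (r z0 : C) (s : R) (m : nat).
Hypotheses (Kr : Kinf r) (r0 : r != 0).
Hypothesis hz0 : apartment s z0.
Hypotheses (hs1 : vl r - 1 < s) (hs2 : s < vl r).
Hypotheses (hm1 : - m%:R <= vl r - 1) (hm2 : vl r <= m%:R).

Let T (o : bool) (w : C) : Prop := apartment (vl r - o%:R) w.
(** The barycentric coordinates of s between vl r - 1 ([true]) and vl r ([false]). *)
Let e (o : bool) : R := if o then vl r - s else 1 - (vl r - s).

Lemma edge_test (A : seq C) : exists W : bool -> C,
  [/\ forall o, T o (W o) /\ aff m (W o),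
      forall al, al \in A -> z0 - al != 0 ->
        (forall o, W o - al != 0) /\
        \sum_o e o * vl (W o - al) <= vl (z0 - al) &
      forall be, outside emb v m be ->
        vl (z0 - be) <= \sum_o e o * vl (W o - be)].
Proof.
have [[ks1 ks2] [km1 km2]] := ((hs1, hs2), (hm1, hm2)).
have t0 := t_neq0; have vt := vl_t.
pose rad (o : bool) := if o then r * t else r.
have rad0 o : rad o != 0 by case: o; rewrite // mulf_neq0.
have vrad o : vl (rad o) = vl r - o%:R.
  by case: o; rewrite /= ?vlM // ?vt ?subr0.
have Krad o : Kinf (rad o) by case: o => //; apply: KinfM => //; exact: Kinf_t.
have /choice[W hW] : forall o : bool, exists w, [/\ apartment (vl r - o%:R) w,
    level (vl r - o%:R) w &
    forall al, al \in A -> [/\ w - al != 0, vl (w - al) <= vl r - o%:R &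
      al != 0 -> vl (w - al) <= vl al]].
  move=> o; have [w [h1 h2 h3]] := generic_point hC hv A (Kinf0 hC) (Krad o) (rad0 o).
  rewrite subr0 vrad in h1; rewrite vrad in h2; exists w; split=> // al /h3.
  by rewrite subr0 vrad.
have so (o : bool) : 0 <= o%:R :> R /\ o%:R <= 1 :> R by case: o; split=> //; rewrite ?ler01.
have aW o : aff m (W o).
  by have [h _ _] := hW o; have [? ?] := so o; apply: (apartment_aff h); lra.
have [vz lz] := hz0.
have big2 (f : bool -> R) : \sum_o f o = f true + f false.
  by rewrite big_bool.
exists W; split.
- by move=> o; split=> //; have [] := hW o.
- move=> al alA z0al; split; first by move=> o; have [_ _ /(_ _ alA)[]] := hW o.
  rewrite big2 /=; have [_ _ /(_ _ alA)[_ a1 a2]] := hW true.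
  have [_ _ /(_ _ alA)[_ b1 b2]] := hW false.
  rewrite /= subr0 in b1; rewrite /= in a1.
  have [[al0 lt]|ge] : (al != 0 /\ vl al < s) \/ vge s al.
    have [->|al0] := eqVneq al 0; first by right; left.
    by have [lt|ge] := ltP (vl al) s; [left|right; right].
  + have [|_ E] := vl_sub_eq vv (y := z0) al0; first by right; rewrite vz.
    rewrite -vlB // in E; rewrite E.
    have := a2 al0; have := b2 al0; nra.
  have : s <= vl (z0 - al).
    by apply: vge_nz => //; apply: vgeB => //; right; rewrite vz.
  by nra.
- move=> be ob; rewrite big2 /=.
  case: ob => [[b0 lt]|hx].
    have eqb w : vge (- m%:R) w -> vl (w - be) = vl be.
      move=> hw; rewrite -vlB //; have [|_ ->//] := vl_sub_eq vv (y := w) b0.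
      by case: hw => [->|h]; [left|right; lra].
    rewrite (eqb z0); last by right; rewrite vz; lra.
    rewrite (eqb (W true)); last by case/(affinoidP hC): (aW true).
    rewrite (eqb (W false)); last by case/(affinoidP hC): (aW false).
    by lra.
  have [x [Kx h]] := hx.
  have eqx w s' : level s' w -> s' <= m%:R -> vl (w - be) = vl (w - x).
    move=> lw le; have [nz le'] := lw _ Kx.
    by have [_ ->] := vl_sub_same nz (le_trans le' le) h.
  have eqW o : vl (W o - be) = vl (W o - x).
    by have [_ lw _] := hW o; have [? ?] := so o; apply: eqx lw _; lra.
  have nzW o : W o - x != 0 by have [_ lw _] := hW o; case: (lw _ Kx).
  rewrite !eqW (eqx _ s) //; last by lra.
  have [nz0 le0] := lz _ Kx.
  have vW o : vl (W o) = vl r - o%:R by have [[]] := hW o.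
  have geW M (o : bool) : vge M x -> M <= vl r - o%:R -> M <= vl (W o - x).
    by move=> hM le; apply: vge_nz => //; apply: vgeB => //; right; rewrite vW.
  have [[x0 ltx]|gex] := Kinf_gap Kr r0 Kx.
    clear hx h.
    have E : vl (z0 - x) = vl x.
      rewrite -vlB //; have [|_ ->//] := vl_sub_eq vv (y := z0) x0.
      by right; rewrite vz; lra.
    rewrite E; have := geW (vl x) true (vge_val _ _); have := geW (vl x) false (vge_val _ _).
    rewrite /= subr0 => h1 h2.
    have k1 : vl x <= vl (W false - x) by apply: h1; lra.
    have k2 : vl x <= vl (W true - x) by apply: h2; lra.
    by nra.
  have k1 : vl r <= vl (W false - x) by apply: geW => //=; lra.
  have k2 : vl r - 1 <= vl (W true - x) by apply: geW => //=; apply: vgeW gex; lra.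
  by nra.
Qed.

Lemma edge_mean (h : C -> C) b : approximable emb v m h ->
  (forall w, apartment (vl r - 1) w -> vge b (h w)) ->
  (forall w, apartment (vl r) w -> vge b (h w)) -> vge b (h z0).
Proof.
have [[ks1 ks2] [km1 km2]] := ((hs1, hs2), (hm1, hm2)); move=> ah hb hb'.
have big2 (f : bool -> R) : \sum_o f o = f true + f false.
  by rewrite big_bool.
have key : vge (\sum_o e o * b) (h z0).
  apply: (analytic_mean hC (T := T) _ _ _ edge_test ah).
  - by rewrite big2 /e; ring.
  - by case; rewrite /e; lra.
  - by apply: (apartment_aff hz0); lra.
  - by move=> [] w hw _; [apply: hb|apply: hb'; move: hw; rewrite /T /= subr0].
by move: key; rewrite -mulr_suml big2 /e subrKC mul1r.
Qed.

End Edge.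
End MeanValue.

(** * Slash operators and congruence subgroups *)

Section Mat2.
Context {A : comNzRingType}.
Implicit Types g h : 'M[A]_2.

Lemma ord2P (i : 'I_2) : i = 0 \/ i = 1.
Proof. by case: i => [[|[|//]]] ?; [left|right]; apply: val_inj. Qed.

Lemma mulmx2E g h i j : (g *m h) i j = g i 0 * h 0 j + g i 1 * h 1 j.
Proof.
by rewrite mxE big_ord_recl big_ord1; congr (_ + g i _ * h _ j); apply: val_inj.
Qed.

Lemma mat2_ext g h : g 0 0 = h 0 0 -> g 0 1 = h 0 1 -> g 1 0 = h 1 0 -> g 1 1 = h 1 1 ->
  g = h.
Proof.
move=> *; apply/matrixP => i j.
by case: (ord2P i) => ->; case: (ord2P j) => ->.
Qed.

Lemma det2E g : \det g = g 0 0 * g 1 1 - g 0 1 * g 1 0.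
Proof.
rewrite (expand_det_row _ 0) big_ord_recl big_ord1 /cofactor !det_mx11 !mxE.
have -> : lift (0 : 'I_2) (0 : 'I_1) = 1 by apply: val_inj.
have -> : lift (1 : 'I_2) (0 : 'I_1) = 0 by apply: val_inj.
by rewrite expr0 mul1r /= expr1 mulN1r mulrN.
Qed.

Lemma mat2E (a b c d : A) : (mat2 a b c d 0 0 = a) * (mat2 a b c d 0 1 = b) *
  (mat2 a b c d 1 0 = c) * (mat2 a b c d 1 1 = d).
Proof. by rewrite !mxE. Qed.

Definition adj2 g : 'M[A]_2 := mat2 (g 1 1) (- g 0 1) (- g 1 0) (g 0 0).

Lemma mul_adj2 g : \det g = 1 -> g *m adj2 g = 1%:M.
Proof.
rewrite det2E => d; apply: mat2_ext; rewrite mulmx2E !mat2E !mxE /= ?mulr1n ?mulr0n;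
  (rewrite -d || idtac); ring.
Qed.

Lemma adj2_mul g : \det g = 1 -> adj2 g *m g = 1%:M.
Proof.
rewrite det2E => d; apply: mat2_ext; rewrite mulmx2E !mat2E !mxE /= ?mulr1n ?mulr0n;
  (rewrite -d || idtac); ring.
Qed.

Lemma det_adj2 g : \det (adj2 g) = \det g.
Proof. by rewrite !det2E !mat2E; ring. Qed.

End Mat2.

Section Slash.
Context {R : realType} {F : finFieldType} {C : fieldType}.
Variables (emb : {rmorphism {fraction {poly F}} -> C}) (v : C -> \bar R).
Hypothesis hC : completed_algebraic_closure v (range emb).
Variable k : nat.

Local Notation Kinf := (Kinfty emb v).
Local Notation K := {fraction {poly F}}.
Local Notation Om := (Omega emb v).
Local Notation supp := (supported_on_Omega emb v).
Implicit Types (g h : 'M[K]_2) (f : C -> C).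

Definition den g z := emb (g 1 0) * z + emb (g 1 1).
Definition mob g z := (emb (g 0 0) * z + emb (g 0 1)) / den g z.

Lemma slashE g f z : slash emb k g f z = emb (\det g) ^+ k.-1 * den g z ^- k * f (mob g z).
Proof. by []. Qed.

Lemma den_neq0 g z : \det g != 0 -> Om z -> den g z != 0.
Proof.
move=> dg Oz; apply/eqP => d0; have [c0|c0] := eqVneq (g 1 0) 0.
  move: d0 dg; rewrite /den c0 rmorph0 mul0r add0r => /eqP; rewrite fmorph_eq0 => /eqP d0.
  by rewrite det2E c0 d0 !mulr0 subrr eqxx.
apply: Oz; have -> : z = emb (- g 1 1 / g 1 0).
  rewrite fmorph_div rmorphN; apply: (mulfI (x := emb (g 1 0))); first by rewrite fmorph_eq0.
  rewrite mulrCA divff ?fmorph_eq0 // mulr1.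
  by move/eqP: d0; rewrite /den addr_eq0 => /eqP.
exact: Kinf_emb.
Qed.

Lemma mob_Kinf g z : Kinf z -> Kinf (mob g z).
Proof.
by move=> Kz; apply: Kinf_div => //; apply: KinfD => //; (apply: KinfM => //; exact: Kinf_emb) || exact: Kinf_emb.
Qed.

Lemma not_Omega z : ~ Om z -> Kinf z. Proof. exact: contrapT. Qed.

(** A vanishing denominator does no harm: [mob g z] is then 0, still an element of K_infty, where f
    is 0. *)
Lemma slash_supp g f : supp f -> supp (slash emb k g f).
Proof.
move=> sf z /not_Omega Kz; rewrite slashE sf ?mulr0 //; apply; exact: mob_Kinf.
Qed.

Lemma den_mul g h z : den g z != 0 -> den h (mob g z) * den g z = den (h *m g) z.
Proof.
move=> dz; rewrite {1}/den mulrDl -mulrA /mob divfK // /den !mulmx2E !rmorphD !rmorphM; ring.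
Qed.

Lemma mob_mul g h z : den g z != 0 -> mob h (mob g z) = mob (h *m g) z.
Proof.
move=> dz; rewrite [RHS]/mob -den_mul // [LHS]/mob.
have [->|d'] := eqVneq (den h (mob g z)) 0; first by rewrite mul0r invr0 !mulr0.
have -> : emb ((h *m g) 0 0) * z + emb ((h *m g) 0 1) =
    (emb (h 0 0) * mob g z + emb (h 0 1)) * den g z.
  by rewrite mulrDl -mulrA {1}/mob divfK // /den !mulmx2E !rmorphD !rmorphM; ring.
by field; rewrite dz d'.
Qed.

(** Support in Omega makes the cocycle identity hold at every z: denominators do not vanish on
    Omega, and elsewhere both sides are 0. *)
Lemma slash_comp g h f : supp f -> \det g != 0 -> \det h != 0 ->
  slash emb k g (slash emb k h f) = slash emb k (h *m g) f.
Proof.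
move=> sf dg dh; apply/funext => z; have [Oz|nOz] := pselect (Om z).
  have dz := den_neq0 dg Oz.
  rewrite !slashE -mob_mul // -den_mul // det_mulmx rmorphM !exprMn invfM; ring.
by rewrite !(slash_supp _ _ nOz) //; apply: slash_supp.
Qed.

Lemma slashD g f f' z :
  slash emb k g (fun z => f z + f' z) z = slash emb k g f z + slash emb k g f' z.
Proof. by rewrite !slashE mulrDr. Qed.

Lemma slashZ g c f z : slash emb k g (fun z => c * f z) z = c * slash emb k g f z.
Proof. by rewrite !slashE; ring. Qed.

Lemma slash_sum (I : Type) (r : seq I) g (f : I -> C -> C) z :
  slash emb k g (fun z => \sum_(i <- r) f i z) z = \sum_(i <- r) slash emb k g (f i) z.
Proof. by rewrite slashE mulr_sumr. Qed.

End Slash.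

Ltac dvd := first [ assumption | apply: dvdp_add; dvd | apply: dvdp_sub; dvd
  | apply: dvdp_mulr; dvd | apply: dvdp_mull; dvd ].

(** * The congruence groups and the matrices of the Hecke operator *)

Section Groups.
Context {F : finFieldType}.
Variables (n wp : {poly F}).
Hypothesis wp_irr : irreducible_poly wp.
Local Notation A := {poly F}.
Implicit Types g h : 'M[A]_2.

(** For r >= 1 membership of the diagonal in 1 + wp A_r is a congruence modulo wp alone, so only the
    lower left entry depends on r. *)
Definition Gam (r : nat) : set 'M[A]_2 := [set g |
  [/\ \det g = 1, [/\ n %| g 0 0 - 1, n %| g 1 0 & n %| g 1 1 - 1],
      wp %| g 0 0 - 1 /\ wp %| g 1 1 - 1 & wp ^+ r %| g 1 0]].

Lemma wp_neq0 : wp != 0.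
Proof. by case: wp_irr => h _; rewrite -size_poly_gt0 ltnW. Qed.

Lemma modp_eq (p q d : A) : p %% d = q %% d <-> d %| p - q.
Proof.
rewrite /dvdp modpD modpN subr_eq0; split=> [->//|/eqP//].
Qed.

Lemma one_unitsE r x : (1 <= r)%N -> one_units wp r (x %% wp ^+ r) <-> wp %| x - 1.
Proof.
move=> r1; have wr : wp %| wp ^+ r by rewrite -(prednK r1) exprS dvdp_mulr.
split=> [[y _ /modp_eq h]|/dvdpP[y e]].
  have -> : x - 1 = wp * y - (1 + wp * y - x) by ring.
  by rewrite dvdp_sub ?dvdp_mulr // (dvdp_trans wr).
by exists y => //; congr (_ %% _); rewrite -[x](subrK 1) e; ring.
Qed.

Lemma GamE r : (1 <= r)%N -> Gamma1p n wp r = Gam r.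
Proof.
move=> r1; apply/seteqP; split=> g /=.
  by move=> [[d a c e] [_ /(one_unitsE _ r1) u w /(one_unitsE _ r1) u']].
by move=> [d [a c e] [u u'] w]; split; split=> //; apply/(one_unitsE _ r1).
Qed.

Lemma wp_dvd r x : (1 <= r)%N -> wp ^+ r %| x -> wp %| x.
Proof. by move=> r1; apply: dvdp_trans; rewrite -(prednK r1) exprS dvdp_mulr. Qed.

Lemma Gam_le r s : (r <= s)%N -> Gam s `<=` Gam r.
Proof.
move=> rs g [d a u w]; split=> //; apply: dvdp_trans w.
by rewrite -(subnKC rs) exprD dvdp_mulr.
Qed.

Lemma Gam_mul r g h : (1 <= r)%N -> Gam r g -> Gam r h -> Gam r (g *m h).
Proof.
move=> r1 [d [a c e] [u u'] w] [d2 [a2 c2 e2] [u2 u2'] w2].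
have cw := wp_dvd r1 w; have cw2 := wp_dvd r1 w2.
have E1 : (g *m h) 0 0 - 1 = (g 0 0 - 1) * h 0 0 + (h 0 0 - 1) + g 0 1 * h 1 0.
  by rewrite mulmx2E; ring.
have E2 : (g *m h) 1 1 - 1 = (g 1 1 - 1) * h 1 1 + (h 1 1 - 1) + g 1 0 * h 0 1.
  by rewrite mulmx2E; ring.
split; first by rewrite det_mulmx d d2 mulr1.
- by rewrite E1 E2 mulmx2E; split; dvd.
- by rewrite E1 E2; split; dvd.
by rewrite mulmx2E; dvd.
Qed.

Lemma Gam1 r : Gam r 1%:M.
Proof. by split; rewrite ?det1 ?mxE ?subrr ?dvdp0. Qed.

Lemma Gam_adj r g : Gam r g -> Gam r (adj2 g).
Proof.
move=> [d [a c e] [u u'] w]; split; rewrite ?det_adj2 // !mat2E ?dvdpNr //.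
Qed.

Lemma toKM g h : toK (g *m h) = toK g *m toK h.
Proof. exact: map_mxM. Qed.

Lemma det_toK g : \det (toK g) = FracField.tofrac (\det g).
Proof. exact: det_map_mx. Qed.

Lemma det_toK_neq0 g : \det g != 0 -> \det (toK g) != 0.
Proof. by rewrite det_toK tofrac_eq0. Qed.

Lemma det_toK1 g : \det g = 1 -> \det (toK g) != 0.
Proof. by move=> e; rewrite det_toK_neq0 // e oner_neq0. Qed.

Let dw := (size wp).-1.
Definition xi (b : A) : 'M[A]_2 := mat2 1 b 0 wp.

Lemma residue_rV (x : A) : wp %| x - rVpoly (poly_rV (x %% wp) : 'rV[F]_dw).
Proof.
rewrite poly_rV_K; last first.
  have := ltn_modp x wp; rewrite wp_neq0; move: (size (x %% wp)%R) => a.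
  by rewrite /dw; move: (size wp) => b; lia.
by rewrite {1}(divp_eq x wp) addrK dvdp_mull.
Qed.

Lemma residue_inj (a b : 'rV[F]_dw) : wp %| rVpoly a - rVpoly b -> a = b.
Proof.
move=> h; apply: (can_inj (@rVpolyK _ _)); apply/eqP; rewrite -subr_eq0.
apply: contraTT h => nz; apply/negP => /(dvdp_leq nz); apply/negP; rewrite -ltnNge.
rewrite (leq_ltn_trans (size_polyD _ _)) // gtn_max size_polyN.
have s1 : (0 < size wp)%N by rewrite size_poly_gt0 wp_neq0.
by rewrite -(prednK s1) !ltnS; apply/andP; split; exact: size_poly.
Qed.

Lemma det_xi b : \det (xi b) = wp.
Proof. by rewrite det2E !mat2E; ring. Qed.

(* xi b h = h' xi b' with b' = h01 + b h11 mod wp, and h' lies one level deeper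
   because its lower left entry is wp h10. *)
Lemma xi_mul s b b' h : (1 <= s)%N -> Gam s h ->
  wp %| h 0 1 + b * h 1 1 - b' ->
  exists2 h', Gam s.+1 h' & xi b *m h = h' *m xi b'.
Proof.
move=> s1 [d [a c e] [u u'] w] hb; have cw := wp_dvd s1 w.
have /dvdpP[y hy] : wp %| h 0 1 + b * h 1 1 - (h 0 0 + b * h 1 0) * b'.
  have -> : h 0 1 + b * h 1 1 - (h 0 0 + b * h 1 0) * b' =
    (h 0 1 + b * h 1 1 - b') - (h 0 0 - 1) * b' - b * h 1 0 * b' by ring.
  by dvd.
have yE : y * wp + (h 0 0 + b * h 1 0) * b' = h 0 1 + b * h 1 1 by rewrite -hy; ring.
rewrite det2E in d.
exists (mat2 (h 0 0 + b * h 1 0) y (wp * h 1 0) (h 1 1 - h 1 0 * b')); last first.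
  apply: mat2_ext; rewrite !mulmx2E !mat2E; try ring.
  by rewrite mul1r -yE; ring.
have E1 : h 0 0 + b * h 1 0 - 1 = (h 0 0 - 1) + b * h 1 0 by ring.
have E2 : h 1 1 - h 1 0 * b' - 1 = (h 1 1 - 1) - h 1 0 * b' by ring.
split; rewrite ?mat2E.
- rewrite det2E !mat2E -[RHS]d.
  have -> : h 0 1 = y * wp + (h 0 0 + b * h 1 0) * b' - b * h 1 1 by rewrite yE; ring.
  ring.
- by rewrite E1 E2; split; dvd.
- by rewrite E1 E2; split; dvd.
by rewrite exprS dvdp_mul.
Qed.

End Groups.

(** * The Hecke operator *)

Section Hecke.
Context {R : realType} {F : finFieldType} {C : fieldType}.
Variables (emb : {rmorphism {fraction {poly F}} -> C}) (v : C -> \bar R).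
Hypothesis hC : completed_algebraic_closure v (range emb).
Variables (k : nat) (n wp : {poly F}).
Hypothesis wp_irr : irreducible_poly wp.

Local Notation supp := (supported_on_Omega emb v).
Local Notation A := {poly F}.
Local Notation G := (Gam n wp).
Local Notation sl g f := (slash emb k (toK g) f).
Let dw := (size wp).-1.
Let wp0 := wp_neq0 wp_irr.

Definition level_invariant (r : nat) (f : C -> C) : Prop :=
  supp f /\ forall g, G r g -> sl g f = f.

Definition U0 (f : C -> C) : C -> C :=
  fun z => \sum_(a : 'rV[F]_dw) sl (xi wp (rVpoly a)) f z.

Lemma sl_mul (g h : 'M[A]_2) f : supp f -> \det g != 0 -> \det h != 0 ->
  sl g (sl h f) = sl (h *m g) f.
Proof. by move=> sf dg dh; rewrite (slash_comp hC) ?det_toK_neq0 // toKM. Qed.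

Lemma det1_neq0 (g : 'M[A]_2) : \det g = 1 -> \det g != 0.
Proof. by move=> ->; rewrite oner_neq0. Qed.

Lemma xi_neq0 b : \det (xi wp b) != 0. Proof. by rewrite det_xi. Qed.

Lemma invariant_mul r f g h : level_invariant r f -> G r g -> \det h != 0 ->
  sl (g *m h) f = sl h f.
Proof.
move=> [sf inv] Gg dh; have [dg _ _ _] := Gg.
by rewrite -sl_mul ?(det1_neq0 dg) // inv.
Qed.

Lemma invariant_le r s f : (r <= s)%N -> level_invariant r f -> level_invariant s f.
Proof. by move=> rs [sf inv]; split=> // g /(Gam_le rs)/inv. Qed.

Lemma invariant0 r : level_invariant r (fun=> 0).
Proof. by split=> // g _; apply/funext => z; rewrite slashE mulr0. Qed.

Lemma invariantD r f f' : level_invariant r f -> level_invariant r f' ->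
  level_invariant r (fun z => f z + f' z).
Proof.
move=> [s i] [s' i']; split=> [z nz|g Gg]; first by rewrite s // s' // addr0.
by apply/funext => z; rewrite slashD i // i'.
Qed.

Lemma invariantZ r c f : level_invariant r f -> level_invariant r (fun z => c * f z).
Proof.
move=> [s i]; split=> [z nz|g Gg]; first by rewrite s // mulr0.
by apply/funext => z; rewrite slashZ i.
Qed.

(** Right multiplication by h in [Gam s] permutes the [xi b] through b -> h01 + b h11 modulo wp,
    injective because h11 = 1 modulo wp. The left factors that appear lie in [Gam s.+1] by [xi_mul],
    and f ignores them. *)
Lemma U0_lower s f : (1 <= s)%N -> level_invariant s.+1 f -> level_invariant s (U0 f).
Proof.
move=> s1 If; have [sf inv] := If; split=> [z nz|h Gh].
  by rewrite /U0 big1 // => a _; apply: (slash_supp hC).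
apply/funext => z; rewrite /U0 slash_sum.
pose sig (a : 'rV[F]_dw) : 'rV[F]_dw :=
  poly_rV ((h 0 1 + rVpoly a * h 1 1) %% wp).
have hsig a : wp %| h 0 1 + rVpoly a * h 1 1 - rVpoly (sig a) by exact: residue_rV.
have [d _ [u u'] w] := Gh.
have sigI : injective sig.
  move=> a b e; apply: (residue_inj wp_irr); move: (hsig a) (hsig b); rewrite e => ha hb.
  have -> : rVpoly a - rVpoly b =
    (h 0 1 + rVpoly a * h 1 1 - rVpoly (sig b)) - (h 0 1 + rVpoly b * h 1 1 - rVpoly (sig b))
    - (h 1 1 - 1) * (rVpoly a - rVpoly b) by ring.
  by dvd.
rewrite [RHS](reindex_inj sigI) /=; apply: eq_bigr => a _.
have [h' Gh' e] := xi_mul s1 Gh (hsig a).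
rewrite sl_mul ?xi_neq0 //; last exact: det1_neq0.
by rewrite e (invariant_mul If) // xi_neq0.
Qed.

Lemma U0_inv s f : (1 <= s)%N -> level_invariant s f -> level_invariant s (U0 f).
Proof. by move=> s1 /(invariant_le (leqnSn s)); apply: U0_lower. Qed.

(* If (U - l)^(m+1) f = 0, then l f = U f - (U - l) f, where U f lies one level
   lower than f by [U0_lower] and (U - l) f by induction. *)
Lemma nilpotent_lower s l f m : (1 <= s)%N -> l != 0 -> level_invariant s.+1 f ->
  iter m (fun g z => U0 g z - l * g z) f = (fun=> 0) -> level_invariant s f.
Proof.
move=> s1 l0; elim: m f => [|m IH] f If /=.
  by move=> ->; exact: invariant0.
rewrite -[X in X = _]/(iter m.+1 (fun g z => U0 g z - l * g z) f) iterSr => e.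
have I1 : level_invariant s.+1 (fun z => U0 f z - l * f z).
  have := invariantD (U0_inv (ltn0Sn s) If) (invariantZ (- l) If).
  by congr level_invariant; apply/funext => z; rewrite mulNr.
have I2 := IH _ I1 e.
have := invariantZ l^-1 (invariantD (U0_lower s1 If) (invariantZ (-1) I2)).
by congr level_invariant; apply/funext => z; field.
Qed.

Lemma nilpotent_bottom r l f m : (1 <= r)%N -> l != 0 -> level_invariant r f ->
  iter m (fun g z => U0 g z - l * g z) f = (fun=> 0) -> level_invariant 1 f.
Proof.
move=> r1 l0; elim: r r1 => // r IH _ If e; case: r IH If => [//|r] IH If.
by apply: IH => //; apply: nilpotent_lower e.
Qed.

Section Decomposition.
Variable r : nat.
Hypothesis r1 : (1 <= r)%N.

Local Notation dec := (is_coset_decomposition (Gamma1p n wp r) wp).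

Lemma xi_coset (h : 'M[A]_2) : G r h ->
  exists (a : 'rV[F]_dw) g, G r g /\ mat2 1 0 0 wp *m h = g *m xi wp (rVpoly a).
Proof.
move=> Gh; pose a : 'rV[F]_dw := poly_rV (h 0 1 %% wp); exists a.
have ha : wp %| h 0 1 - rVpoly a by exact: residue_rV.
have [d [n1 n2 n3] [u u'] w] := Gh; have cw := wp_dvd r1 w.
have /dvdpP[y hy] : wp %| h 0 1 - h 0 0 * rVpoly a.
  have -> : h 0 1 - h 0 0 * rVpoly a = (h 0 1 - rVpoly a) - (h 0 0 - 1) * rVpoly a by ring.
  by dvd.
have yE : h 0 1 = y * wp + h 0 0 * rVpoly a by rewrite -hy; ring.
rewrite det2E in d.
exists (mat2 (h 0 0) y (wp * h 1 0) (h 1 1 - h 1 0 * rVpoly a)); split; last first.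
  by apply: mat2_ext; rewrite !mulmx2E !mat2E ?yE; ring.
have E2 : h 1 1 - h 1 0 * rVpoly a - 1 = (h 1 1 - 1) - h 1 0 * rVpoly a by ring.
split; rewrite ?mat2E.
- by rewrite det2E !mat2E -[RHS]d yE; ring.
- by rewrite E2; split; dvd.
- by rewrite E2; split; dvd.
by dvd.
Qed.

Lemma mulmx_adj2K (g h : 'M[A]_2) : \det g = 1 -> adj2 g *m (g *m h) = h.
Proof. by move=> d; rewrite mulmxA adj2_mul // mul1mx. Qed.

Lemma xi_decomposition : dec [seq xi wp (rVpoly a) | a <- enum 'rV[F]_dw].
Proof.
have xiI a b : xi wp a = xi wp b -> a = b.
  by move=> /(congr1 (fun M : 'M[A]_2 => M 0 1)); rewrite !mat2E.
split.
- rewrite map_inj_uniq ?enum_uniq // => a b /xiI; exact: (can_inj (@rVpolyK _ _)).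
- move=> y; rewrite /hecke_double_coset /right_coset (GamE n wp r1); split.
    move=> [g [h [Gg Gh ->]]]; have [a [g' [Gg' e]]] := xi_coset Gh.
    exists (xi wp (rVpoly a)); first by apply: map_f; rewrite mem_enum.
    exists (g *m g'); first exact: (Gam_mul r1).
    by rewrite -mulmxA -e mulmxA.
  move=> [_ /mapP[a _ ->] [g Gg <-]].
  (* [xi wp b] is diag(1, wp) times a unipotent matrix that lies in every [Gam r]. *)
  exists g, (mat2 1 (rVpoly a) 0 1); split=> //.
    by split; rewrite ?mat2E ?subrr ?dvdp0 // det2E !mat2E; ring.
  by rewrite -mulmxA; congr (_ *m _); apply: mat2_ext; rewrite mulmx2E !mat2E; ring.
move=> _ _ /mapP[a _ ->] /mapP[b _ ->] [y []]; rewrite /right_coset (GamE n wp r1).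
move=> [g Gg <-] [h Gh e]; congr (xi _ (rVpoly _)).
have [dg _ _ _] := Gg.
have e2 : xi wp (rVpoly a) = (adj2 g *m h) *m xi wp (rVpoly b).
  by rewrite -mulmxA e mulmx_adj2K.
have Gk := Gam_mul r1 (Gam_adj Gg) Gh.
move: (adj2 g *m h) Gk e2 => q [dq _ _ _] e2.
have e00 := congr1 (fun M : 'M[A]_2 => M 0 0) e2.
have e01 := congr1 (fun M : 'M[A]_2 => M 0 1) e2.
rewrite /= !mulmx2E !mat2E in e00 e01.
(* The upper rows give q 0 0 = 1, and then that a and b agree modulo wp. *)
apply: (residue_inj wp_irr); rewrite e01.
have -> : q 0 0 = 1 by rewrite e00; ring.
by rewrite mul1r addrAC subrr add0r dvdp_mull.
Qed.

(** [hecke_U] takes its decomposition from [xget]. Two representatives of a coset differ by a left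
    factor in the group, under which f is invariant, so any decomposition gives the same sum. *)
Lemma decomposition_sum f xs ys : level_invariant r f -> dec xs -> dec ys ->
  forall z, \sum_(x <- xs) sl x f z = \sum_(y <- ys) sl y f z.
Proof.
move=> If [ux cx dx] [uy cy dy] z.
have Gid : Gamma1p n wp r 1%:M by rewrite (GamE n wp r1); exact: Gam1.
have self (x : 'M[A]_2) : right_coset (Gamma1p n wp r) x x by exists 1%:M; rewrite ?mul1mx.
have to (us ws : seq 'M[A]_2) : dec us -> dec ws -> forall x, x \in us ->
    exists y, y \in ws /\ exists2 g, G r g & x = g *m y.
  move=> [_ cu _] [_ cw _] x xu.
  have : hecke_double_coset (Gamma1p n wp r) wp x by apply/cu; exists x.
  move=> /cw[y yw [g Gg e]]; exists y; split=> //; exists g => //.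
  by rewrite -(GamE n wp r1).
have dxs : dec xs by []. have dys : dec ys by [].
have /choice[ph hph] : forall x, exists y, x \in xs -> y \in ys /\ exists2 g, G r g & x = g *m y.
  move=> x; have [xu|_] := boolP (x \in xs); last by exists 0.
  by have [y hy] := to _ _ dxs dys _ xu; exists y.
have same (g h x y : 'M[A]_2) : G r g -> G r h -> g *m x = h *m y ->
    exists w, right_coset (Gamma1p n wp r) x w /\ right_coset (Gamma1p n wp r) y w.
  move=> Gg Gh e; exists (g *m x); rewrite /right_coset (GamE n wp r1).
  by split; [exists g|exists h].
have detn y : y \in ys -> \det y != 0.
  move=> yy; have : hecke_double_coset (Gamma1p n wp r) wp y by apply/cy; exists y.
  rewrite /hecke_double_coset (GamE n wp r1) => -[g [h [[dg _ _ _] [dh _ _ _] ->]]].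
  by rewrite !det_mulmx dg dh det2E !mat2E mulr1 !mul1r mulr0 subr0.
transitivity (\sum_(x <- xs) sl (ph x) f z).
  rewrite big_seq [RHS]big_seq; apply: eq_bigr => x xu.
  have [py [g Gg {1}->]] := hph _ xu; rewrite (invariant_mul If) //; exact: detn.
rewrite -(big_map ph xpredT (fun y => sl y f z)); apply: perm_big; apply: uniq_perm => //.
  rewrite map_inj_in_uniq // => x x' xu xu' e.
  have [_ [g Gg eg]] := hph _ xu; have [_ [g' Gg' eg']] := hph _ xu'.
  have [dg _ _ _] := Gg; have [dg' _ _ _] := Gg'.
  apply: dx => //; apply: (same (adj2 g) (adj2 g')); rewrite ?Gam_adj //.
  + exact: Gam_adj.
  + exact: Gam_adj.
  + by rewrite {1}eg eg' !mulmx_adj2K // e.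
move=> y; apply/mapP/idP => [[x xu ->]|yu]; first by have [] := hph _ xu.
have [x [xu [g Gg e]]] := to _ _ dys dxs _ yu; exists x => //.
have [py [h Gh eh]] := hph _ xu; apply: dy => //.
apply: (same 1%:M (g *m h)); [exact: Gam1|exact: (Gam_mul r1)|].
by rewrite mul1mx {1}e eh mulmxA -eh.
Qed.

Lemma hecke_UE f : level_invariant r f -> hecke_U emb k (Gamma1p n wp r) wp f = U0 f.
Proof.
move=> If; apply/funext => z; rewrite /hecke_U.
have h := @xgetPex _ [::] [set xs | dec xs] (ex_intro _ _ xi_decomposition).
rewrite (decomposition_sum If h xi_decomposition) big_map /U0 big_enum //.
Qed.

Lemma iter_hecke_U l f m : level_invariant r f ->
  iter m (fun g z => hecke_U emb k (Gamma1p n wp r) wp g z - l * g z) f =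
  iter m (fun g z => U0 g z - l * g z) f /\
  level_invariant r (iter m (fun g z => U0 g z - l * g z) f).
Proof.
move=> If; elim: m => [//|m [IH1 IH2]] /=; rewrite IH1; split.
  by apply/funext => z; rewrite hecke_UE.
have := invariantD (U0_inv r1 IH2) (invariantZ (- l) IH2).
by congr level_invariant; apply/funext => z; rewrite mulNr.
Qed.

End Decomposition.
End Hecke.

(** * Lattice exponentials *)

Lemma vcvgV {R : realType} {C : fieldType} (v : C -> \bar R) (vv : is_valuation v)
  (u : nat -> C) l : l != 0 -> vcvg v u l -> vcvg v (fun m => (u m)^-1) l^-1.
Proof.
move=> l0 /(vcvgP vv) h; apply/(vcvgP vv) => M.
have [N hN] := h (Order.max (vl v l + 1) (M + vl v l + vl v l)); exists N => m /hN hm.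
have [||u0 vu] := vge_near vv (y := u m) (M := vl v l + 1) l0; first by lra.
  by apply: vgeW hm; rewrite le_max lexx.
have -> : (u m)^-1 - l^-1 = - ((u m - l) * ((u m)^-1 * l^-1)) by field; rewrite l0 u0.
apply/(vgeN vv).
have -> : M = (M + vl v l + vl v l) + (vl v (u m)^-1 + vl v l^-1) by rewrite !vlV // vu; ring.
apply: vgeM => //; first by apply: vgeW hm; rewrite le_max lexx orbT.
by apply: vgeM => //; apply: vge_val.
Qed.

Section Lattice.
Context {R : realType} {F : finFieldType} {C : fieldType}.
Variables (emb : {rmorphism {fraction {poly F}} -> C}) (v : C -> \bar R).
Hypothesis hC : completed_algebraic_closure v (range emb).
Hypothesis hv : extends_infty_valuation emb v.

Local Notation vl := (vl v).
Local Notation vge := (vge v).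
Local Notation io := (coefA emb).
Local Notation A := {poly F}.
Let vv := vv hC.
Hint Resolve vv : core.

Definition polys (m : nat) : seq A := [seq rVpoly a | a <- enum 'rV[F]_m].

Lemma mem_polys m p : (p \in polys m) = (size p <= m)%N.
Proof.
apply/mapP/idP => [[a _ ->]|sp]; first exact: size_poly.
by exists (poly_rV p); rewrite ?mem_enum // poly_rV_K.
Qed.

Lemma polys_uniq m : uniq (polys m).
Proof. by rewrite map_inj_uniq ?enum_uniq //; exact: (can_inj (@rVpolyK _ _)). Qed.

Lemma size_polys m : size (polys m) = (#|F| ^ m)%N.
Proof. by rewrite size_map -cardE card_mx mul1n. Qed.

Lemma big_polys (f : A -> C) (P : pred A) m :
  \prod_(a : 'rV[F]_m | P (rVpoly a)) f (rVpoly a) = \prod_(p <- polys m | P p) f p.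
Proof. by rewrite big_map big_enum_cond. Qed.

Lemma polys_split m m' (P : pred A) (f : A -> C) : (m <= m')%N ->
  \prod_(p <- polys m' | P p) f p =
  \prod_(p <- polys m | P p) f p * \prod_(p <- polys m' | P p && (m < size p)%N) f p.
Proof.
move=> mm; rewrite (bigID (fun p : A => (size p <= m)%N)) /=; congr (_ * _); last first.
  by apply: eq_bigl => p; rewrite ltnNge.
rewrite (eq_bigl (fun p : A => (size p <= m)%N && P p)); last by move=> p; rewrite andbC.
rewrite -big_filter_cond; apply: perm_big; apply: uniq_perm.
- exact/filter_uniq/polys_uniq.
- exact: polys_uniq.
move=> p; rewrite mem_filter !mem_polys; case: leqP => //= h.
by rewrite (leq_trans h).
Qed.

Definition trunc (L : set A) (m : nat) (z : C) : C :=
  z * \prod_(p <- polys m | (p != 0) && (p \in L)) (1 - z / io p).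

Lemma lattice_expE L z : lattice_exp emb v L z = vlim v (fun m => trunc L m z).
Proof.
rewrite /lattice_exp; congr (vlim v _); apply/funext => m; rewrite /trunc; congr (_ * _).
exact: (big_polys (fun p => 1 - z / io p) (fun p => (p != 0) && (p \in L))).
Qed.

Lemma vge_prod1 e (I : Type) (r : seq I) (P : pred I) (f : I -> C) : 0 <= e ->
  (forall i, P i -> vge e (f i - 1)) -> vge e (\prod_(i <- r | P i) f i - 1).
Proof.
move=> e0 h; elim/big_ind: _ => [|x y hx hy|//]; first by left; rewrite subrr.
have -> : x * y - 1 = (x - 1) * (y - 1) + ((x - 1) + (y - 1)) by ring.
by apply: vgeD => //; [apply: (@vgeW _ _ _ _ (e + e)); [lra|exact: vgeM]|exact: vgeD].
Qed.

Lemma vl_io_gt (p : A) m : (m < size p)%N -> vl (io p) <= - m%:R.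
Proof.
move=> h; have p0 : p != 0 by rewrite -size_poly_gt0 (leq_trans _ h).
by rewrite (vl_io hv) // lerN2 ler_nat; move: h; case: (size p).
Qed.

(* From the index [stab z] on, the factors 1 - z / p are congruent to 1. *)
Definition stab (z : C) : nat := Num.bound `|vl z|.

Lemma stabP z : 0 <= vl z + (stab z)%:R.
Proof.
have := archi_boundP (normr_ge0 (vl z)); rewrite -/(stab z).
by have := ler_norm (- vl z); rewrite normrN; lra.
Qed.

Lemma tail_vge (L : set A) z m m' : (stab z < m)%N ->
  vge (vl z + m%:R) (\prod_(p <- polys m' | ((p != 0) && (p \in L)) && (m < size p)%N)
    (1 - z / io p) - 1).
Proof.
move=> sm; have := stabP z => h0; have h1 : (stab z)%:R <= m%:R :> R by rewrite ler_nat ltnW.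
apply: vge_prod1 => [|p /andP[/andP[p0 _] sp]]; first by lra.
have -> : 1 - z / io p - 1 = - (z * (io p)^-1) by ring.
apply/(vgeN vv); apply: vgeM => //; first exact: vge_val.
by right; rewrite vlV // lerNr; exact: vl_io_gt.
Qed.

Lemma trunc_step (L : set A) z m m' : (m <= m')%N -> trunc L m' z = trunc L m z *
  \prod_(p <- polys m' | ((p != 0) && (p \in L)) && (m < size p)%N) (1 - z / io p).
Proof. by move=> mm; rewrite /trunc (polys_split _ _ mm) mulrA. Qed.

Lemma tail_unit (L : set A) z m m' : (stab z < m)%N ->
  let t := \prod_(p <- polys m' | ((p != 0) && (p \in L)) && (m < size p)%N) (1 - z / io p) in
  t != 0 /\ vl t = 0.
Proof.
move=> sm /=; have := tail_vge L m' sm; set t := \prod_(_ <- _ | _) _ => h.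
have [||t0 vt] := vge_near vv (y := t) (M := vl z + m%:R) (oner_neq0 C).
- have := stabP z; have : (stab z)%:R + 1 <= m%:R :> R by rewrite natr1 ler_nat.
  by rewrite (vl1 vv); lra.
- exact: h.
by rewrite t0 vt (vl1 vv).
Qed.

Lemma trunc_vl (L : set A) z m : (stab z < m)%N -> trunc L (stab z).+1 z != 0 ->
  trunc L m z != 0 /\ vl (trunc L m z) = vl (trunc L (stab z).+1 z).
Proof.
move=> sm t0; rewrite (trunc_step L z sm).
have [u0 vu] := @tail_unit L z (stab z).+1 m (ltnSn _).
by rewrite mulf_neq0 // vlM // vu addr0.
Qed.

Lemma trunc_vge (L : set A) z m : (stab z < m)%N ->
  vge (vl (trunc L (stab z).+1 z)) (trunc L m z).
Proof.
move=> sm; have [t0|t0] := eqVneq (trunc L (stab z).+1 z) 0.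
  by left; rewrite (trunc_step L z sm) t0 mul0r.
by have [_ <-] := trunc_vl sm t0; apply: vge_val.
Qed.

(** Beyond [stab z] the nonzero partial products keep a fixed valuation, and passing from m to m + 1
    multiplies them by 1 up to valuation vl z + m. *)
Lemma lattice_exp_cvg (L : set A) z : vcvg v (fun m => trunc L m z) (lattice_exp emb v L z).
Proof.
have [l hl] : exists l, vcvg v (fun m => trunc L m z) l.
  apply: (cauchy_succ vv (vcomp hC)) => M; set B := vl (trunc L (stab z).+1 z).
  exists (maxn (stab z).+1 (Num.bound `|M - B - vl z|)) => m; rewrite geq_max => /andP[h1 h2].
  rewrite (trunc_step L z (leqnSn m)) -[X in _ - X]mulr1 -mulrBr.
  have hM : M <= B + (vl z + m%:R).
    have := archi_boundP (normr_ge0 (M - B - vl z)); have := ler_norm (M - B - vl z).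
    have : (Num.bound `|M - B - vl z|)%:R <= m%:R :> R by rewrite ler_nat.
    by lra.
  apply: vgeW hM _; apply: vgeM => //; first exact: trunc_vge.
  exact: tail_vge.
by rewrite lattice_expE (vlimE vv hl).
Qed.

(** The valuations of the partial products are constant beyond [stab z], so the limit cannot be
    0. *)
Lemma lattice_exp_neq0 (L : set A) z : (forall p, L p -> z != io p) -> L 0 ->
  lattice_exp emb v L z != 0.
Proof.
move=> h L0; have t0 m : trunc L m z != 0.
  rewrite mulf_neq0 //; first by have := h _ L0; rewrite rmorph0.
  rewrite prodf_seq_neq0; apply/allP => p _; apply/implyP => /andP[p0 /set_mem Lp].
  rewrite subr_eq0 eq_sym; apply/eqP => e; have := h _ Lp; apply/negP; rewrite negbK.
  by rewrite -[z](divfK (x := io p)) ?io_eq0 // e mul1r.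
have [] // := vcvg_vle vv (M := vl (trunc L (stab z).+1 z)) _ (lattice_exp_cvg L z).
by exists (stab z).+1 => m sm; have [nz ->] := trunc_vl sm (t0 _).
Qed.

Section Additive.
Variable L : set A.
Hypothesis L0 : L 0.
Hypothesis LB : forall a b, L a -> L b -> L (a - b).

Lemma latN a : L a -> L (- a). Proof. by move=> La; rewrite -sub0r; apply: LB. Qed.
Lemma latD a b : L a -> L b -> L (a + b).
Proof. by move=> La /latN Lb; rewrite -[b]opprK; apply: LB. Qed.

Definition points m : seq A := [seq p <- polys m | p \in L].

Lemma mem_points m p : (p \in points m) = (size p <= m)%N && (p \in L).
Proof. by rewrite mem_filter mem_polys andbC. Qed.

Lemma points_uniq m : uniq (points m). Proof. exact/filter_uniq/polys_uniq. Qed.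

Lemma points_shift m a : a \in points m ->
  perm_eq [seq p - a | p <- points m] (points m).
Proof.
rewrite mem_points => /andP[sa /set_mem La]; apply: uniq_perm.
- rewrite map_inj_uniq ?points_uniq // => p q; exact: addIr.
- exact: points_uniq.
move=> p; apply/mapP/idP => [[x + ->]|].
  rewrite !mem_points => /andP[sx /set_mem Lx]; apply/andP; split.
    by rewrite (leq_trans (size_polyD _ _)) // geq_max sx size_polyN.
  by apply/mem_set; apply: LB.
rewrite mem_points => /andP[sp /set_mem Lp]; exists (p + a); last by rewrite addrK.
rewrite mem_points; apply/andP; split.
  by rewrite (leq_trans (size_polyD _ _)) // geq_max sp sa.
by apply/mem_set; apply: latD.
Qed.

(** Its roots form a finite additive group, so it is an additive polynomial; [trunc] is a scalar
    multiple of it, and e_L inherits additivity in the limit. *)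
Definition vanishing m : {poly C} := \prod_(a <- points m) ('X - (io a)%:P).

Lemma vanishing_shift m a w : a \in points m -> (vanishing m).[io a + w] = (vanishing m).[w].
Proof.
move=> am; rewrite !horner_prod -[RHS](perm_big _ (points_shift am)) /= big_map.
by apply: eq_bigr => p _; rewrite !hornerE rmorphB; ring.
Qed.

Lemma vanishing_root m a : a \in points m -> (vanishing m).[io a] = 0.
Proof.
by move=> am; rewrite horner_prod (bigD1_seq a) ?points_uniq //= !hornerE subrr mul0r.
Qed.

(* P(X + w) - P(X) - P(w) has degree less than the number of its roots. *)
Lemma vanishingD m z w : (vanishing m).[z + w] = (vanishing m).[z] + (vanishing m).[w].
Proof.
set P := vanishing m; pose D := P \Po ('X + w%:P) - P - P.[w]%:P.
have sP : size P = (size (points m)).+1.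
  by rewrite /P /vanishing -(big_map io xpredT (fun x => 'X - x%:P)) size_prod_XsubC size_map.
have mP : P \is monic by apply: monic_prod_XsubC.
have evD x : D.[x] = P.[x + w] - P.[x] - P.[w].
  by rewrite /D !(hornerD, hornerN, hornerC, horner_comp, hornerX).
suff D0 : D = 0.
  by have := evD z; rewrite D0 horner0 => h; apply/eqP; rewrite -subr_eq0 opprD addrA -h.
apply/eqP; apply: contraT => Dn.
have : (size [seq io a | a <- points m] < size D)%N.
  apply: max_poly_roots => //.
    apply/allP => _ /mapP[a am ->].
    by rewrite rootE evD vanishing_shift // [X in _ - X - _]vanishing_root // subr0 subrr.
  by rewrite map_inj_uniq ?points_uniq //; exact: io_inj.
rewrite size_map ltnNge => /negP[]; rewrite -ltnS -sP.
have n0 : (0 < size (points m))%N.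
  case: (points m) (mem_points m 0) => //; rewrite size_poly0 /= => /esym/negP[].
  exact/mem_set.
have sXw : size ('X + w%:P) = 2 by exact: size_XaddC.
have mXw : 'X + w%:P \is monic by rewrite monicE lead_coefDl ?lead_coefX // size_polyX size_polyC; case: eqP.
have sC : size (P \Po ('X + w%:P)) = size P.
  by rewrite size_comp_poly2 // sXw.
have lC : lead_coef (P \Po ('X + w%:P)) = lead_coef P.
  by rewrite lead_coef_comp ?sXw // (monicP mXw) expr1n mulr1.
have lt : (size (P \Po ('X + w%:P) - P)%R < size P)%N.
  rewrite -sC; have PC0 : P \Po ('X + w%:P) != 0 by rewrite -size_poly_gt0 sC sP.
  apply: (leq_ltn_trans (n := (size P).-1)); last by rewrite sC sP.
  apply/leq_sizeP => j; rewrite leq_eqVlt => /orP[/eqP<-|jP]; rewrite coefB.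
    by rewrite -{1}sC -!lead_coefE lC subrr.
  have sPj : (size P <= j)%N by rewrite sP in jP *.
  by rewrite !nth_default ?subrr // sC.
rewrite (leq_ltn_trans (size_polyD _ _)) // gtn_max lt size_polyN size_polyC sP.
by rewrite ltnS; case: (_ == _).
Qed.

Lemma vanishing0 m : (vanishing m).[0] = 0.
Proof. by have := vanishingD m 0 0; rewrite addr0 => /eqP; rewrite -subr_eq0 opprD addrA subrr sub0r oppr_eq0 => /eqP. Qed.

Lemma truncE m z : trunc L m z =
  (\prod_(p <- points m | p != 0) - (io p)^-1) * (vanishing m).[z].
Proof.
have -> : (vanishing m).[z] = z * \prod_(p <- points m | p != 0) (z - io p).
  rewrite horner_prod (bigD1_seq 0) /= ?points_uniq //; last first.
    by rewrite mem_points size_poly0; apply/mem_set.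
  rewrite !hornerE rmorph0 subr0; congr (_ * _).
  by apply: eq_bigr => p _; rewrite !hornerE.
rewrite [RHS]mulrCA -big_split /= /trunc /points big_filter_cond; congr (_ * _).
rewrite [RHS](eq_bigl (fun p => (p != 0) && (p \in L))); last by move=> p; rewrite andbC.
apply: eq_bigr => p /andP[p0 _]; rewrite mulNr mulrBr mulVf ?io_eq0 // opprB mulrC.
by [].
Qed.

Lemma truncD m z w : trunc L m (z + w) = trunc L m z + trunc L m w.
Proof. by rewrite !truncE vanishingD mulrDr. Qed.

Lemma lattice_expD z w : lattice_exp emb v L (z + w) =
  lattice_exp emb v L z + lattice_exp emb v L w.
Proof.
apply: (vcvg_uniq vv (lattice_exp_cvg L (z + w))).
apply: vcvg_ext (vcvgD vv (lattice_exp_cvg L z) (lattice_exp_cvg L w)).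
by exists 0%N => m _; rewrite truncD.
Qed.

Lemma lattice_exp0 a : L a -> lattice_exp emb v L (io a) = 0.
Proof.
move=> La; apply: (vcvg_uniq vv (lattice_exp_cvg L (io a))).
apply: vcvg_ext (vcvg_cst vv 0); exists (size a) => m sm.
rewrite truncE vanishing_root ?mulr0 // mem_points sm.
exact/mem_set.
Qed.

Lemma lattice_expB z w : lattice_exp emb v L (z - w) =
  lattice_exp emb v L z - lattice_exp emb v L w.
Proof. by have := lattice_expD (z - w) w; rewrite subrK => ->; rewrite addrK. Qed.

Lemma lattice_exp_shift a z : L a -> lattice_exp emb v L (z + io a) = lattice_exp emb v L z.
Proof. by move=> /lattice_exp0 e; rewrite lattice_expD e addr0. Qed.

End Additive.

End Lattice.

Lemma ex_max {R : realType} (T : eqType) (f : T -> R) (s : seq T) x0 : x0 \in s ->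
  exists2 x, x \in s & forall y, y \in s -> f y <= f x.
Proof.
elim: s x0 => // y [|z s] IH x0 _.
  by exists y; rewrite ?mem_head // => x; rewrite inE => /eqP->.
have [x xs hx] := IH z (mem_head _ _).
have [le|lt] := leP (f x) (f y).
  exists y; first exact: mem_head.
  by move=> w; rewrite in_cons => /orP[/eqP->//|/hx/le_trans]; apply.
exists x; first by rewrite in_cons xs orbT.
by move=> w; rewrite in_cons => /orP[/eqP->|/hx//]; exact: ltW.
Qed.

Lemma vcvg_prod_in {R : realType} {C : fieldType} (v : C -> \bar R) (I : eqType)
  (r : seq I) (u : I -> nat -> C) (l : I -> C) : is_valuation v ->
  (forall i, i \in r -> vcvg v (u i) (l i)) ->
  vcvg v (fun m => \prod_(i <- r) u i m) (\prod_(i <- r) l i).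
Proof.
move=> vv; elim: r => [|i r IH] h.
  by rewrite big_nil; apply: vcvg_ext (vcvg_cst vv 1); exists 0%N => m _; rewrite big_nil.
rewrite big_cons; apply: vcvg_ext (vcvgM vv (h i (mem_head _ _)) (IH _)).
  by exists 0%N => m _; rewrite big_cons.
by move=> k kr; apply: h; rewrite in_cons kr orbT.
Qed.

(** * Estimates and product formulas for lattice exponentials *)

Section LatticeEstimates.
Context {R : realType} {F : finFieldType} {C : fieldType}.
Variables (emb : {rmorphism {fraction {poly F}} -> C}) (v : C -> \bar R).
Hypothesis hC : completed_algebraic_closure v (range emb).
Hypothesis hv : extends_infty_valuation emb v.

Local Notation vl := (vl v).
Local Notation io := (coefA emb).
Local Notation A := {poly F}.
Local Notation level := (level emb v).
Local Notation apartment := (apartment emb v).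
Local Notation lexp := (lattice_exp emb v).
Local Notation tr := (trunc emb).
Let vv := vv hC.
Hint Resolve vv : core.

Section Level.
Variables (L : set A) (N : A).
Hypothesis L0 : L 0.
Hypothesis LB : forall a b, L a -> L b -> L (a - b).

Lemma factor_le z p : p != 0 -> z - io p != 0 -> vl (z - io p) <= vl z ->
  1 - z / io p != 0 /\ vl (1 - z / io p) <= 0.
Proof.
move=> p0 nz le; have ip0 : io p != 0 by rewrite io_eq0.
have E : 1 - z / io p = - ((z - io p) / io p) by field.
rewrite E oppr_eq0 mulf_neq0 ?invr_eq0 // vlN // vl_div //; split=> //.
rewrite subr_le0; have [h|h] := ltP (vl (io p)) (vl z); last exact: le_trans h.
have [|_ e] := vl_sub_eq vv (y := z) ip0; first by right.
by rewrite -(vlB vv) in e; rewrite e.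
Qed.

Lemma lattice_exp_closest z : (forall p, L p -> z - io p != 0 /\ vl (z - io p) <= vl z) ->
  lexp L z != 0 /\ vl (lexp L z) <= vl z.
Proof.
move=> h; apply: (vcvg_vle vv _ (lattice_exp_cvg hC hv L z)).
exists 0%N => m _; have [z0 _] := h _ L0; rewrite rmorph0 subr0 in z0.
have f p : (p != 0) && (p \in L) -> 1 - z / io p != 0 /\ vl (1 - z / io p) <= 0.
  by move=> /andP[p0 /set_mem/h[]]; apply: factor_le.
have nz p : (p != 0) && (p \in L) -> 1 - z / io p != 0 by move=> /f[].
have pn : \prod_(p <- polys m | (p != 0) && (p \in L)) (1 - z / io p) != 0.
  by rewrite prodf_seq_neq0; apply/allP => p _; apply/implyP/nz.
rewrite /trunc mulf_neq0 // vlM // vl_prod //; split=> //.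
rewrite gerDl; apply: sumr_le0 => p /f[_ le]; exact: le.
Qed.

(** By periodicity z may be translated by its nearest lattice point. Then no lattice point is closer
    to z than 0 is, and every factor of the product has absolute value at least 1. *)
Lemma lattice_exp_level z s : level s z -> lexp L z != 0 /\ vl (lexp L z) <= s.
Proof.
move=> lz; have [z0 _] := level_n0 hC lz.
pose m := (stab v z).+1.
have p0 : 0 \in points L m by rewrite mem_points size_poly0; apply/mem_set.
have [a am amax] := ex_max (fun p => vl (z - io p)) p0.
have La : L a by move: am; rewrite mem_points => /andP[_ /set_mem].
have lza : level s (z - io a).
  move=> x Kx; rewrite -addrA -opprD; apply: lz; apply: (KinfD hC) => //.
  exact: Kinf_io.
have [] := @lattice_exp_closest (z - io a); last first.
  have -> : lexp L (z - io a) = lexp L z.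
    by rewrite (lattice_expB hC hv L0 LB) (lattice_exp0 hC hv L0 La) // subr0.
  move=> e0 le; split=> //; apply: le_trans le _.
  by have [] := level_n0 hC lza.
move=> p Lp; have Lap : L (a + p) by apply: latD.
have E : z - io a - io p = z - io (a + p) by rewrite rmorphD opprD addrA.
rewrite E; have [nz _] := lz _ (Kinf_io hC (a + p)); split=> //.
have [sp|sp] := leqP (size (a + p)) m.
  by apply: amax; rewrite mem_points sp; apply/mem_set.
have ap0 : io (a + p) != 0 by rewrite io_eq0 -size_poly_gt0 (leq_trans _ sp).
have lt : vl (io (a + p)) < vl z.
  apply: le_lt_trans (vl_io_gt hv sp) _; have := stabP v z.
  by rewrite /m -natr1; lra.
rewrite -(vlB vv); have [|_ ->] := vl_sub_eq vv (y := z) ap0; first by right.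
by rewrite (le_trans (ltW lt)) //; have := amax _ p0; rewrite rmorph0 subr0.
Qed.

Hypothesis N0 : N != 0.
Hypothesis LN : forall b, L (N * b).

(* The N b with b of size at most i - deg N contribute q^(i - deg N) factors of
   absolute value at least q. *)
Lemma lattice_exp_apartment i z : apartment (- i%:R) z -> ((size N).-1 < i)%N ->
  vl (lexp L z) <= - (#|F| ^ (i - (size N).-1))%:R.
Proof.
move=> [vz lz] di; set d := (size N).-1.
have [z0 _] := level_n0 hC lz.
have h p : L p -> z - io p != 0 /\ vl (z - io p) <= vl z.
  by move=> _; rewrite vz; exact: lz (Kinf_io hC p).
have f p : (p != 0) && (p \in L) -> 1 - z / io p != 0 /\ vl (1 - z / io p) <= 0.
  by move=> /andP[p0 /set_mem/h[]]; apply: factor_le.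
apply: (proj2 (vcvg_vle vv _ (lattice_exp_cvg hC hv L z))).
exists i => m im.
have pn : \prod_(p <- polys m | (p != 0) && (p \in L)) (1 - z / io p) != 0.
  by rewrite prodf_seq_neq0; apply/allP => p _; apply/implyP => /f[].
rewrite /trunc mulf_neq0 // vlM // vl_prod //; last by move=> p /f[].
split=> //.
pose s := [seq N * b | b <- [seq b <- polys (i - d) | b != 0]].
have s1 : (0 < size N)%N by rewrite size_poly_gt0.
have sP p : p \in s -> (p != 0) && (p \in L) /\ (size p <= i)%N.
  move=> /mapP[b]; rewrite mem_filter mem_polys => /andP[b0 sb] ->.
  rewrite mulf_neq0 //; split; first by apply/mem_set; apply: LN.
  by rewrite size_mul //; move: di sb s1; rewrite /d; move: (size N) (size b) => x y; lia.
have us : uniq s.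
  rewrite map_inj_uniq; first exact/filter_uniq/polys_uniq.
  by move=> a b /(mulfI N0).
have cs : size s = (#|F| ^ (i - d)).-1.
  rewrite size_map size_filter; have := count_predC (pred1 (0 : A)) (polys (i - d)).
  rewrite count_uniq_mem ?polys_uniq // mem_polys size_poly0 size_polys => <-.
  by rewrite add1n.
have sub : \sum_(p <- polys m | (p != 0) && (p \in L)) vl (1 - z / io p) <=
    \sum_(p <- s) (-1 : R).
  rewrite (bigID (mem s)) /= -[leRHS]addr0; apply: lerD; last first.
    by apply: sumr_le0 => p /andP[/f[]].
  rewrite -big_filter [X in X <= _](_ : _ = \sum_(p <- s) vl (1 - z / io p)); last first.
    apply: perm_big; apply: uniq_perm => //; first exact/filter_uniq/polys_uniq.
    move=> p; rewrite mem_filter mem_polys; case ps : (p \in s); last by rewrite andbF.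
    by have [-> sp] := sP _ ps; rewrite /= (leq_trans sp im).
  rewrite big_seq [leRHS]big_seq; apply: ler_sum => p /sP[/andP[p0 Lp] sp].
  have ip0 : io p != 0 by rewrite io_eq0.
  have E : 1 - z / io p = - ((z - io p) / io p) by field.
  have [nz le] := h _ (set_mem Lp).
  rewrite E vlN // vl_div // (vl_io hv) //; move: le; rewrite vz.
  have : (size p).-1%:R + 1 <= i%:R :> R.
    rewrite natr1 ler_nat prednK //; by rewrite size_poly_gt0.
  by lra.
rewrite big_const_seq count_predT iter_addr_0 cs mulNrn in sub.
have q0 : (0 < #|F| ^ (i - d))%N by rewrite expn_gt0 (leq_trans _ (finNzRing_gt1 F)).
have : (#|F| ^ (i - d)).-1%:R + 1 = (#|F| ^ (i - d))%:R :> R by rewrite natr1 prednK.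
(* There are only q^(i - d) - 1 nonzero b; the leading factor z, of valuation - i <= -1, supplies
   the missing unit. *)
have : 1 <= i%:R :> R by rewrite ler1n; move: di; lia.
by move: sub; rewrite vz; lra.
Qed.

End Level.

Lemma ex_representatives (T : eqType) (e : rel T) (s : seq T) : equivalence_rel e ->
  exists s', [/\ {subset s' <= s}, forall x, x \in s -> has (e x) s', uniq s' &
    {in s' &, forall x y, e x y -> x = y}].
Proof.
move=> /equivalence_relP[rf ts]; elim: s => [|x s [s' [sub cov us inj]]]; first by exists [::].
have sy a b : e a b -> e b a by move=> h; rewrite -(ts _ _ h); exact: rf.
have [hx|hx] := boolP (has (e x) s').
  exists s'; split=> //; first by move=> y /sub ys; rewrite in_cons ys orbT.
  by move=> y; rewrite in_cons => /orP[/eqP->|/cov].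
have nx y : y \in s' -> ~ e x y by move=> ys exy; move/hasP: hx; apply; exists y.
exists (x :: s'); split.
- by move=> y; rewrite !in_cons => /orP[->//|/sub->]; rewrite orbT.
- by move=> y; rewrite in_cons /= => /orP[/eqP->|/cov->]; rewrite ?rf ?orbT.
- by rewrite /= us andbT; apply/negP => /nx; apply; exact: rf.
move=> y z; rewrite !in_cons => /orP[/eqP->|ys] /orP[/eqP->|zs] //.
- by move=> /(nx _ zs).
- by move=> /sy /(nx _ ys).
exact: inj.
Qed.

Section Sublattice.
Variables (L L' : set A) (N : A).
Hypothesis L0 : L 0.
Hypothesis LB : forall a b, L a -> L b -> L (a - b).
Hypothesis L'B : forall a b, L' a -> L' b -> L' (a - b).
Hypothesis LL' : L `<=` L'.
Hypothesis N0 : N != 0.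
Hypothesis LN : forall b, L (N * b).

(** L contains N A, so L' / L is finite. [rs] represents its nonzero classes by polynomials no
    longer than N. *)
Lemma lattice_representatives : exists rs : seq A,
  [/\ forall l, l \in rs -> L' l /\ ~ L l,
      forall a, L' a -> L a \/ exists2 l, l \in rs & L (a - l),
      uniq rs & {in rs &, forall x y, L (x - y) -> x = y}].
Proof.
pose e : rel A := fun x y => (x - y) \in L.
have Le : equivalence_rel e.
  apply/equivalence_relP; split; first by move=> x; rewrite /e subrr; apply/mem_set.
  move=> x y /set_mem xy z; apply/idP/idP => /set_mem h; apply/mem_set.
    by have -> : y - z = (x - z) - (x - y) by [ring]; apply: LB.
  by have -> : x - z = (x - y) + (y - z) by [ring]; apply: latD.
have [s [sub cov us inj]] := ex_representatives
  [seq a <- polys (size N) | (a \in L') && (a \notin L)] Le.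
exists s; split=> //; last by move=> x y xs ys h; apply: inj => //; apply/mem_set.
  by move=> l /sub; rewrite mem_filter => /andP[/andP[/set_mem h /negP n] _]; split=> // h2; apply: n; apply/mem_set.
move=> a La; pose a' := a %% N.
have aa' : L (a - a').
  by have -> : a - a' = N * (a %/ N) by [rewrite {1}(divp_eq a N) /a'; ring].
have [h|h] := pselect (L a); [by left|right].
have /cov/hasP[l ls] : a' \in [seq a <- polys (size N) | (a \in L') && (a \notin L)].
  rewrite mem_filter mem_polys; apply/andP; split; last by rewrite ltnW // ltn_modp.
  apply/andP; split; first by apply/mem_set; have -> : a' = a - (a - a') by [ring]; apply: L'B => //; apply: LL'.
  apply/negP => /set_mem h'; apply: h; have -> : a = (a - a') + a' by ring.
  exact: latD.
move=> /set_mem h'; exists l => //.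
by have -> : a - l = (a - a') + (a' - l) by [ring]; apply: latD.
Qed.

(** The product over the coset l + L. As a polynomial in z it is P(l - z) / P(l) with P the additive
    polynomial [vanishing], and additivity splits the numerator. *)
Lemma vanishing_ratio m l z : (forall a, a \in points L m -> io l + io a != 0) ->
  \prod_(a <- points L m) (1 - z / (io l + io a)) =
  1 - tr L m z / tr L m (io l).
Proof.
move=> nz.
have neg w : (vanishing emb L m).[- w] = - (vanishing emb L m).[w].
  have := vanishingD emb L0 LB m w (- w); rewrite subrr vanishing0 // => /esym/eqP.
  by rewrite addrC addr_eq0 => /eqP.
have prodE w : (vanishing emb L m).[w] = \prod_(a <- points L m) (w + io a).
  have p0 : 0 \in points L m by rewrite mem_points size_poly0; apply/mem_set.
  have pm : perm_eq [seq - a | a <- points L m] (points L m).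
    apply: uniq_perm; rewrite ?points_uniq //.
      by rewrite map_inj_uniq ?points_uniq //; exact: oppr_inj.
    move=> p; apply/mapP/idP => [[x + ->]|].
      by rewrite !mem_points size_polyN => /andP[-> /set_mem Lx] /=; apply/mem_set; apply: latN.
    rewrite mem_points => /andP[sp /set_mem Lp]; exists (- p); last by rewrite opprK.
    by rewrite mem_points size_polyN sp; apply/mem_set; apply: latN.
  rewrite horner_prod -(perm_big _ pm) /= big_map.
  by apply: eq_bigr => a _; rewrite !hornerE rmorphN; ring.
set c := \prod_(p <- points L m | p != 0) - (io p)^-1.
have c0 : c != 0.
  rewrite prodf_seq_neq0; apply/allP => p _; apply/implyP => p0.
  by rewrite oppr_eq0 invr_eq0 io_eq0.
have l0 : (vanishing emb L m).[io l] != 0.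
  by rewrite prodE prodf_seq_neq0; apply/allP => a am; apply: nz.
rewrite !truncE // -/c.
have -> : 1 - c * (vanishing emb L m).[z] / (c * (vanishing emb L m).[io l]) =
   (vanishing emb L m).[io l - z] / (vanishing emb L m).[io l].
  by rewrite vanishingD // neg; field; rewrite c0 l0.
rewrite !prodE -prodf_div big_seq [RHS]big_seq; apply: eq_bigr => a am.
by field; exact: nz.
Qed.

(** Once m bounds the sizes of [rs], the points of L' of size at most m are exactly those of L and
    their translates by [rs], without overlap. *)
Lemma trunc_product rs m z :
  (forall l, l \in rs -> (L' l /\ ~ L l) /\ (size l <= m)%N) ->
  (forall a, L' a -> L a \/ exists2 l, l \in rs & L (a - l)) ->
  uniq rs -> {in rs &, forall x y, L (x - y) -> x = y} ->
  tr L' m z = tr L m z * \prod_(l <- rs) (1 - tr L m z / tr L m (io l)).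
Proof.
move=> rsL cov us inj; rewrite {1 2}/trunc -mulrA; congr (_ * _).
have nz l a : l \in rs -> a \in points L m -> io l + io a != 0.
  move=> /rsL[[_ nl] _]; rewrite mem_points => /andP[_ /set_mem La].
  rewrite -rmorphD io_eq0; apply: contra_notN nl; rewrite addr_eq0 => /eqP->.
  exact: latN.
rewrite (bigID (fun p : A => p \in L)) /=; congr (_ * _).
  apply: eq_bigl => p; have [/set_mem Lp|] := boolP (p \in L); last by rewrite !andbF.
  by rewrite (mem_set (LL' Lp)) !andbT.
transitivity (\prod_(p <- [seq l + a | l <- rs, a <- points L m]) (1 - z / io p)); last first.
  rewrite big_allpairs_dep; apply: eq_big_seq => l ls.
  rewrite -vanishing_ratio; last by move=> a; exact: nz.
  by apply: eq_bigr => a _; rewrite rmorphD.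
rewrite -big_filter; apply: perm_big; apply: uniq_perm.
- exact/filter_uniq/polys_uniq.
- apply: allpairs_uniq_dep => //; first by move=> *; exact: points_uniq.
  move=> [x a] [y b] /allpairsPdep[x' [a' [xr ap [-> ->]]]] /allpairsPdep[y' [b' [yr bp [-> ->]]]] /= e.
  move: ap bp; rewrite !mem_points => /andP[_ /set_mem La] /andP[_ /set_mem Lb].
  have E : x' = y'.
    apply: inj => //; have -> : x' - y' = b' - a'; last exact: LB.
    by apply/eqP; rewrite subr_eq addrAC eq_sym subr_eq addrC e addrC.
  by move: e; rewrite E => /addrI->.
move=> p; rewrite mem_filter mem_polys; apply/idP/allpairsPdep.
  move=> /andP[/andP[/andP[p0 /set_mem L'p] /negP nLp] sp].
  case: (cov _ L'p) => [Lp|[l lr h]]; first by case: nLp; apply/mem_set.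
  exists l, (p - l); split=> //; last by rewrite addrC subrK.
  have [_ sl] := rsL _ lr; rewrite mem_points; apply/andP; split; last exact/mem_set.
  by rewrite (leq_trans (size_polyD _ _)) // geq_max sp size_polyN.
move=> [l [a [lr]]]; rewrite mem_points => /andP[sa /set_mem La] ->.
have [[L'l nLl] sl] := rsL _ lr.
have nLla : ~ L (l + a) by move=> h; apply: nLl; rewrite -[l](addrK a); apply: LB.
rewrite (leq_trans (size_polyD _ _)) ?geq_max ?sl // andbT; apply/andP; split.
  apply/andP; split; first by apply: contra_notN nLla => /eqP->.
  apply/mem_set; rewrite -[a]opprK; apply: L'B => //; apply: LL'; exact: latN.
by apply/negP => /set_mem.
Qed.

Lemma lattice_exp_product rs z :
  (forall l, l \in rs -> L' l /\ ~ L l) ->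
  (forall a, L' a -> L a \/ exists2 l, l \in rs & L (a - l)) ->
  uniq rs -> {in rs &, forall x y, L (x - y) -> x = y} ->
  lexp L' z = lexp L z * \prod_(l <- rs) (1 - lexp L z / lexp L (io l)).
Proof.
move=> rsL cov us inj; apply: (vcvg_uniq vv (lattice_exp_cvg hC hv L' z)).
have c : vcvg v (fun m => tr L m z * \prod_(l <- rs) (1 - tr L m z / tr L m (io l)))
    (lexp L z * \prod_(l <- rs) (1 - lexp L z / lexp L (io l))).
  apply: vcvgM => //; first exact: lattice_exp_cvg.
  apply: vcvg_prod_in => // l /rsL[_ nl]; apply: vcvgB => //; first exact: vcvg_cst.
  apply: vcvgM => //; first exact: lattice_exp_cvg.
  apply: vcvgV => //; last exact: lattice_exp_cvg.
  apply: lattice_exp_neq0 => // p Lp; apply/eqP => /io_inj e; apply: nl.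
  by rewrite e.
apply: vcvg_ext c; exists (\max_(l <- rs) size l)%N => m hm.
rewrite (@trunc_product rs m z) // => l lr; split; first exact: rsL.
by apply: leq_trans hm; rewrite (bigD1_seq l) //= leq_maxl.
Qed.

End Sublattice.
End LatticeEstimates.

(** * Expansions at the cusps *)

Section PowerSeries.
Context {R : realType} {C : fieldType} (v : C -> \bar R).
Hypothesis vv : is_valuation v.
Hypothesis vcomp : vcomplete v.

Local Notation vl := (vl v).
Local Notation vge := (vge v).

Definition psum (c : nat -> C) (u : C) (m : nat) : C := \sum_(i < m) c i * u ^+ i.

Lemma psumS c u m : psum c u m.+1 = psum c u m + c m * u ^+ m.
Proof. by rewrite /psum big_ord_recr. Qed.

Lemma archi_nat (x : R) : exists n : nat, x <= n%:R.
Proof.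
by exists (Num.bound `|x|); rewrite (le_trans (ler_norm _)) // ltW // archi_boundP.
Qed.

Lemma linear_large (d B M : R) : 0 < d -> exists n : nat, forall m, (n <= m)%N ->
  M <= d * m%:R - B.
Proof.
move=> d0; have [n hn] := archi_nat ((M + B) / d); exists n => m nm.
rewrite lerBrDr mulrC -ler_pdivrMr //; apply: le_trans hn _.
by rewrite ler_nat.
Qed.

Lemma series_cvg (t : nat -> C) (d B : R) : 0 < d ->
  (forall j, vge (d * j%:R - B) (t j)) ->
  exists l, vcvg v (fun m => \sum_(j < m) t j) l /\
    forall m, vge (d * m%:R - B) (l - \sum_(j < m) t j).
Proof.
move=> d0 h; have step m : \sum_(j < m.+1) t j - \sum_(j < m) t j = t m.
  by rewrite big_ord_recr /= addrAC subrr add0r.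
have [l hl] : exists l, vcvg v (fun m => \sum_(j < m) t j) l.
  apply: cauchy_succ => // M; have [N hN] := linear_large B M d0; exists N => m Nm.
  by rewrite step; apply: (vgeW (hN _ Nm)).
exists l; split=> // m; apply: (cauchy_succ_bound vv hl) => k mk; rewrite step.
apply: vgeW (h k); rewrite lerD2r ler_pM2l // ler_nat //.
Qed.

Lemma psum_cvg (c : nat -> C) (u : C) (s B d : R) : 0 < d -> s + d <= vl u ->
  (forall j, vge (- (s * j%:R) - B) (c j)) ->
  exists l, vcvg v (psum c u) l /\ forall m, vge (d * m%:R - B) (l - psum c u m).
Proof.
move=> d0 sd h; apply: (@series_cvg (fun j => c j * u ^+ j) d B d0) => j.
apply: vgeW (vgeM vv (h j) (vgeX vv j (vge_val v u))).
have : (s + d) * j%:R <= vl u * j%:R by rewrite ler_wpM2r.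
by rewrite mulrDl; lra.
Qed.

Lemma coef_bound (a : nat -> C) u l : u != 0 -> vcvg v (psum a u) l ->
  exists B, forall i, vge (- (vl u * i%:R) - B) (a i).
Proof.
move=> u0 /(vcvgP vv) /(_ 0)[N hN].
have big i : (N <= i)%N -> vge 0 (a i * u ^+ i).
  move=> Ni; have -> : a i * u ^+ i = (psum a u i.+1 - l) - (psum a u i - l).
    by rewrite /psum big_ord_recr /=; ring.
  by apply: vgeB => //; apply: hN => //; exact: leqW.
have [B B0 hB] : exists2 B, 0 <= B & forall i, vge (- B) (a i * u ^+ i).
  have [B B0 hB] : exists2 B, 0 <= B & forall i, (i < N)%N -> vge (- B) (a i * u ^+ i).
    elim: (N) => [|k [B B0 IH]]; first by exists 0.
    exists (Order.max B (- vl (a k * u ^+ k))); first by rewrite le_max B0.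
    move=> j; rewrite ltnS leq_eqVlt => /orP[/eqP->|/IH]; last first.
      by apply: vgeW; rewrite lerN2 le_max lexx.
    by right; rewrite lerNl le_max lexx orbT.
  exists B => // i; have [/hB//|/big] := ltnP i N.
  by apply: vgeW; rewrite oppr_le0.
exists B => i; have ui : u ^+ i != 0 by rewrite expf_neq0.
have -> : a i = (a i * u ^+ i) * (u ^+ i)^-1 by rewrite mulfK.
have -> : - (vl u * i%:R) - B = - B + vl (u ^+ i)^-1 by rewrite vlV // vlX //; ring.
by apply: vgeM => //; apply: vge_val.
Qed.

(** The terms decay in j uniformly in i, so the triangular sums differ from the sums of the s i by
    tails that tend to 0. *)
Lemma double_series (t : nat -> nat -> C) (s : nat -> C) (h : C) (d B : R) : 0 < d ->
  (forall i j, vge (d * j%:R - B) (t i j)) -> (forall i j, (j < i)%N -> t i j = 0) ->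
  (forall i, vcvg v (fun m => \sum_(j < m) t i j) (s i)) ->
  vcvg v (fun m => \sum_(i < m) s i) h ->
  vcvg v (fun m => \sum_(j < m) \sum_(i < j.+1) t i j) h.
Proof.
move=> d0 ht tri hs hh.
have E m : \sum_(j < m) \sum_(i < j.+1) t i j = \sum_(i < m) \sum_(j < m) t i j.
  rewrite exchange_big /=; apply: eq_bigr => j _.
  rewrite -!(big_mkord xpredT (fun i => t i j)) [RHS](big_cat_nat (n := j.+1)) //=.
  rewrite [X in _ = _ + X]big_nat [X in _ = _ + X]big1 ?addr0 // => i /andP[ji _]; exact: tri.
have c0 : vcvg v (fun m => \sum_(i < m) (s i - \sum_(j < m) t i j)) 0.
  apply/(vcvgP vv) => M; have [N hN] := linear_large B M d0; exists N => m Nm.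
  rewrite subr0; apply: vge_sum => // i _; apply: (vgeW (hN _ Nm)).
  have [l [hl hb]] := series_cvg d0 (ht i).
  by rewrite (vcvg_uniq vv (hs i) hl).
have := vcvgB vv hh c0; rewrite subr0; apply: vcvg_ext; exists 0%N => m _.
by rewrite E sumrB opprB addrC subrK.
Qed.

(* Coefficients of (sum_j c_j u^j) / (u - b). *)
Fixpoint divX (b : C) (c : nat -> C) (j : nat) : C :=
  if j is j'.+1 then (divX b c j' - c j) / b else - c 0%N / b.

Lemma divX_bound (b : C) (c : nat -> C) (s B : R) : b != 0 -> vl b <= s ->
  (forall j, vge (- (s * j%:R) - B) (c j)) ->
  forall j, vge (- (s * j%:R) - (B + vl b)) (divX b c j).
Proof.
move=> b0 bs h; elim=> [|j IH] /=.
  have -> : - (s * 0%:R) - (B + vl b) = (- (s * 0%:R) - B) + vl b^-1 by rewrite vlV //; ring.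
  by apply: vgeM => //; [apply/(vgeN vv)|exact: vge_val].
have -> : - (s * j.+1%:R) - (B + vl b) = (- (s * j.+1%:R) - B) + vl b^-1 by rewrite vlV //; ring.
apply: vgeM => //; last exact: vge_val.
by apply: vgeB => //; apply: vgeW IH; rewrite -natr1; lra.
Qed.

Lemma divX_vanish (b : C) (c : nat -> C) I : (forall j, (j < I)%N -> c j = 0) ->
  forall j, (j < I)%N -> divX b c j = 0.
Proof.
move=> h; elim=> [|j IH] jI /=; first by rewrite h // oppr0 mul0r.
by rewrite IH 1?ltnW // h // subrr mul0r.
Qed.

Lemma divX_psum (b u : C) (c : nat -> C) m : b != 0 ->
  (u - b) * psum (divX b c) u m.+1 = psum c u m.+1 + divX b c m * u ^+ m.+1.
Proof.
move=> b0; elim: m => [|m IH]; first by rewrite /psum !big_ord1 /= !expr0 expr1; field.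
rewrite /psum big_ord_recr [in RHS]big_ord_recr -!/(psum _ _ _) mulrDr IH /= !exprS.
by field.
Qed.

(** By [divX_psum] the product of u - b with the partial quotient is a partial sum of the given
    series plus one boundary term, which tends to 0 because vl u exceeds s. *)
Lemma divX_lim (b u : C) (c : nat -> C) (s B d : R) (l : C) : b != 0 -> u - b != 0 ->
  0 < d -> s + d <= vl u -> vl b <= s ->
  (forall j, vge (- (s * j%:R) - B) (c j)) ->
  vcvg v (psum c u) l -> vcvg v (psum (divX b c) u) (l / (u - b)).
Proof.
move=> b0 ub d0 sd bs hc cl; have hd := divX_bound b0 bs hc.
have [l' [cl' _]] := psum_cvg d0 sd hd.
suff -> : l / (u - b) = l' by [].
apply: (mulIf ub); rewrite divfK //.
have c1 : vcvg v (fun m => psum c u m.+1) l.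
  by apply/(vcvgP vv) => M; have [N hN] := (vcvgP vv _ _).1 cl M; exists N => m Nm; apply: hN; exact: leqW.
have c2 : vcvg v (fun m => psum (divX b c) u m.+1) l'.
  by apply/(vcvgP vv) => M; have [N hN] := (vcvgP vv _ _).1 cl' M; exists N => m Nm; apply: hN; exact: leqW.
have c3 : vcvg v (fun m => divX b c m * u ^+ m.+1) 0.
  apply/(vcvgP vv) => M; have [N hN] := linear_large (B + vl b - vl u) M d0; exists N => m Nm.
  rewrite subr0; apply: (vgeW (hN _ Nm)); apply: vgeW (vgeM vv (hd m) (vgeX vv m.+1 (vge_val v u))).
  have : (s + d) * m%:R <= vl u * m%:R by rewrite ler_wpM2r.
  by rewrite mulrDl -natr1; lra.
apply: (vcvg_uniq vv (u := fun m => (u - b) * psum (divX b c) u m.+1)).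
  have := vcvgD vv c1 c3; rewrite addr0; apply: vcvg_ext; exists 0%N => m _.
  by rewrite divX_psum.
by rewrite mulrC; apply: vcvgZ.
Qed.

End PowerSeries.

(** * Changing the lattice of an expansion *)

Section CuspExpansion.
Context {R : realType} {F : finFieldType} {C : fieldType}.
Variables (emb : {rmorphism {fraction {poly F}} -> C}) (v : C -> \bar R).
Hypothesis hC : completed_algebraic_closure v (range emb).
Hypothesis hv : extends_infty_valuation emb v.

Local Notation vl := (vl v).
Local Notation vge := (vge v).
Local Notation io := (coefA emb).
Local Notation A := {poly F}.
Local Notation level := (level emb v).
Local Notation apartment := (apartment emb v).
Local Notation lexp := (lattice_exp emb v).
Let vv := vv hC.
Hint Resolve vv : core.
Let vcomp := vcomp hC.

Definition expandable (L : set A) (h : C -> C) : Prop :=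
  exists (a : nat -> C) (s : R), a 0%N = 0 /\
    forall z, level s z -> vcvg v (psum a (lexp L z)^-1) (h z).

Lemma t_exp (i : nat) : io ('X ^+ i) != 0 /\ vl (io ('X ^+ i)) = - i%:R.
Proof.
by rewrite io_eq0 expf_neq0 ?polyX_eq0 // (vl_io hv) ?expf_neq0 ?polyX_eq0 // size_polyXn.
Qed.

Lemma apartment_ex (i : nat) : exists z, apartment (- i%:R) z.
Proof.
have [r0 vr] := t_exp i.
have [w [h _ _]] := generic_point hC hv [::] (Kinf0 hC) (Kinf_io hC _) r0.
by exists w; move: h; rewrite subr0 vr.
Qed.

Lemma level_ex (s : R) : exists z, level s z.
Proof.
have [i hi] := archi_nat (- s); have [z [_ lz]] := apartment_ex i.
by exists z; apply: level_le lz; lra.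
Qed.

Lemma level_shift s z a : level s z -> level s (z + io a).
Proof.
move=> lz x Kx; have -> : z + io a - x = z - (x - io a) by ring.
by apply: lz; apply: (KinfB hC) => //; exact: Kinf_io.
Qed.

Section Change.
Variables (L L' : set A) (N : A) (rs : seq A).
Hypothesis L0 : L 0.
Hypothesis LB : forall a b, L a -> L b -> L (a - b).
Hypothesis L'B : forall a b, L' a -> L' b -> L' (a - b).
Hypothesis LL' : L `<=` L'.
Hypothesis rsL : forall l, l \in rs -> L' l /\ ~ L l.
Hypothesis rs_cov : forall a, L' a -> L a \/ exists2 l, l \in rs & L (a - l).
Hypothesis rs_uniq : uniq rs.
Hypothesis rs_inj : {in rs &, forall x y, L (x - y) -> x = y}.

Let L'0 : L' 0 := LL' L0.
Let b (l : A) : C := (lexp L (io l))^-1.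
(** The index of L in L', counting the zero class. *)
Let D : nat := (size rs).+1.
Let u (z : C) : C := (lexp L z)^-1.
Let u' (z : C) : C := (lexp L' z)^-1.

Lemma b_neq0 l : l \in rs -> b l != 0.
Proof.
move=> /rsL[_ nl]; rewrite invr_eq0; apply: lattice_exp_neq0 => // p Lp.
by apply/eqP => /io_inj e; apply: nl; rewrite e.
Qed.

Lemma u_level s z : level s z -> u z != 0 /\ - s <= vl (u z).
Proof.
move=> /(lattice_exp_level hC hv L0 LB)[nz le]; rewrite invr_eq0 nz vlV //.
by split=> //; lra.
Qed.

Lemma u'_level s z : level s z -> u' z != 0 /\ - s <= vl (u' z).
Proof.
move=> /(lattice_exp_level hC hv L'0 L'B)[nz le]; rewrite invr_eq0 nz vlV //.
by split=> //; lra.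
Qed.

(** The product formula for e_L' in terms of e_L, rewritten for the reciprocals. It gives u' as a
    power series in u and makes u a root of a polynomial of degree D over the polynomials in u'. *)
Lemma u_relation s z : level s z -> u' z * \prod_(l <- rs) (u z - b l) = u z ^+ D.
Proof.
move=> lz; have [x0 _] := lattice_exp_level hC hv L0 LB lz.
have [y0 _] := lattice_exp_level hC hv L'0 L'B lz.
have E : \prod_(l <- rs) (u z - b l) =
    u z ^+ size rs * \prod_(l <- rs) (1 - lexp L z / lexp L (io l)).
  rewrite -[size rs]count_predT -iter_mulr_1 -big_const_seq -big_split /= /u.
  apply: eq_bigr => l _; rewrite mulrBr mulr1 mulrA mulVf // mul1r //.
have P := lattice_exp_product hC hv L0 LB L'B LL' z rsL rs_cov rs_uniq rs_inj.
rewrite E /u' P /D exprS /u; rewrite P mulf_eq0 negb_or in y0; case/andP: y0 => _ p0.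
by field; rewrite x0 p0.
Qed.

(** A radius: for vl u > [sg] every 1 / (u - b l) is a convergent power series in u. *)
Let sg : R := \sum_(l <- rs) `|vl (b l)|.

Lemma sg0 : 0 <= sg. Proof. by apply: sumr_ge0 => l _. Qed.

Lemma sg_le l : l \in rs -> vl (b l) <= sg.
Proof.
move=> lr; rewrite /sg (bigD1_seq l) //= (le_trans (ler_norm _)) // lerDl.
by apply: sumr_ge0.
Qed.

(** Since u' = u^D / prod (u - b l), a multiplication by u' is done on coefficients in two moves:
    [divs] divides by the linear factors and [shift] multiplies by u^D. *)
Let shift (c : nat -> C) (j : nat) : C := if (D <= j)%N then c (j - D)%N else 0.
Let divs (r : seq A) (c : nat -> C) := foldr (fun l c => divX (b l) c) c r.
(* the coefficients of u'^i as a power series in u *)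
Let Y (i : nat) : nat -> C := iter i (fun c => shift (divs rs c)) (fun j => (j == 0%N)%:R).

Lemma divs_bound r c B : {subset r <= rs} ->
  (forall j, vge (- (sg * j%:R) - B) (c j)) ->
  forall j, vge (- (sg * j%:R) - (B + \sum_(l <- r) vl (b l))) (divs r c j).
Proof.
elim: r => [|l r IH] sub h j; first by rewrite big_nil addr0; exact: h.
rewrite big_cons /= addrCA addrC.
have lr := sub l (mem_head _ _).
apply: divX_bound => //; [exact: b_neq0|exact: sg_le|].
by move=> j'; apply: IH => // x xr; apply: sub; rewrite in_cons xr orbT.
Qed.

Lemma divs_vanish r c I : (forall j, (j < I)%N -> c j = 0) ->
  forall j, (j < I)%N -> divs r c j = 0.
Proof. by move=> h; elim: r => [|l r IH] //= j; apply: divX_vanish. Qed.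

Lemma divs_lim r c B d x l : {subset r <= rs} -> 0 < d -> sg + d <= vl x ->
  (forall j, vge (- (sg * j%:R) - B) (c j)) ->
  vcvg v (psum c x) l -> vcvg v (psum (divs r c) x) (l / \prod_(a <- r) (x - b a)).
Proof.
move=> sub d0 sd hc cl; elim: r sub => [|a r IH] sub; first by rewrite big_nil divr1.
have sub' : {subset r <= rs} by move=> y yr; apply: sub; rewrite in_cons yr orbT.
have ar := sub a (mem_head _ _); have ba := sg_le ar.
rewrite big_cons /= invfM mulrA mulrAC.
apply: (divX_lim vv vcomp _ _ d0 sd ba (divs_bound sub' hc) (IH sub')); first exact: b_neq0.
apply/eqP => /eqP; rewrite subr_eq0 => /eqP e; move: sd; rewrite e; lra.
Qed.

Lemma psum_shift c x m : psum (shift c) x (D + m) = x ^+ D * psum c x m.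
Proof.
elim: m => [|m IH].
  rewrite addn0 /psum big_ord0 mulr0 big1 // => i _.
  by rewrite /shift leqNgt ltn_ord mul0r.
rewrite addnS psumS IH psumS mulrDr /shift leq_addr addKn exprD; ring.
Qed.

Lemma shift_lim c x l : vcvg v (psum c x) l -> vcvg v (psum (shift c) x) (x ^+ D * l).
Proof.
move=> /(vcvgZ vv (x ^+ D))/(vcvg_subn vv D); apply: vcvg_ext; exists D => m Dm.
by rewrite -[in RHS](subnKC Dm) psum_shift.
Qed.

Lemma Y_bound i j : vge (- (sg * j%:R)) (Y i j).
Proof.
elim: i j => [|i IH] j /=.
  by case: j => [|j] /=; [right; rewrite mulr1n vl1 // mulr0n mulr0 oppr0|left; rewrite mulr0n].
rewrite /shift; have [Dj|jD] := leqP D j; last by left.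
have h := @divs_bound rs (Y i) 0 (fun _ => id) _ (j - D)%N.
have {}h : vge (- (sg * (j - D)%:R) - (0 + \sum_(l <- rs) vl (b l))) (divs rs (Y i) (j - D)).
  by apply: h => j'; rewrite subr0; exact: IH.
apply: vgeW h; rewrite natrB // add0r.
have : \sum_(l <- rs) vl (b l) <= sg by apply: ler_sum => l _; exact: ler_norm.
have : sg * 1 <= sg * D%:R by rewrite ler_wpM2l ?sg0 // ler1n.
lra.
Qed.

Lemma Y_vanish i j : (j < i)%N -> Y i j = 0.
Proof.
elim: i j => [//|i IH] j ji /=; rewrite /shift; have [Dj|//] := leqP D j.
by apply: (divs_vanish _ IH); move: Dj ji; rewrite /D; lia.
Qed.

Lemma Y_lim i s z : level s z -> sg + 1 <= - s -> vcvg v (psum (Y i) (u z)) (u' z ^+ i).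
Proof.
move=> lz hs; have [u0 vu] := u_level lz; elim: i => [|i IH].
  apply: vcvg_ext (vcvg_cst vv 1); exists 1%N => m m1; rewrite -(prednK m1) /psum.
  by rewrite big_ord_recl /= mul1r expr0 big1 ?addr0 // => j _; rewrite mul0r.
have nz l : l \in rs -> u z - b l != 0.
  move=> /sg_le h; apply/eqP => /eqP; rewrite subr_eq0 => /eqP e; move: vu; rewrite e; lra.
have p0 : \prod_(l <- rs) (u z - b l) != 0 by rewrite prodf_seq_neq0; apply/allP => l /nz.
have := shift_lim (@divs_lim rs (Y i) 0 1 (u z) _ (fun _ => id) ltr01 _ _ IH).
have -> : u z ^+ D * (u' z ^+ i / \prod_(a <- rs) (u z - b a)) = u' z ^+ i.+1.
  by rewrite -(u_relation lz) exprS; field.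
by apply; [lra|move=> j; rewrite subr0; exact: Y_bound].
Qed.

(** Substitute the series of u' in u and collect powers of u. The series of u'^i starts at u^i, so
    each new coefficient is a finite sum. *)
Lemma expandable_sub h : expandable L' h -> expandable L h.
Proof.
move=> [a [s0 [a0 ha]]]; have [z0 lz0] := level_ex s0.
have [u'0 _] := u'_level lz0; have [B hB] := coef_bound vv u'0 (ha _ lz0).
pose tau := Order.max 0 (vl (u' z0)).
have tau0 : 0 <= tau by rewrite le_max lexx.
have hB' i : vge (- (tau * i%:R) - B) (a i).
  apply: vgeW (hB i); rewrite lerD2r lerN2; apply: ler_wpM2r => //.
  by rewrite le_max lexx orbT.
have sgp := sg0.
(* [tau] absorbs the growth of a and [sg] that of Y; the extra 1 makes the double series decay. *)
exists (fun j => \sum_(i < j.+1) a i * Y i j), (Order.min s0 (- (sg + tau + 1))); split.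
  by rewrite big_ord1 a0 mul0r.
move=> z lz.
have lz1 : level s0 z by apply: level_le lz; rewrite ge_min lexx.
have lz2 : level (- (sg + tau + 1)) z by apply: level_le lz; rewrite ge_min lexx orbT.
have [uz vuz] := u_level lz2; rewrite opprK in vuz.
have := @double_series R C v vv vcomp (fun i j => a i * Y i j * u z ^+ j)
  (fun i => a i * u' z ^+ i) (h z) 1 B ltr01.
move=> /(_ _ _ _ (ha _ lz1)) key.
apply: vcvg_ext (key _ _ _).
- by exists 0%N => m _; apply: eq_bigr => j _; rewrite mulr_suml.
- move=> i j; have [ji|ij] := ltnP j i; first by left; rewrite Y_vanish // mulr0 mul0r.
  apply: vgeW (vgeM vv (vgeM vv (hB' i) (Y_bound i j)) (vgeX vv j (vge_val v (u z)))).
  have : tau * i%:R <= tau * j%:R by rewrite ler_wpM2l // ler_nat.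
  have : (sg + tau + 1) * j%:R <= vl (u z) * j%:R by rewrite ler_wpM2r.
  by rewrite !mulrDl mul1r; lra.
- by move=> i j ji; rewrite Y_vanish // mulr0 mul0r.
- move=> i; have := vcvgZ vv (a i) (Y_lim i lz2 _); rewrite opprK => /(_ _) c.
  apply: vcvg_ext (c _); last by lra.
  by exists 0%N => m _; rewrite /psum mulr_sumr; apply: eq_bigr => j _; rewrite mulrA.
Qed.

Let Q : {poly C} := \prod_(l <- rs) ('X - (b l)%:P).

(* u^i = sum_(l < D) PB i l (u') u^l *)
Fixpoint PB (i l : nat) : {poly C} :=
  if i is i'.+1 then
    (if l is l'.+1 then PB i' l' else 0) + Q`_l *: ('X * PB i' (size rs))
  else (l == 0%N)%:R.

(** Each use of the relation brings one factor u' and lowers the degree in u by at most D, so going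
    from u^i down to u^l takes at least (i - l) / D uses. *)
Lemma PB_vanish i l j : (D * j + l < i)%N -> (PB i l)`_j = 0.
Proof.
elim: i l j => [//|i IH] l j h /=.
rewrite coefD coefZ coefXM.
have -> : ((if l is l'.+1 then PB i l' else 0) : {poly C})`_j = 0.
  case: l h => [|l] h; first by rewrite coef0.
  by rewrite IH //; move: h; lia.
case: j h => [|j] h /=; first by rewrite mulr0 addr0.
rewrite IH ?mulr0 ?addr0 //; move: h; rewrite /D; nia.
Qed.

Let tq : R := \sum_(l < D) `|vl Q`_l|.

Lemma tq0 : 0 <= tq. Proof. by apply: sumr_ge0. Qed.

Lemma size_Q : size Q = D.
Proof. by rewrite /Q -(big_map b xpredT (fun x => 'X - x%:P)) size_prod_XsubC size_map. Qed.

Lemma Q_bound l : vge (- tq) Q`_l.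
Proof.
have [lD|Dl] := ltnP l D; last by left; rewrite nth_default // size_Q.
right; rewrite lerNl /tq (bigD1 (Ordinal lD)) //= -normrN (le_trans (ler_norm _)) // lerDl.
by apply: sumr_ge0.
Qed.

Lemma PB_bound i l j : vge (- (tq * j%:R)) (PB i l)`_j.
Proof.
elim: i l j => [|i IH] l j /=.
  case: l => [|l] /=; last by left; rewrite mulr0n coef0.
  rewrite mulr1n coef1; case: j => [|j] /=; last by left.
  by right; rewrite mulr1n vl1 // mulr0n mulr0 oppr0.
rewrite coefD coefZ coefXM; apply: vgeD => //.
  by case: l => [|l]; [left; rewrite coef0|exact: IH].
case: j => [|j] /=; first by left; rewrite mulr0.
have -> : - (tq * j.+1%:R) = - tq + - (tq * j%:R) by rewrite -natr1; ring.
by apply: vgeM => //; exact: Q_bound.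
Qed.

Lemma PB_eval i s z : level s z -> u z ^+ i = \sum_(l < D) (PB i l).[u' z] * u z ^+ l.
Proof.
move=> lz; elim: i => [|i IH].
  rewrite big_ord_recl /= mulr1n hornerC mul1r expr0 big1 ?addr0 // => l _.
  by rewrite mulr0n horner0 mul0r.
have Qu : u z ^+ D = u' z * \sum_(l < D) Q`_l * u z ^+ l.
  rewrite -(u_relation lz) -size_Q -horner_coef horner_prod.
  by congr (_ * _); apply: eq_bigr => l _; rewrite !hornerE.
rewrite exprSr IH mulr_suml big_ord_recr /= -mulrA -exprSr Qu.
have -> : \sum_(l < D) (PB i.+1 l).[u' z] * u z ^+ l =
    \sum_(l < D) ((if (l : nat) is l'.+1 then PB i l' else 0) : {poly C}).[u' z] * u z ^+ l +
    (PB i (size rs)).[u' z] * (u' z * \sum_(l < D) Q`_l * u z ^+ l).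
  rewrite !mulr_sumr -big_split /=; apply: eq_bigr => l _.
  by rewrite hornerD hornerZ hornerM hornerX; ring.
congr (_ + _); rewrite [RHS]big_ord_recl /= horner0 mul0r add0r.
by apply: eq_bigr => l _; rewrite -mulrA -exprSr.
Qed.

Lemma horner_tail (p : {poly C}) x m :
  p.[x] - \sum_(j < m) p`_j * x ^+ j = \sum_(m <= j < m + size p) p`_j * x ^+ j.
Proof.
rewrite (horner_coef_wide (n := m + size p)) ?leq_addl //.
rewrite -!(big_mkord xpredT (fun j => p`_j * x ^+ j)) (big_cat_nat (n := m)) ?leq_addr //=.
by rewrite addrAC subrr add0r.
Qed.

(* Writing h = sum_(l < D) g_l(u') u^l, periodicity of h makes the polynomial
   sum_l g_l X^l - h vanish at the D conjugates of u, so h = g_0(u'). *)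
Lemma expandable_periodic h : (forall l z, L' l -> h (z + io l) = h z) ->
  expandable L h -> expandable L' h.
Proof.
move=> per [a [s0 [a0 ha]]]; have [z0 lz0] := level_ex s0.
have [u0 _] := u_level lz0; have [B hB] := coef_bound vv u0 (ha _ lz0).
pose tau := Order.max 0 (vl (u z0)).
have tau0 : 0 <= tau by rewrite le_max lexx.
have hB' i : vge (- (tau * i%:R) - B) (a i).
  apply: vgeW (hB i); rewrite lerD2r lerN2; apply: ler_wpM2r => //.
  by rewrite le_max lexx orbT.
have tqp := tq0.
(* The coefficient of u'^j in g_l: by [PB_vanish] only i <= D j + l contribute, and l < D. *)
pose c l j := \sum_(i < D * j.+1) a i * (PB i l)`_j.
(* One power of u' accounts for D powers of u, whence [tau * D]; [tq] controls the coefficients of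
   [PB], and 1 gives convergence. *)
pose s := Order.min s0 (- (tau * D%:R + tq + 1)).
have tD : 0 <= tau * D%:R by rewrite mulr_ge0.
have hc l j : vge (- ((tau * D%:R + tq) * j%:R) - (B + tau * D%:R)) (c l j).
  apply: vge_sum => // i _; apply: vgeW (vgeM vv (hB' i) (PB_bound i l j)).
  have : tau * i%:R <= tau * (D * j.+1)%:R by rewrite ler_wpM2l // ler_nat ltnW.
  by rewrite natrM -natr1; lra.
exists (c 0%N), s; split.
  rewrite /c big1 // => i _; have [e|i0] := posnP i; first by rewrite e a0 mul0r.
  by rewrite PB_vanish ?mulr0 // muln0.
move=> z lz.
have lz1 : level s0 z by apply: level_le lz; rewrite ge_min lexx.
have lz2 : level (- (tau * D%:R + tq + 1)) z.
  by apply: level_le lz; rewrite ge_min lexx orbT.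
have [u'z vu'] := u'_level lz2; rewrite opprK in vu'.
have /choice[g hg] : forall l, exists g, vcvg v (psum (c l) (u' z)) g.
  move=> l; have [g [hg _]] := psum_cvg vv vcomp ltr01 vu' (hc l); by exists g.
have main w : level (- (tau * D%:R + tq + 1)) w -> level s0 w -> u' w = u' z ->
    \sum_(l < D) g l * u w ^+ l = h w.
  move=> lw lw0 e; have [uw vu] := u_level lw.
  have uw0 : 0 <= vl (u w) by lra.
  have c1 : vcvg v (fun m => \sum_(l < D) psum (c l) (u' w) m * u w ^+ l)
      (\sum_(l < D) g l * u w ^+ l).
    apply: vcvg_sum => // l; rewrite e; exact: (vcvgM vv (hg l) (vcvg_cst vv _)).
  apply: (vcvg_uniq vv c1).
  have c2 : vcvg v (fun m => psum a (u w) (D * m)) (h w).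
    apply/(vcvgP vv) => M; have [n hn] := (vcvgP vv _ _).1 (ha _ lw0) M.
    by exists n => m nm; apply: hn; rewrite (leq_trans nm) // leq_pmull.
  (* Both truncations involve the a i with i < D m; their difference consists of the terms of the
     [PB i l] in degrees j >= m, which are uniformly small. *)
  have c3 : vcvg v (fun m => psum a (u w) (D * m) -
      \sum_(l < D) psum (c l) (u' w) m * u w ^+ l) 0.
    apply/(vcvgP vv) => M.
    have [n hn] := linear_large (B + tau * D%:R) M (ltr01 : 0 < 1 :> R).
    exists n => m nm; rewrite subr0.
    have -> : psum a (u w) (D * m) - \sum_(l < D) psum (c l) (u' w) m * u w ^+ l =
      \sum_(i < D * m) \sum_(l < D) a i * u w ^+ l *
        ((PB i l).[u' w] - \sum_(j < m) (PB i l)`_j * u' w ^+ j).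
      have E (l : 'I_D) : psum (c l) (u' w) m =
          \sum_(i < D * m) a i * (\sum_(j < m) (PB i l)`_j * u' w ^+ j).
        under [RHS]eq_bigr do rewrite mulr_sumr.
        rewrite exchange_big /=; apply: eq_bigr => j _; rewrite /c mulr_suml.
        under [RHS]eq_bigr do rewrite mulrA.
        pose f i := a i * (PB i l)`_j * u' w ^+ j.
        rewrite -!(big_mkord xpredT f) [RHS](big_cat_nat (n := (D * j.+1)%N)) //=; last first.
          by rewrite leq_mul2l ltn_ord orbT.
        rewrite [X in _ = _ + X]big_nat [X in _ = _ + X]big1 ?addr0 // => i /andP[ji _].
        rewrite /f PB_vanish ?mulr0 ?mul0r // (leq_trans _ ji) // mulnS addnC ltn_add2r.
        exact: ltn_ord.
      under [X in _ - X]eq_bigr do rewrite E mulr_suml.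
      rewrite exchange_big /= /psum -sumrB; apply: eq_bigr => i _.
      rewrite (PB_eval i lw) mulr_sumr -sumrB; apply: eq_bigr => l _; ring.
    apply: vge_sum => // i _; apply: vge_sum => // l _.
    rewrite horner_tail mulr_sumr big_nat; apply: vge_sum => // j /andP[mj _].
    have [lt|le] := ltnP (D * j + l) i.
      by left; rewrite PB_vanish // mul0r mulr0.
    apply: (vgeW (hn _ nm)).
    apply: vgeW (vgeM vv (vgeM vv (hB' i) (vgeX vv l (vge_val v (u w))))
      (vgeM vv (PB_bound i l j) (vgeX vv j (vge_val v (u' w))))).
    have k1 : tau * i%:R <= tau * (D * j.+1)%:R.
      by rewrite ler_wpM2l // ler_nat (leq_trans le) // mulnS addnC leq_add2r ltnW.
    have k2 : 0 <= vl (u w) * l%:R by rewrite mulr_ge0.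
    have k3 : (tau * D%:R + tq + 1) * j%:R <= vl (u' w) * j%:R by rewrite e ler_wpM2r.
    have k4 : m%:R <= j%:R :> R by rewrite ler_nat.
    move: k1 k2 k3 k4; rewrite natrM -natr1 !mulrDl mul1r mulrDr; lra.
  have := vcvgB vv c2 c3; rewrite subr0; apply: vcvg_ext; exists 0%N => m _; ring.
suff <- : g 0%N = h z by exact: hg.
pose P := \poly_(l < D) g l - (h z)%:P.
have rootP w : level (- (tau * D%:R + tq + 1)) w -> level s0 w -> u' w = u' z -> h w = h z ->
    root P (u w).
  move=> lw lw0 e1 e2; rewrite rootE hornerD hornerN hornerC horner_poly.
  by rewrite (main _ lw lw0 e1) e2 subrr.
have sP : (size P <= D)%N.
  rewrite (leq_trans (size_polyD _ _)) // geq_max size_poly size_polyN size_polyC.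
  by case: (_ == _).
have P0 : P = 0.
  apply: (roots_geq_poly_eq0 (rs := [seq u (z + io l) | l <- 0 :: rs])) => //.
  - apply/allP => _ /mapP[l lr ->]; have L'l : L' l.
      by move: lr; rewrite in_cons => /orP[/eqP->//|/rsL[]].
    apply: rootP; try exact: level_shift; last exact: per.
    by rewrite /u' (lattice_exp_shift hC hv L'0 L'B).
  (* The conjugates are distinct: e_L is additive, and its zeros in A are the elements of L. *)
  - rewrite map_inj_in_uniq.
      rewrite /= rs_uniq andbT; apply/negP => /rsL[_]; exact.
    move=> l m lr mr /invr_inj /eqP.
    rewrite !(lattice_expD hC hv L0 LB) addrC eq_sym -subr_eq0 => /eqP e.
    have {}e : lexp L (io (m - l)) = 0.
      by rewrite rmorphB (lattice_expB hC hv L0 LB) -e; ring.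
    have Lml : L (m - l).
      apply: contrapT => nL; move: e; apply/eqP; apply: lattice_exp_neq0 => // p Lp.
      by apply/eqP => /io_inj e; apply: nL; rewrite e.
    move: lr mr; rewrite !in_cons => /orP[/eqP l0|lr] /orP[/eqP m0|mr].
    + by rewrite l0 m0.
    + by have [_ []] := rsL mr; rewrite -[m](subr0) -l0.
    + by have [_ []] := rsL lr; rewrite -[l]opprK; apply: latN => //; rewrite -[- l]add0r -m0.
    + by apply/esym/rs_inj.
  by rewrite size_map.
have := congr1 (fun p : {poly C} => p`_0) P0.
by rewrite coefB coef_poly coefC /= coef0 => /eqP; rewrite subr_eq0 => /eqP.
Qed.

End Change.
End CuspExpansion.

(** * Growth of modular forms *)

Section Reduction.
Context {R : realType} {F : finFieldType} {C : fieldType}.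
Variables (emb : {rmorphism {fraction {poly F}} -> C}) (v : C -> \bar R).
Hypothesis hC : completed_algebraic_closure v (range emb).
Hypothesis hv : extends_infty_valuation emb v.

Local Notation vl := (vl v).
Local Notation vge := (vge v).
Local Notation io := (coefA emb).
Local Notation A := {poly F}.
Local Notation Kinf := (Kinfty emb v).
Local Notation level := (level emb v).
Local Notation apartment := (apartment emb v).
Local Notation aff := (Omega_affinoid emb v).
Local Notation Om := (Omega emb v).
Let vv := vv hC.
Hint Resolve vv : core.

Definition Tm (b : A) : 'M[A]_2 := mat2 1 b 0 1.
Definition Sm : 'M[A]_2 := mat2 0 (-1) 1 0.

Lemma det_Tm b : \det (Tm b) = 1. Proof. by rewrite det2E !mat2E; ring. Qed.
Lemma det_Sm : \det Sm = 1. Proof. by rewrite det2E !mat2E; ring. Qed.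

Lemma toKE (g : 'M[A]_2) i j : toK g i j = FracField.tofrac (g i j).
Proof. by rewrite mxE. Qed.

Lemma den_toK (g : 'M[A]_2) z : den emb (toK g) z = io (g 1 0) * z + io (g 1 1).
Proof. by rewrite /den !toKE. Qed.

Lemma mob_toK (g : 'M[A]_2) z : mob emb (toK g) z =
  (io (g 0 0) * z + io (g 0 1)) / (io (g 1 0) * z + io (g 1 1)).
Proof. by rewrite /mob /den !toKE. Qed.

Lemma mob_Tm b z : mob emb (toK (Tm b)) z = z + io b.
Proof. by rewrite mob_toK !mat2E !rmorph0 !rmorph1 mul0r mul1r add0r divr1. Qed.

Lemma mob_Sm z : mob emb (toK Sm) z = - z^-1.
Proof.
by rewrite mob_toK !mat2E !rmorph0 !rmorph1 rmorphN rmorph1 mul0r mul1r add0r addr0 mulN1r.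
Qed.

(** The non-archimedean form of Im(-1/z) = Im(z) / |z|^2. *)
Lemma inv_level (s s' : R) (z : C) : level s' z -> 0 < s -> vl z = s ->
  level (Order.max (- s) (s' - s - s)) (- z^-1).
Proof.
move=> lz sp vz y Ky; have [z0 _] := level_n0 hC lz.
have w0 : - z^-1 != 0 by rewrite oppr_eq0 invr_eq0.
have vw : vl (- z^-1) = - s by rewrite vlN // vlV // vz.
have [->|y0] := eqVneq y 0; first by rewrite subr0 w0 vw le_max lexx.
have [le|lt] := leP (vl y) (- s); last first.
  have [|-> ->] := vl_sub_eq vv (y := y) w0; first by right; rewrite vw.
  by rewrite vw le_max lexx.
have [nz le2] := lz _ (KinfN hC (KinfV hC Ky)).
have E : - z^-1 - y = - (y * (z - - y^-1) / z) by field; rewrite z0 y0.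
rewrite E oppr_eq0 !mulf_neq0 ?invr_eq0 // vlN // vl_div ?mulf_neq0 // vlM // vz.
by split=> //; rewrite le_max; apply/orP; right; lra.
Qed.

Lemma nearest_poly s z : level s z -> exists a, forall p,
  z - io a - io p != 0 /\ vl (z - io a - io p) <= vl (z - io a).
Proof.
move=> lz; have [z00 _] := level_n0 hC lz; pose M := (stab v z).+1.
have p0 : (0 : A) \in polys M by rewrite mem_polys size_poly0.
have [a am amax] := ex_max (fun p => vl (z - io p)) p0; exists a => p.
have -> : z - io a - io p = z - io (a + p) by rewrite rmorphD; ring.
have [nz _] := lz _ (Kinf_io hC (a + p)); split=> //.
have [sp|sp] := leqP (size (a + p)) M; first by apply: amax; rewrite mem_polys.
have ap0 : io (a + p) != 0 by rewrite io_eq0 -size_poly_gt0 (leq_trans _ sp).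
have lt : vl (io (a + p)) < vl z.
  by apply: le_lt_trans (vl_io_gt hv sp) _; have := stabP v z; rewrite /M -natr1; lra.
rewrite -(vlB vv); have [|_ ->] := vl_sub_eq vv (y := z) ap0; first by right.
by rewrite (le_trans (ltW lt)) //; have := amax _ p0; rewrite rmorph0 subr0.
Qed.

Lemma nearest_apartment z : (forall p, z - io p != 0 /\ vl (z - io p) <= vl z) ->
  vl z <= 0 -> apartment (vl z) z.
Proof.
move=> h le0; split=> // x Kx; have [p hp] := Kinf_round hC hv Kx; have [nz le] := h p.
have -> : z - x = (z - io p) - (x - io p) by ring.
have [|-> ->] := vl_sub_eq vv (y := x - io p) nz; last by [].
by case: hp => [->|hp]; [left|right; lra].
Qed.

(* Every point of Omega is SL_2(A)-equivalent to some w with |w| = |w|_i >= 1: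
   subtract the nearest polynomial, and invert if the result has |z| < 1. *)
Lemma reduction (m : nat) z : level m%:R z -> exists g w,
  [/\ \det g = 1, apartment (vl w) w, vl w <= 0 & mob emb (toK g) w = z].
Proof.
elim: m z => [|m IH] z lz; have [a ha] := nearest_poly lz; set z0 := z - io a in ha.
all: have mobT : mob emb (toK (Tm a)) z0 = z by rewrite mob_Tm /z0 subrK.
all: have lev : vl z0 <= 0 -> exists g w,
  [/\ \det g = 1, apartment (vl w) w, vl w <= 0 & mob emb (toK g) w = z]
  by move=> le0; exists (Tm a), z0; split=> //; [exact: det_Tm|exact: nearest_apartment].
  by apply: lev; case: (lz _ (Kinf_io hC a)).
have z0n : z0 != 0 by have [] := ha 0; rewrite rmorph0 subr0.
have [le0|gt0] := leP (vl z0) 0; first exact: lev.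
have lz0 : level m.+1%:R z0.
  move=> x Kx; have -> : z0 - x = z - (io a + x) by rewrite /z0; ring.
  by apply: lz; apply: KinfD => //; exact: Kinf_io.
have mobS : mob emb (toK Sm) (- z0^-1) = z0 by rewrite mob_Sm invrN invrK opprK.
have Om_w w : level (Order.max (- vl z0) (m.+1%:R - vl z0 - vl z0)) w -> Om w by exact: level_Omega.
have denTS g w : \det g = 1 -> Om w -> den emb (toK g) w != 0.
  by move=> dg; apply: (den_neq0 hC); apply: det_toK1.
have w_lev := inv_level lz0 gt0 (erefl _).
have Ow := level_Omega w_lev.
(* If |z0| = |z0|_i, one inversion finishes. Otherwise some x in K_infty is closer to z0 than 0 is,
   so vl z0 = vl x is a positive integer, and the inversion lowers the level by at least 1, as the
   induction requires. *)
have [lvl|nlvl] := pselect (level (vl z0) z0).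
  exists (Tm a *m Sm), (- z0^-1); split.
  - by rewrite det_mulmx det_Tm det_Sm mulr1.
  - split=> //; apply: level_le (inv_level lvl gt0 (erefl _)).
    by rewrite vlN // vlV // ge_max; apply/andP; split; lra.
  - by rewrite vlN // vlV //; lra.
  - rewrite toKM -(mob_mul _ (denTS _ _ det_Sm Ow)) mobS //.
have [x [Kx lt]] : exists x, Kinf x /\ vl z0 < vl (z0 - x).
  apply: contrapT => no; apply: nlvl => x Kx; have [nz _] := lz0 _ Kx; split=> //.
  by rewrite leNgt; apply/negP => lt; apply: no; exists x.
have [nzx _] := lz0 _ Kx.
have [x0 vx] : x != 0 /\ vl x = vl z0.
  have -> : x = z0 - (z0 - x) by ring.
  by apply: vl_sub_eq => //; right.
have [s hs] := Kinf_int hC hv Kx x0.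
have s1 : 1 <= vl z0.
  have : 0 < s%:~R :> R by rewrite -hs vx.
  rewrite ltr0z => sp; have : 1%:~R <= s%:~R :> R by rewrite ler_int.
  by rewrite -hs vx.
have [|g [w [dg apw vw mw]]] := IH (- z0^-1).
  apply: level_le w_lev; rewrite ge_max -natr1; have := ler0n R m.
  by move=> ?; apply/andP; split; lra.
exists (Tm a *m Sm *m g), w; split=> //.
  by rewrite !det_mulmx det_Tm det_Sm dg !mulr1.
have [_ lw] := apw; have Ow' := level_Omega lw.
rewrite toKM -(mob_mul _ (denTS _ _ dg Ow')) mw toKM.
by rewrite -(mob_mul _ (denTS _ _ det_Sm Ow)) mobS.
Qed.

(* If p and q are not both divisible by a high power of 1/t, then neither is
   p z + q on the m-th affinoid. *)
Lemma linear_bound m z p q (E : R) : aff m z -> Kinf p -> Kinf q ->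
  ~ (vge E p /\ vge E q) -> p * z + q != 0 /\ vl (p * z + q) <= E + m%:R + m%:R.
Proof.
move=> /(affinoidP hC)[zm lz] Kp Kq npq; have m0 := ler0n R m.
have [z0 _] := level_n0 hC lz.
have [p0|p0] := eqVneq p 0.
  rewrite p0 mul0r add0r; have q0 : q != 0 by apply/eqP => q0; apply: npq; rewrite p0 q0; split; left.
  split=> //; rewrite leNgt; apply/negP => lt; apply: npq; rewrite p0; split; first by left.
  by right; lra.
have [nz le] := lz _ (KinfN hC (Kinf_div hC Kq Kp)).
have E1 : p * z + q = p * (z - - (q / p)) by field.
have nz' : p * z + q != 0 by rewrite E1 mulf_neq0.
have le' : vl (p * z + q) <= vl p + m%:R by rewrite E1 vlM // lerD2l.
split=> //; have [ltp|gep] := ltP (vl p) E; first by lra.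
have vz := vge_nz z0 zm.
have [q0 ltq] : q != 0 /\ vl q < E.
  split; first by apply/eqP => q0; apply: npq; split; [right|left].
  by rewrite ltNge; apply/negP => h; apply: npq; split; right.
have pz0 : p * z != 0 by rewrite mulf_neq0.
have [lt|ge] := ltP (vl q) (vl (p * z)).
  have [|_ e] := vl_add_eq vv (y := p * z) q0; first by right.
  by rewrite addrC e; lra.
by move: ge; rewrite vlM //; lra.
Qed.

Lemma homogenize (P : {poly C}) (d : nat) (a b c e : C) : (size P <= d.+1)%N ->
  exists P' : {poly C}, forall z, c * z + e != 0 ->
    P'.[z] = P.[(a * z + b) / (c * z + e)] * (c * z + e) ^+ d.
Proof.
move=> sP; exists (\sum_(i < size P)
  P`_i *: ((a *: 'X + b%:P) ^+ i * (c *: 'X + e%:P) ^+ (d - i))) => z nz.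
rewrite horner_sum horner_coef mulr_suml; apply: eq_bigr => i _.
rewrite hornerZ hornerM !horner_exp !hornerE.
have id : (i <= d)%N by rewrite -ltnS (leq_trans _ sP).
have E : (c * z + e) ^+ d = (c * z + e) ^+ i * (c * z + e) ^+ (d - i) by rewrite -exprD subnKC.
have : (c * z + e) ^+ i != 0 by rewrite expf_neq0.
rewrite E expr_div_n /=; move: (_ ^+ i) ((c * z + e) ^+ i) (_ ^+ (d - i)) => x y w y0.
by field.
Qed.

Lemma det1_entries (g : 'M[A]_2) : \det g = 1 ->
  io (g 0 0) * io (g 1 1) - io (g 0 1) * io (g 1 0) = 1.
Proof. by rewrite det2E => /(congr1 io); rewrite rmorphB !rmorphM rmorph1. Qed.

(** g maps the m-th affinoid into a larger one, on which f is approximated; substituting the Moebius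
    map and dividing by the weight factor keeps the approximants rational. *)
Lemma slash_approximable k (g : 'M[A]_2) f : \det g = 1 -> rigid_analytic emb v f ->
  forall m, approximable emb v m (slash emb k (toK g) f).
Proof.
move=> dg ra m M; have K1 i j : Kinf (io (g i j)) by exact: Kinf_io.
have det1 := det1_entries dg.
pose e := Order.min (vl (io (g 1 0))) (vl (io (g 1 1))).
have he0 : vge e (io (g 1 0)) by right; rewrite ge_min lexx.
have he1 : vge e (io (g 1 1)) by right; rewrite ge_min lexx orbT.
pose e' := Order.min (vl (io (g 0 0))) (vl (io (g 0 1))).
have he'0 : vge e' (io (g 0 0)) by right; rewrite ge_min lexx.
have he'1 : vge e' (io (g 0 1)) by right; rewrite ge_min lexx orbT.
have m0 := ler0n R m.
(* Neither row can be too small when the determinant is 1: if both lower entries had valuation at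
   least 1 - e', the determinant would have valuation at least 1. *)
have dbound z : aff m z -> den emb (toK g) z != 0 /\
    vl (den emb (toK g) z) <= - e' + 1 + m%:R + m%:R.
  move=> az; rewrite den_toK; apply: linear_bound => // -[h1 h2].
  have : vge (e' + (- e' + 1)) (1 : C).
    by rewrite -det1; apply: vgeB => //; apply: vgeM.
  by move=> /(vge_nz (oner_neq0 C)); rewrite (vl1 vv); lra.
have dlow z : aff m z -> vge (e - m%:R) (den emb (toK g) z).
  move=> /(affinoidP hC)[zm _]; rewrite den_toK; apply: vgeD => //; first exact: vgeM.
  by apply: vgeW he1; lra.
have nlow z : aff m z -> vge (e' - m%:R) (io (g 0 0) * z + io (g 0 1)).
  move=> /(affinoidP hC)[zm _]; apply: vgeD => //; first exact: vgeM.
  by apply: vgeW he'1; lra.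
have [m' hm'] : exists m' : nat, - (e' - m%:R) + (- e' + 1 + m%:R + m%:R) <= m'%:R /\
    (- e + 1 + m%:R + m%:R) - (e - m%:R) <= m'%:R.
  have [m1 h1] := archi_nat (- (e' - m%:R) + (- e' + 1 + m%:R + m%:R)).
  have [m2 h2] := archi_nat ((- e + 1 + m%:R + m%:R) - (e - m%:R)).
  exists (maxn m1 m2); split; [apply: le_trans h1 _|apply: le_trans h2 _];
  by rewrite ler_nat ?leq_maxl ?leq_maxr.
have aff_mob z : aff m z -> aff m' (mob emb (toK g) z).
  move=> az; have [d0 dle] := dbound _ az; have dl := vge_nz d0 (dlow _ az).
  apply/(affinoidP hC); split.
    rewrite mob_toK -den_toK.
    apply: (@vgeW _ _ _ _ ((e' - m%:R) + vl (den emb (toK g) z)^-1)).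
      by rewrite vlV //; case: hm' => h _; lra.
    by apply: vgeM => //; [exact: nlow|exact: vge_val].
  move=> x Kx; pose p := io (g 0 0) - x * io (g 1 0); pose q := io (g 0 1) - x * io (g 1 1).
  have E1 : mob emb (toK g) z - x = (p * z + q) / den emb (toK g) z.
    rewrite mob_toK -den_toK; apply: (mulIf d0); rewrite mulrBl !divfK // den_toK /p /q; ring.
  have [nz le] : p * z + q != 0 /\ vl (p * z + q) <= - e + 1 + m%:R + m%:R.
    apply: linear_bound => //; try by apply: (KinfB hC) => //; apply: KinfM.
    move=> [hp hq].
    have : vge (- e + 1 + e) (1 : C).
      rewrite -det1.
      have -> : io (g 0 0) * io (g 1 1) - io (g 0 1) * io (g 1 0) =
        p * io (g 1 1) - q * io (g 1 0) by rewrite /p /q; ring.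
      by apply: vgeB => //; apply: vgeM.
    by move=> /(vge_nz (oner_neq0 C)); rewrite (vl1 vv); lra.
  rewrite E1 mulf_neq0 ?invr_eq0 // vl_div //; split=> //.
  by case: hm' => _ h; lra.
pose B := (- e' + 1 + m%:R + m%:R) * k%:R.
have [P [Q hPQ]] := rigid_approximable hC m' ra (M + B).
pose d := (size P + size Q)%N.
have [P' hP'] := homogenize (io (g 0 0)) (io (g 0 1)) (io (g 1 0)) (io (g 1 1)) (leqW (leq_addr (size Q) (size P)) : (size P <= d.+1)%N).
have [Q' hQ'] := homogenize (io (g 0 0)) (io (g 0 1)) (io (g 1 0)) (io (g 1 1)) (leqW (leq_addl (size P) (size Q)) : (size Q <= d.+1)%N).
exists P', (Q' * (io (g 1 0) *: 'X + (io (g 1 1))%:P) ^+ k) => z az.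
have [d0 dle] := dbound _ az; have [Q0 hM] := hPQ _ (aff_mob _ az).
have d0' := d0; rewrite den_toK in d0'.
have E1 : (io (g 1 0) *: 'X + (io (g 1 1))%:P).[z] = den emb (toK g) z.
  by rewrite den_toK !hornerE.
rewrite hornerM horner_exp E1 hQ' // hP' // -mob_toK -den_toK.
split; first by rewrite !mulf_neq0 // expf_neq0.
rewrite slashE det_toK dg !rmorph1 expr1n mul1r.
have -> : den emb (toK g) z ^- k * f (mob emb (toK g) z) -
   P.[mob emb (toK g) z] * den emb (toK g) z ^+ d /
   (Q.[mob emb (toK g) z] * den emb (toK g) z ^+ d * den emb (toK g) z ^+ k) =
   den emb (toK g) z ^- k * (f (mob emb (toK g) z) -
   P.[mob emb (toK g) z] / Q.[mob emb (toK g) z]).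
  by field; rewrite Q0 !expf_neq0.
have -> : M = - B + (M + B) by ring.
apply: vgeM => //; right; rewrite vlV // vlX // lerN2 /B.
by apply: ler_wpM2r.
Qed.

End Reduction.

(** * Translation lattices and conditions at the cusps *)

Section Cusps.
Context {R : realType} {F : finFieldType} {C : fieldType}.
Variables (emb : {rmorphism {fraction {poly F}} -> C}) (v : C -> \bar R).
Hypothesis hC : completed_algebraic_closure v (range emb).
Hypothesis hv : extends_infty_valuation emb v.
Variables (k : nat) (n wp : {poly F}).
Hypothesis n0 : n != 0.
Hypothesis wp0 : wp != 0.

Local Notation io := (coefA emb).
Local Notation A := {poly F}.
Local Notation Kinf := (Kinfty emb v).
Local Notation level := (level emb v).
Local Notation supp := (supported_on_Omega emb v).
Local Notation sl g f := (slash emb k (toK g) f).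
Local Notation G := (Gam n wp).
Local Notation inv := (level_invariant emb v k n wp).
Let vv := vv hC.
Hint Resolve vv : core.

Lemma invmx2E (g : 'M[A]_2) : \det g = 1 -> invmx g = adj2 g.
Proof.
move=> d; have ug : g \in unitmx by rewrite unitmxE d unitr1.
by rewrite -[LHS]mulmx1 -(mul_adj2 d) mulmxA mulVmx // mul1mx.
Qed.

Lemma translationsE r (g : 'M[A]_2) b : \det g = 1 -> translations (G r) g b <->
  [/\ n %| g 0 0 * g 1 0 * b, n %| g 1 0 * g 1 0 * b, wp %| g 0 0 * g 1 0 * b &
      wp ^+ r %| g 1 0 * g 1 0 * b].
Proof.
move=> d; have d' := d; rewrite det2E in d'.
have E00 : (g *m Tm b *m adj2 g) 0 0 - 1 = - (g 0 0 * g 1 0 * b).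
  transitivity (g 0 0 * g 1 1 - g 0 1 * g 1 0 - 1 - g 0 0 * g 1 0 * b).
    by rewrite !mulmx2E !mat2E; ring.
  by rewrite d'; ring.
have E10 : (g *m Tm b *m adj2 g) 1 0 = - (g 1 0 * g 1 0 * b).
  by rewrite !mulmx2E !mat2E; ring.
have E11 : (g *m Tm b *m adj2 g) 1 1 - 1 = g 0 0 * g 1 0 * b.
  transitivity (g 0 0 * g 1 1 - g 0 1 * g 1 0 - 1 + g 0 0 * g 1 0 * b).
    by rewrite !mulmx2E !mat2E; ring.
  by rewrite d'; ring.
rewrite /translations /= invmx2E // -/(Tm b) /Gam /= E00 E10 E11 !dvdpNr.
split=> [[_ [? ? _] [? _] ?]|[? ? ? ?]]; split=> //.
by rewrite !det_mulmx det_adj2 d det_Tm !mulr1.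
Qed.

Section Translations.
Variables (r : nat) (g : 'M[A]_2).
Hypothesis dg : \det g = 1.
Local Notation L := (translations (G r) g).

Lemma trans0 : L 0.
Proof. by apply/translationsE => //; rewrite !mulr0 !dvdp0. Qed.

Lemma transB a b : L a -> L b -> L (a - b).
Proof.
move=> /translationsE-/(_ dg)[? ? ? ?] /translationsE-/(_ dg)[? ? ? ?].
by apply/translationsE => //; split; rewrite mulrBr dvdp_sub.
Qed.

Lemma transN b : (1 <= r)%N -> L (n * wp ^+ r * b).
Proof.
move=> r1; have wr : wp %| wp ^+ r by rewrite -(prednK r1) exprS dvdp_mulr.
have nN : n %| n * wp ^+ r * b by rewrite -mulrA dvdp_mulr.
have wN : wp ^+ r %| n * wp ^+ r * b by rewrite mulrAC dvdp_mull.
by apply/translationsE => //; split; apply: dvdp_mull => //; apply: dvdp_trans wN.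
Qed.

End Translations.

Lemma trans_le r s (g : 'M[A]_2) : (r <= s)%N ->
  translations (G s) g `<=` translations (G r) g.
Proof. by move=> rs b; apply: Gam_le. Qed.

Lemma slash_Tm (g : 'M[A]_2) f b z : supp f -> \det g = 1 ->
  sl (g *m Tm b) f z = sl g f (z + io b).
Proof.
move=> sf dg; rewrite -(sl_mul hC k sf); last 2 first.
- by rewrite det_Tm oner_neq0.
- by rewrite dg oner_neq0.
rewrite slashE mob_Tm det_toK det_Tm !rmorph1 expr1n mul1r den_toK !mat2E.
by rewrite rmorph0 rmorph1 mul0r add0r expr1n invr1 mul1r.
Qed.

Lemma slash_Sm (g : 'M[A]_2) f z : supp f -> \det g = 1 -> z != 0 ->
  sl (g *m Sm) f z = z ^- k * sl g f (- z^-1).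
Proof.
move=> sf dg z0; rewrite -(sl_mul hC k sf); last 2 first.
- by rewrite det_Sm oner_neq0.
- by rewrite dg oner_neq0.
rewrite slashE mob_Sm det_toK det_Sm !rmorph1 expr1n mul1r den_toK !mat2E.
by rewrite rmorph0 rmorph1 mul1r addr0.
Qed.

Lemma translation_periodic r (g : 'M[A]_2) f : inv r f -> \det g = 1 ->
  forall l z, translations (G r) g l -> sl g f (z + io l) = sl g f z.
Proof.
move=> If dg l z Ll; have [sf _] := If; rewrite -slash_Tm //.
have -> : g *m Tm l = (g *m Tm l *m invmx g) *m g.
  by rewrite invmx2E // -[RHS]mulmxA adj2_mul // mulmx1.
by rewrite (invariant_mul hC If) // dg oner_neq0.
Qed.

Lemma vanishesP (Gm : set 'M[A]_2) f g :
  vanishes_at_cusp emb v Gm k f g <-> expandable emb v (translations Gm g) (sl g f).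
Proof.
have E M z : Omega emb v z /\ (forall x, Kinf x -> (v (z - x)%R <= M%:E)%E) <-> level M z.
  split; first by move=> [_ h] x Kx; apply/(vleP vv); apply: h.
  move=> lz; split; first exact: level_Omega lz.
  by move=> x /lz[? ?]; apply/(vleP vv).
split=> -[a [M [a0 h]]]; exists a, M; split=> //.
  by move=> z /E[Oz hz]; exact: h.
by move=> z Oz hz; apply: h; apply/E.
Qed.

Lemma expandable_level r s f (g : 'M[A]_2) : (1 <= r)%N -> (r <= s)%N -> inv r f ->
  \det g = 1 ->
  expandable emb v (translations (G r) g) (sl g f) <->
  expandable emb v (translations (G s) g) (sl g f).
Proof.
move=> r1 rs If dg; have s1 := leq_trans r1 rs.
have N0 : n * wp ^+ s != 0 by rewrite mulf_neq0 // expf_neq0.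
have [rs' [h1 h2 h3 h4]] := lattice_representatives (@trans0 s g dg) (@transB s g dg)
  (@transB r g dg) (@trans_le r s g rs) N0 (fun b => transN dg b s1).
split.
  apply: (expandable_sub hC hv (@trans0 s g dg) (@transB s g dg) (@transB r g dg) (@trans_le r s g rs) h1 h2 h3 h4).
apply: (expandable_periodic hC hv (@trans0 s g dg) (@transB s g dg) (@transB r g dg) (@trans_le r s g rs) h1 h2 h3 h4).
by move=> l z Ll; apply: (translation_periodic If dg).
Qed.

End Cusps.

(** * Forms that vanish to high order at all cusps *)

Section Vanishing.
Context {R : realType} {F : finFieldType} {C : fieldType}.
Variables (emb : {rmorphism {fraction {poly F}} -> C}) (v : C -> \bar R).
Hypothesis hC : completed_algebraic_closure v (range emb).
Hypothesis hv : extends_infty_valuation emb v.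
Variables (k : nat) (n wp : {poly F}) (r : nat).
Hypothesis n0 : n != 0.
Hypothesis wp0 : wp != 0.
Hypothesis r1 : (1 <= r)%N.

Local Notation vl := (vl v).
Local Notation vge := (vge v).
Local Notation io := (coefA emb).
Local Notation A := {poly F}.
Local Notation level := (level emb v).
Local Notation apartment := (apartment emb v).
Local Notation supp := (supported_on_Omega emb v).
Local Notation sl g f := (slash emb k (toK g) f).
Local Notation G := (Gam n wp).
Local Notation inv := (level_invariant emb v k n wp r).
Let vv := vv hC.
Hint Resolve vv : core.
Let N : A := n * wp ^+ r.

Lemma N_neq0 : N != 0. Proof. by rewrite mulf_neq0 // expf_neq0. Qed.

(** The group contains the principal congruence subgroup of level N, in which g h^-1 lies. *)
Lemma slash_congr f (g h : 'M[A]_2) : inv f -> \det g = 1 -> \det h = 1 ->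
  (forall i j, N %| g i j - h i j) -> sl g f = sl h f.
Proof.
move=> If dg dh hN.
have wr : wp %| wp ^+ r by rewrite -(prednK r1) exprS dvdp_mulr.
have nN : n %| N by rewrite dvdp_mulr.
have wN : wp ^+ r %| N by rewrite dvdp_mull.
have E : g = (g *m adj2 h) *m h by rewrite -mulmxA adj2_mul // mulmx1.
rewrite {1}E (invariant_mul hC If) ?dh ?oner_neq0 //.
have D1 i j : N %| (g *m adj2 h) i j - (i == j)%:R.
  have -> : (i == j)%:R = (h *m adj2 h) i j by rewrite mul_adj2 // mxE.
  rewrite !mulmx2E.
  have -> : g i 0 * adj2 h 0 j + g i 1 * adj2 h 1 j - (h i 0 * adj2 h 0 j + h i 1 * adj2 h 1 j)
    = (g i 0 - h i 0) * adj2 h 0 j + (g i 1 - h i 1) * adj2 h 1 j by ring.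
  by rewrite dvdp_add // dvdp_mulr.
have D00 := D1 0 0; have D10 := D1 1 0; have D11 := D1 1 1; rewrite /= subr0 in D10.
split; first by rewrite det_mulmx det_adj2 dg dh mulr1.
- by split; apply: dvdp_trans nN _.
- by split; apply: dvdp_trans wr _; apply: dvdp_trans wN _.
exact: dvdp_trans wN D10.
Qed.

(** By [slash_congr] only entries modulo N matter. [pick] lifts a residue matrix to SL_2(A) and
    falls back on the identity where no lift exists, so all listed matrices have determinant 1. *)
Lemma finite_cosets : exists s : seq 'M[A]_2, (forall g, g \in s -> \det g = 1) /\
  forall g, \det g = 1 -> exists2 h, h \in s & forall f, inv f -> sl g f = sl h f.
Proof.
pose P := polys (size N) (F := F).
pose cand := [seq mat2 x.1 x.2 y.1 y.2 | x <- [seq (a, b) | a <- P, b <- P],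
   y <- [seq (a, b) | a <- P, b <- P]].
pose pick (m : 'M[A]_2) : 'M[A]_2 := xget 1%:M [set g | \det g = 1 /\ forall i j, N %| g i j - m i j].
have pickP m : \det (pick m) = 1.
  by rewrite /pick; case: xgetP => [x -> []//|_]; rewrite det1.
exists [seq pick m | m <- cand]; split; first by move=> g /mapP[m _ ->].
move=> g dg; pose m : 'M[A]_2 := mat2 (g 0 0 %% N) (g 0 1 %% N) (g 1 0 %% N) (g 1 1 %% N).
have mP x : x %% N \in P by rewrite mem_polys ltnW // ltn_modp N_neq0.
have mc : m \in cand.
  apply/allpairsP; exists ((g 0 0 %% N, g 0 1 %% N), (g 1 0 %% N, g 1 1 %% N)); split=> //=;
  exact: (allpairs_f (fun a b => (a, b)) (mP _) (mP _)).
exists (pick m); first exact: map_f.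
have ex : exists g, \det g = 1 /\ forall i j, N %| g i j - m i j.
  exists g; split=> // i j.
  have h x : N %| x - x %% N by rewrite {1}(divp_eq x N) addrK dvdp_mull.
  by case: (ord2P i) => ->; case: (ord2P j) => ->; rewrite !mat2E.
have [dp hp] := @xgetPex _ 1%:M [set g | \det g = 1 /\ forall i j, N %| g i j - m i j] ex.
move=> f If; apply: slash_congr => // i j.
have -> : g i j - pick m i j = (g i j - m i j) - (pick m i j - m i j) by ring.
apply: dvdp_sub; last exact: hp.
have h x : N %| x - x %% N by rewrite {1}(divp_eq x N) addrK dvdp_mull.
by case: (ord2P i) => ->; case: (ord2P j) => ->; rewrite !mat2E.
Qed.

Section Form.
Variable f : C -> C.
Hypothesis If : inv f.
Hypothesis ra : rigid_analytic emb v f.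
Let sf : supp f := proj1 If.

(** Uniformity in g lets a bound on the i-th vertex of the standard apartment serve for all its
    translates under SL_2(A). *)
Definition lower_bound (i : nat) (b : R) : Prop :=
  forall g, \det g = 1 -> forall z, apartment (- i%:R) z -> vge b (sl g f z).

Lemma lower_bound_le i b b' : b <= b' -> lower_bound i b' -> lower_bound i b.
Proof. by move=> le h g dg z az; apply: vgeW le _; apply: h. Qed.

Lemma finite_bound (P : 'M[A]_2 -> R -> Prop) (s : seq 'M[A]_2) :
  (forall g b b', b <= b' -> P g b' -> P g b) ->
  (forall g, g \in s -> exists b, P g b) -> exists b, forall g, g \in s -> P g b.
Proof.
move=> mono; elim: s => [|g s IH] h; first by exists 0.
have [|b hb] := IH; first by move=> x xs; apply: h; rewrite in_cons xs orbT.
have [b' hb'] := h g (mem_head _ _); exists (Order.min b b') => x.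
rewrite in_cons => /orP[/eqP->|/hb]; [apply: mono hb'|apply: mono];
by rewrite ge_min lexx ?orbT.
Qed.

Lemma bounded_below i : exists b, lower_bound i b.
Proof.
have [s [s1 s2]] := finite_cosets.
have [|g gs|b hb] := @finite_bound (fun g b => forall z, apartment (- i%:R) z -> vge b (sl g f z)) s.
- by move=> g b b' le h z az; apply: vgeW le _; apply: h.
- have [b hb] := approximable_bounded hC (slash_approximable hC k (s1 _ gs) ra i).
  by exists b => z [vz lz]; apply: hb; apply: (apartment_aff hC (conj vz lz)) => //; have := ler0n R i; lra.
exists b => g dg z az; have [h hs e] := s2 _ dg.
by rewrite e //; apply: hb.
Qed.

Local Notation q := (#|F|%:R : R).

(** Of the neighbours of vertex i + 1, one is vertex i + 2; the other q are translates of vertex i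
    by c t^(i + 1), and the translation is absorbed into g. *)
Lemma vertex_step i b b' : lower_bound i.+2 b -> lower_bound i b' ->
  lower_bound i.+1 ((b + b' * q) / #|F|.+1%:R).
Proof.
move=> hb hb' g dg z az; have [t0 vt] := t_exp hv i.+1.
have i0 := ler0n R i; have e1 : i.+1%:R = i%:R + 1 :> R by rewrite natr1.
have e2 : i.+2%:R = i%:R + 1 + 1 :> R by rewrite !natr1.
apply: (@vertex_mean R F C emb v hC hv (io ('X ^+ i.+1)) z i.+2) => //.
- exact: Kinf_io.
- by rewrite vt.
- by rewrite vt; lra.
- by rewrite vt; lra.
- exact: slash_approximable.
- move=> w; rewrite vt => aw; apply: hb => //; move: aw; congr apartment; lra.
move=> c w; rewrite vt -rmorphM => aw.
have -> : w = (w - io (c%:P * 'X^(i.+1))) + io (c%:P * 'X^(i.+1)) by rewrite subrK.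
rewrite -(slash_Tm hC) //; apply: hb'; first by rewrite det_mulmx dg det_Tm mulr1.
by move: aw; congr apartment; lra.
Qed.

Lemma apartment_inv w : apartment 1 w -> apartment (-1) (- w^-1).
Proof.
move=> [vw lw]; split.
  by rewrite vlN // vlV // vw.
apply: level_le (inv_level hC lw ltr01 vw); rewrite ge_max; apply/andP; split; lra.
Qed.

(** At vertex 0 the q neighbours of valuation 1 are carried to vertex 1 by a translation and the
    inversion; the automorphy factor y^(-k) with vl y = 1 costs k. *)
Lemma vertex_step0 b : lower_bound 1 b ->
  lower_bound 0 ((b + (b - k%:R) * q) / #|F|.+1%:R).
Proof.
move=> hb g dg z az.
apply: (@vertex_mean R F C emb v hC hv 1 z 1) => //; rewrite ?(vl1 vv).
- exact: Kinf1.
- exact: oner_neq0.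
- by move: az; rewrite oppr0.
- by lra.
- by lra.
- exact: slash_approximable.
- move=> w aw; apply: hb => //; move: aw; congr apartment; lra.
move=> c w; rewrite mulr1 add0r => aw.
set y := w - io c%:P in aw; have -> : w = y + io c%:P by rewrite subrK.
have [vy ly] := aw; have [y0 _] := level_n0 hC ly.
have dT : \det (g *m Tm c%:P) = 1 by rewrite det_mulmx dg det_Tm mulr1.
rewrite -(slash_Tm hC) //.
have -> : g *m Tm c%:P = (g *m Tm c%:P *m adj2 (@Sm F)) *m @Sm F.
  by rewrite -[RHS]mulmxA adj2_mul ?mulmx1 // det_Sm.
have dS : \det (g *m Tm c%:P *m adj2 (@Sm F)) = 1.
  by rewrite det_mulmx dT det_adj2 det_Sm mulr1.
rewrite (slash_Sm hC) // addrC; apply: vgeM => //.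
  by right; rewrite vlV // vlX // vy mul1r.
by apply: hb => //; apply: apartment_inv.
Qed.

(* The convexity inequalities bound the growth of the infimum N_i of v(f|g) on
   the i-th vertex by N_i <= N_0 + k q^i, unless f vanishes on all vertices. *)
Lemma lower_bound_growth : (exists i b, ~ lower_bound i b) ->
  exists B, forall i b, lower_bound i b -> b <= B + k%:R * q ^+ i.
Proof.
move=> [i1 [b1 nb1]]; have q0 : 0 < #|F|.+1%:R :> R by rewrite ltr0n.
have qE : #|F|.+1%:R = q + 1 :> R by rewrite natr1.
have q2 : 2 <= q by rewrite ler_nat; exact: finNzRing_gt1.
(* [fin i] says that the infimum N_i is finite. An infinite infimum at one vertex propagates to the
   adjacent ones through the mean value inequality, as [bounded_below] controls the remaining
   neighbour. *)
pose fin i := exists b, ~ lower_bound i b.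
have step_up i : fin i -> fin i.+1.
  move=> [b nb]; apply: contrapT => nf; apply: nb.
  have all c : lower_bound i.+1 c by apply: contrapT => h; apply: nf; exists c.
  case: i all {nf} => [|i] all.
    apply: lower_bound_le (vertex_step0 (all (b + k%:R))).
    by rewrite ler_pdivlMr // qE; have := ler0n R k; lra.
  have [b' hb'] := bounded_below i.
  apply: lower_bound_le (vertex_step (all (b * #|F|.+1%:R - b' * q)) hb').
  by rewrite ler_pdivlMr //; lra.
have step_down i : fin i.+1 -> fin i.
  move=> [b nb]; apply: contrapT => nf; apply: nb.
  have all c : lower_bound i c by apply: contrapT => h; apply: nf; exists c.
  have [b' hb'] := bounded_below i.+2.
  apply: lower_bound_le (vertex_step hb' (all ((b * #|F|.+1%:R - b') / q))).
  by rewrite ler_pdivlMr // divfK; [lra|apply: lt0r_neq0; lra].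
have fin0 : fin 0%N.
  by have : fin i1 by [exists b1]; elim: i1 {nb1} => // i IH /step_down/IH.
have fin_all i : fin i by elim: i => // i /step_up.
have /choice[Nf hN] : forall i, exists b, lower_bound i b /\ forall c, lower_bound i c -> c <= b.
  move=> i; pose S := [set b | lower_bound i b].
  have [b0 hb0] := bounded_below i; have [c0 hc0] := fin_all i.
  have ubc : ubound S c0.
    move=> c hc; rewrite leNgt; apply/negP => lt; apply: hc0.
    exact: lower_bound_le (ltW lt) hc.
  have hs : has_sup S by split; [exists b0|exists c0].
  exists (sup S); split; last by move=> c hc; apply: ub_le_sup => //; exists c0.
  move=> g dg z az; have [->|nz] := eqVneq (sl g f z) 0; first by left.
  right; apply: ge_sup; first by exists b0.
  by move=> b hb; apply: (vge_nz nz); apply: hb.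
exists (Nf 0%N) => i b /(proj2 (hN i)) le; apply: le_trans le _.
have k0 := ler0n R k.
have d0 : Nf 1%N - Nf 0%N <= k%:R.
  have := proj2 (hN 0%N) _ (vertex_step0 (proj1 (hN 1%N))).
  by rewrite ler_pdivrMr // qE; nra.
have dS j : Nf j.+2 - Nf j.+1 <= q * (Nf j.+1 - Nf j).
  have := proj2 (hN j.+1) _ (vertex_step (proj1 (hN j.+2)) (proj1 (hN j))).
  by rewrite ler_pdivrMr // qE; lra.
(* By d0 and dS the increments satisfy N_(i+1) - N_i <= k q^i; their sum stays below k q^i because q
   >= 2. *)
have [] : Nf i <= Nf 0%N + k%:R * q ^+ i /\ Nf i.+1 - Nf i <= k%:R * q ^+ i; last by [].
elim: i => [|i [IH1 IH2]]; first by rewrite expr0 mulr1; split=> //; lra.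
have qi : 0 <= k%:R * q ^+ i by rewrite mulr_ge0 // exprn_ge0 // ler0n.
have := dS i; rewrite !exprS; move: qi IH1 IH2; move: (q ^+ i) => x.
rewrite mulrCA; move: (k%:R * x) => y qi IH1 IH2 dSi; split; nra.
Qed.

Variable s : seq 'M[A]_2.
Hypothesis s1 : forall g, g \in s -> \det g = 1.
Hypothesis s2 : forall g, \det g = 1 -> exists2 h, h \in s & forall f, inv f -> sl g f = sl h f.

Definition high_order (J : nat) : Prop := forall g, g \in s -> exists (a : nat -> C) (s0 : R),
  (forall i, (i < J)%N -> a i = 0) /\
  forall z, level s0 z -> vcvg v (psum a (lattice_exp emb v (translations (G r) g) z)^-1) (sl g f z).

Let d := (size N).-1.

Lemma high_order_bound J : high_order J -> exists B i0, forall i, (i0 <= i)%N ->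
  lower_bound i (J%:R * q ^+ (i - d) - B).
Proof.
move=> hJ.
have q2 : 2 <= q by rewrite ler_nat; exact: finNzRing_gt1.
(* The single number b <= 0 serves both as error term and, through - b <= i, as threshold for i, so
   one minimum over the cosets settles both. *)
have [|g gs|B hB] := @finite_bound (fun g b => b <= 0 /\ forall i z, apartment (- i%:R) z ->
  - b <= i%:R -> vge (J%:R * q ^+ (i - d) + b) (sl g f z)) s.
- move=> g b b' le [b0 h]; split; first by lra.
  by move=> i z az hi; apply: vgeW (h i z az _); lra.
- have dg := s1 gs; have [a [s0 [aJ ha]]] := hJ _ gs.
  have [z0 lz0] := level_ex hC hv s0.
  pose u z := (lattice_exp emb v (translations (G r) g) z)^-1.
  have T0 := trans0 n wp r dg; have TB := @transB F n wp r g dg.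
  have u0 : u z0 != 0.
    by rewrite invr_eq0; have [] := lattice_exp_level hC hv T0 TB lz0.
  have [B hB] := coef_bound (vv) u0 (ha _ lz0).
  pose tau := Order.max 0 (vl (u z0)).
  have tau0 : 0 <= tau by rewrite le_max lexx.
  have hB' i : vge (- (tau * i%:R) - B) (a i).
    apply: vgeW (hB i); rewrite lerD2r lerN2; apply: ler_wpM2r => //.
    by rewrite le_max lexx orbT.
  (* From i1 on the vertex lies in the region of convergence, i exceeds d, and q^(i - d) >= tau, so
     the lower bounds for the terms j >= J are least at j = J. *)
  have [i1 hi1] := archi_nat (Order.max (- s0) (d%:R + 1 + tau)).
  move: hi1; rewrite ge_max => /andP[hi1 hi2].
  exists (- (`|J%:R * tau + B| + i1%:R)); rewrite oppr_le0 addr_ge0 //; split=> //.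
  move=> i z az; rewrite opprK => hi; have [vz lz] := az.
  have ii1 : i1%:R <= i%:R :> R by have := normr_ge0 (J%:R * tau + B); lra.
  have di : (d < i)%N by rewrite -(ltr_nat R); lra.
  have w_u : q ^+ (i - d) <= vl (u z).
    have := lattice_exp_apartment hC hv N_neq0 (fun b => transN n wp dg b r1) az di.
    by rewrite /u vlV // -natrX; lra.
  have tw : tau <= q ^+ (i - d).
    have : (i - d)%:R <= (#|F| ^ (i - d))%:R :> R.
      by rewrite ler_nat ltnW // ltn_expl // finNzRing_gt1.
    by rewrite natrX natrB 1?ltnW //; lra.
  have lz0' : level s0 z by apply: level_le lz; lra.
  apply: (vcvg_vge vv _ (ha _ lz0')); exists 0%N => m _.
  apply: vge_sum => // j _; have [jJ|Jj] := ltnP j J; first by left; rewrite aJ // mul0r.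
  apply: vgeW (vgeM vv (hB' j) (vgeX vv j (vge_val v (u z)))).
  have k1 : (q ^+ (i - d) - tau) * J%:R <= (q ^+ (i - d) - tau) * j%:R.
    by apply: ler_wpM2l; [lra|rewrite ler_nat].
  have k2 : q ^+ (i - d) * j%:R <= vl (u z) * j%:R by apply: ler_wpM2r.
  have k3 := ler_norm (J%:R * tau + B); have k4 := ler0n R i1.
  by move: k1 k2 k3 k4; rewrite !mulrBl; lra.
have [i0 hi0] := archi_nat (- B); exists (- B), i0 => i ii0 g dg z az.
have [h hs e] := s2 dg; have [_ hBh] := hB _ hs.
rewrite e // opprK; apply: hBh => //; apply: le_trans hi0 _; by rewrite ler_nat.
Qed.

(** If some infimum were finite, they would be at most B + (k q^d) q^(i - d) and at least J q^(i -
    d) - B', impossible for large i when J > k q^d. *)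
Lemma high_order_lower_bound J : (k * #|F| ^ d < J)%N -> high_order J ->
  forall i b, lower_bound i b.
Proof.
move=> kJ hJ; apply: contrapT => no.
have ex : exists i b, ~ lower_bound i b.
  apply: contrapT => h; apply: no => i b; apply: contrapT => nb; apply: h; by exists i, b.
have [B hB] := lower_bound_growth ex; have [B' [i0 hB']] := high_order_bound hJ.
have [i1 hi1] := archi_nat (B + B' + 1); pose i := (maxn (maxn i0 i1) d + d)%N.
have h1 : (i0 <= i)%N by rewrite /i; lia.
have := hB _ _ (hB' i h1).
have di : (d <= i)%N by rewrite leq_addl.
have J1 : k%:R * q ^+ d + 1 <= J%:R.
  by rewrite -natrX -natrM natr1 ler_nat.
have E : q ^+ i = q ^+ d * q ^+ (i - d) by rewrite -exprD subnKC.
have k2 : (i - d)%:R <= (#|F| ^ (i - d))%:R :> R.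
  by rewrite ler_nat ltnW // ltn_expl // finNzRing_gt1.
rewrite natrX in k2.
have k3 : i1%:R <= (i - d)%:R :> R by rewrite ler_nat /i; lia.
rewrite E; have := ler_wpM2r (x := q ^+ (i - d)) _ J1; move=> /(_ (le_trans (ler0n _ _) k2)).
by rewrite mulrDl mul1r -mulrA; lra.
Qed.

Lemma high_order_eq0 J : (k * #|F| ^ d < J)%N -> high_order J -> f = (fun=> 0).
Proof.
move=> kJ hJ; have all0 := high_order_lower_bound kJ hJ.
apply/funext => z; have [Oz|nOz] := pselect (Omega emb v z); last exact: sf.
have [m lz] := Omega_level hC Oz; have [g [w [dg aw le0 mw]]] := reduction hC hv lz.
suff h0 : sl g f w = 0.
  move: h0; have [_ lw] := aw; have Ow := level_Omega lw.
  have dn := den_neq0 hC (det_toK1 dg) Ow.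
  rewrite slashE det_toK dg !rmorph1 expr1n mul1r mw => /eqP; rewrite mulf_eq0.
  by rewrite invr_eq0 expf_eq0 (negbTE dn) andbF => /eqP.
apply: (@vge_all0 _ _ v) => b.
(* The integral part of - vl w: w lies over vertex i or over the open edge from i to i + 1. *)
have [i [hi1 hi2]] : exists i : nat, - vl w < i%:R + 1 /\ i%:R <= - vl w.
  have ex : exists i : nat, - vl w < i.+1%:R.
    by have [i hi] := archi_nat (- vl w); exists i; rewrite -natr1; lra.
  case: (ex_minnP ex) => i lt min; exists i; rewrite natr1; split=> //.
  case: i min {lt} => [|i] min; first by lra.
  by rewrite leNgt; apply/negP => /min; rewrite ltnn.
have [e|ne] := eqVneq (- vl w) i%:R.
  by apply: (all0 i) => //; move: aw; rewrite -e opprK.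
have [t0 vt] := t_exp hv i; have i_0 := ler0n R i.
have lt : i%:R < - vl w by rewrite lt_neqAle eq_sym ne.
apply: (@edge_mean R F C emb v hC hv (io ('X ^+ i)) w (vl w) i.+1) => //.
- exact: Kinf_io.
- by rewrite vt; lra.
- by rewrite vt; lra.
- by rewrite vt -natr1; lra.
- by rewrite vt -natr1; lra.
- exact: slash_approximable.
- by move=> y; rewrite vt => ay; apply: (all0 i.+1) => //; move: ay; congr apartment; rewrite -natr1; lra.
- by move=> y; rewrite vt; apply: all0.
Qed.

End Form.
End Vanishing.

(** * Slope dimensions of linear operators *)

Section FunctionSpaces.
Context {C : fieldType}.
Implicit Types (W : set (C -> C)) (U : (C -> C) -> C -> C).

Definition subspace W : Prop :=
  W (fun=> 0) /\ forall c f g, W f -> W g -> W (fun z => c * f z + g z).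

Definition independent (d : nat) (b : 'I_d -> C -> C) : Prop :=
  forall c : 'I_d -> C, (forall z, \sum_(i < d) c i * b i z = 0) -> forall i, c i = 0.

Definition dim_le W (D : nat) : Prop :=
  forall d (b : 'I_d -> C -> C), (forall i, W (b i)) -> independent b -> (d <= D)%N.

Definition linear_op U : Prop :=
  forall c f g z, U (fun z => c * f z + g z) z = c * U f z + U g z.

Lemma subspace_sum W (I : finType) (c : I -> C) (b : I -> C -> C) : subspace W ->
  (forall i, W (b i)) -> W (fun z => \sum_i c i * b i z).
Proof.
move=> [W0 WD] Wb.
have h (r : seq I) : W (fun z => \sum_(i <- r) c i * b i z).
  elim: r => [|i r IH].
    by have -> : (fun z => \sum_(i <- [::]) c i * b i z) = (fun=> 0 : C); first by apply/funext => z; rewrite big_nil.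
  have -> : (fun z => \sum_(j <- i :: r) c j * b j z) =
      (fun z => c i * b i z + \sum_(j <- r) c j * b j z).
    by apply/funext => z; rewrite big_cons.
  exact: WD.
exact: h.
Qed.

Lemma has_dimension_ex W D : subspace W -> dim_le W D -> exists d, has_dimension W d.
Proof.
move=> sW dW.
pose P d := `[< exists b : 'I_d -> C -> C, (forall i, W (b i)) /\ independent b >].
have P0 : exists d, P d by exists 0%N; apply/asboolP; exists (fun _ _ => 0); split=> [[]|c _ []].
have PD d : P d -> (d <= D)%N by move=> /asboolP[b [Wb ib]]; apply: dW Wb ib.
case: (ex_maxnP P0 PD) => d /asboolP[b [Wb ib]] max.
exists d, b; split=> // f; split; last by move=> [c ->]; apply: subspace_sum.
move=> Wf; apply: contrapT => nf.
have /max : P d.+1; last by rewrite ltnn.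
apply/asboolP; exists (fun i => if unlift ord0 i is Some i' then b i' else f); split.
  by move=> i; case: unliftP => [i' _|_].
move=> c hc.
have hc' z : c ord0 * f z + \sum_(i < d) c (lift ord0 i) * b i z = 0.
  rewrite -[RHS](hc z) big_ord_recl unlift_none; congr (_ + _).
  by apply: eq_bigr => i _; rewrite liftK.
have c0 : c ord0 = 0.
  apply/eqP; apply: contraPT (nf) => c0; rewrite notK.
  exists (fun i => - (c ord0)^-1 * c (lift ord0 i)); apply/funext => z.
  under eq_bigr do rewrite -mulrA; rewrite -mulr_sumr.
  have := hc' z; move: (\sum_(i < d) _) => x /eqP; rewrite addrC addr_eq0 => /eqP->.
  by field.
move=> i; case: (unliftP ord0 i) => [i' ->|->//].
by apply: (ib (fun i => c (lift ord0 i))) => z; rewrite -[RHS](hc' z) c0 mul0r add0r.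
Qed.

Lemma dim_le_sub W W' D : W' `<=` W -> dim_le W D -> dim_le W' D.
Proof. by move=> sub h d b Wb; apply: h => i; apply: sub. Qed.

Lemma linear_op0 U : linear_op U -> forall z, U (fun=> 0) z = 0.
Proof.
move=> lU z; have := lU (-1) (fun=> 0) (fun=> 0) z.
have -> : (fun z : C => -1 * (fun=> 0 : C) z + (fun=> 0 : C) z) = (fun=> 0 : C).
  by apply/funext => w; rewrite mulr0 addr0.
by rewrite mulN1r addNr.
Qed.

Lemma iter_linear U l m : linear_op U ->
  linear_op (iter m (fun g z => U g z - l * g z)).
Proof.
move=> lU; elim: m => [|m IH] c f g z //=.
have -> : iter m (fun g z => U g z - l * g z) (fun z => c * f z + g z) =
  (fun z => c * iter m (fun g z => U g z - l * g z) f z +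
            iter m (fun g z => U g z - l * g z) g z) by apply/funext => w; exact: IH.
by rewrite lU; ring.
Qed.

Lemma iter_zero U l m e f : linear_op U ->
  iter m (fun g z => U g z - l * g z) f = (fun=> 0) ->
  iter (e + m) (fun g z => U g z - l * g z) f = (fun=> 0).
Proof.
move=> lU h; rewrite iterD h; elim: e => //= e ->.
by apply/funext => z; rewrite linear_op0 // mulr0 subrr.
Qed.

Lemma generalized_subspace W U l : subspace W -> linear_op U ->
  subspace (generalized_eigenspace W U l).
Proof.
move=> [W0 WD] lU; split; first by split=> //; exists 0%N.
move=> c f g [Wf [m hm]] [Wg [e he]]; split; first exact: WD.
exists (m + e)%N; apply/funext => z; rewrite iter_linear //.
have -> := iter_zero m lU he; rewrite addnC; have -> := iter_zero e lU hm.
by rewrite mulr0 addr0.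
Qed.

(* Evaluating polynomials in U separates the eigenvectors. *)
Lemma eigenvectors_independent U (d : nat) (lam : 'I_d -> C) (b : 'I_d -> C -> C) :
  linear_op U -> injective lam -> (forall i, b i <> (fun=> 0)) ->
  (forall i, U (b i) = (fun z => lam i * b i z)) -> independent b.
Proof.
move=> lU inj nz eig c hc.
have Usum (e : 'I_d -> C) : U (fun z => \sum_i e i * b i z) = (fun z => \sum_i e i * lam i * b i z).
  have h (r : seq 'I_d) : U (fun z => \sum_(i <- r) e i * b i z) =
      (fun z => \sum_(i <- r) e i * lam i * b i z).
    elim: r => [|i r IH].
      have -> : (fun z => \sum_(i <- [::]) e i * b i z) = (fun=> 0 : C).
        by apply/funext => z; rewrite big_nil.
      by apply/funext => z; rewrite linear_op0 // big_nil.
    have -> : (fun z => \sum_(j <- i :: r) e j * b j z) =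
        (fun z => e i * b i z + \sum_(j <- r) e j * b j z).
      by apply/funext => z; rewrite big_cons.
    by apply/funext => z; rewrite lU IH eig big_cons mulrA.
  exact: h.
have pow m : (fun z => \sum_i c i * lam i ^+ m * b i z) = (fun=> 0).
  elim: m => [|m IH]; first by apply/funext => z; rewrite -[RHS](hc z); apply: eq_bigr => i _; rewrite expr0 mulr1.
  have := Usum (fun i => c i * lam i ^+ m); rewrite IH => e.
  apply/funext => z; have := congr1 (fun g => g z) e; rewrite /= linear_op0 // => h; rewrite [RHS]h.
  by apply: eq_bigr => i _; rewrite exprSr mulrA.
have pol (P : {poly C}) z : \sum_i c i * P.[lam i] * b i z = 0.
  under eq_bigr do rewrite horner_coef mulr_sumr mulr_suml.
  rewrite exchange_big big1 // => m _ /=.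
  have := congr1 (fun g => g z) (pow m) => /= h.
  transitivity (P`_m * \sum_i c i * lam i ^+ m * b i z); last by rewrite h mulr0.
  by rewrite mulr_sumr; apply: eq_bigr => i _; ring.
move=> i; pose P := \prod_(j < d | j != i) ('X - (lam j)%:P).
have Pi : P.[lam i] != 0.
  rewrite horner_prod; apply/prodf_neq0 => j ji; rewrite hornerXsubC subr_eq0.
  by apply: contra_neq ji => /inj.
have Pj j : j != i -> P.[lam j] = 0.
  by move=> ji; rewrite horner_prod (bigD1 j) //= hornerXsubC subrr mul0r.
apply/eqP; apply: contra_notT (nz i) => ci; apply/funext => z.
have := pol P z; rewrite (bigD1 i) //= big1 ?addr0 => [/eqP|j ji]; last by rewrite Pj // mulr0 mul0r.
by rewrite !mulf_eq0 (negbTE ci) (negbTE Pi) => /eqP.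
Qed.

Lemma slope_dimension_ex (X : Type) (L : fieldType) (j : {rmorphism L -> C}) (sl : L -> X)
    W U (a : X) D : subspace W -> linear_op U -> dim_le W D ->
  exists d, slope_dimension j sl W U a d.
Proof.
move=> sW lU dW; pose E l := eigenvalue_on W U (j l) /\ sl l = a.
have bd (s : seq L) : uniq s -> (forall l, l \in s -> E l) -> (size s <= D)%N.
  move=> us sE; have /choice[b hb] : forall i : 'I_(size s), exists f : C -> C,
      [/\ W f, f <> (fun=> 0) & U f = (fun z => j (tnth (in_tuple s) i) * f z)].
    by move=> i; have [[f hf] _] := sE _ (mem_tnth i (in_tuple s)); exists f.
  apply: (dW _ b); first by move=> i; case: (hb i).
  apply: (@eigenvectors_independent U _ (fun i => j (tnth (in_tuple s) i))) => //.
  - by move=> x y /fmorph_inj/(tuple_uniqP (in_tuple s) us).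
  - by move=> i; case: (hb i).
  - by move=> i; case: (hb i).
pose P m := `[< exists s : seq L, [/\ uniq s, forall l, l \in s -> E l & size s = m] >].
have P0 : exists m, P m by exists 0%N; apply/asboolP; exists [::].
have PD m : P m -> (m <= D)%N by move=> /asboolP[s [us sE <-]]; apply: bd.
case: (ex_maxnP P0 PD) => m /asboolP[s [us sE sm]] max.
have sE' l : l \in s <-> E l.
  split=> [/sE//|El]; apply: contrapT => /negP nl.
  have /max : P m.+1; last by rewrite ltnn.
  apply/asboolP; exists (l :: s); split; rewrite /= ?nl ?sm //.
  by move=> l'; rewrite in_cons => /orP[/eqP->|/sE].
have /choice[e he] : forall l, exists d, l \in s ->
    has_dimension (generalized_eigenspace W U (j l)) d.
  move=> l; have [d hd] := @has_dimension_ex (generalized_eigenspace W U (j l)) D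
    (generalized_subspace (j l) sW lU) (dim_le_sub (fun f => @proj1 _ _) dW).
  by exists d.
exists (\sum_(l <- s) e l)%N, s, e; split=> //.
Qed.

Lemma slope_dimension_eq (X : Type) (L : fieldType) (j : L -> C) (sl : L -> X)
    W W' U U' (a : X) d :
  (forall l, sl l = a -> (eigenvalue_on W U (j l) <-> eigenvalue_on W' U' (j l)) /\
     generalized_eigenspace W U (j l) = generalized_eigenspace W' U' (j l)) ->
  slope_dimension j sl W U a d -> slope_dimension j sl W' U' a d.
Proof.
move=> h [s [e [us sE se de]]]; exists s, e; split=> // l.
  split=> [/sE[el sl_]|[el sl_]]; first by split=> //; apply/(proj1 (h _ sl_)).
  by apply/sE; split=> //; apply/(proj1 (h _ sl_)).
move=> ls; have [_ sl_] := (sE l).1 ls.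
by rewrite -(proj2 (h _ sl_)); apply: se.
Qed.

End FunctionSpaces.

(** * Cusp forms *)

Section CuspForms.
Context {R : realType} {F : finFieldType} {C : fieldType}.
Variables (emb : {rmorphism {fraction {poly F}} -> C}) (v : C -> \bar R).
Hypothesis hC : completed_algebraic_closure v (range emb).
Hypothesis hv : extends_infty_valuation emb v.
Variables (k : nat) (n wp : {poly F}).
Hypothesis n0 : n != 0.
Hypothesis wp_irr : irreducible_poly wp.

Local Notation A := {poly F}.
Local Notation sl g f := (slash emb k (toK g) f).
Local Notation G := (Gam n wp).
Local Notation inv := (level_invariant emb v k n wp).
Local Notation Sk r := (cuspforms emb v k (Gamma1p n wp r)).
Local Notation U r := (hecke_U emb k (Gamma1p n wp r) wp).
Let vv := vv hC.
Hint Resolve vv : core.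
Let wp0 : wp != 0 := wp_neq0 wp_irr.

Lemma cuspformsP r f : (1 <= r)%N -> Sk r f <-> [/\ inv r f, rigid_analytic emb v f &
  forall g, \det g = 1 -> expandable emb v (translations (G r) g) (sl g f)].
Proof.
move=> r1; rewrite /cuspforms /= (GamE n wp r1).
split=> [[sf ra iv vc]|[[sf iv] ra vc]]; split=> //.
  by move=> g dg; apply/(vanishesP hC); apply: vc.
by move=> g dg; apply/(vanishesP hC); apply: vc.
Qed.

(** Level 1 mediates: its translation lattice contains those of levels r and s, so both expansions
    are compared with the one at level 1. *)
Lemma cuspforms_level r s f : (1 <= r)%N -> (1 <= s)%N -> inv 1 f -> Sk r f -> Sk s f.
Proof.
move=> r1 s1 I1 /(cuspformsP _ r1)[_ ra ex]; apply/(cuspformsP _ s1); split=> //.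
  exact: invariant_le I1.
move=> g dg.
have h t : (1 <= t)%N -> expandable emb v (translations (G 1) g) (sl g f) <->
    expandable emb v (translations (G t) g) (sl g f).
  by move=> t1; apply: expandable_level.
by apply/(h _ s1)/(h _ r1); apply: ex.
Qed.

Lemma psumZD (c : C) (a b : nat -> C) u m :
  psum (fun i => c * a i + b i) u m = c * psum a u m + psum b u m.
Proof.
rewrite /psum mulr_sumr -big_split /=; apply: eq_bigr => i _; ring.
Qed.

Lemma slashZD c f f' g : sl g (fun z => c * f z + f' z) = (fun z => c * sl g f z + sl g f' z).
Proof. by apply/funext => z; rewrite !slashE; ring. Qed.

Lemma cuspforms_subspace r : (1 <= r)%N -> subspace (Sk r).
Proof.
move=> r1; have slash0 (g : 'M[A]_2) : sl g (fun=> 0) = (fun=> 0 : C).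
  by apply/funext => z; rewrite slashE mulr0.
split.
  apply/(cuspformsP _ r1); split; first exact: invariant0.
    move=> m M; exists 0, 1 => z _; rewrite horner0 hornerC oner_neq0; split=> //.
    by rewrite mul0r subrr (v0 vv) ltry.
  move=> g dg; rewrite slash0; exists (fun=> 0), 0; split=> // z _.
  by apply: vcvg_ext (vcvg_cst vv 0); exists 0%N => m _; rewrite /psum big1 // => i _; rewrite mul0r.
move=> c f f' /(cuspformsP _ r1)[If ra ex] /(cuspformsP _ r1)[If' ra' ex'].
apply/(cuspformsP _ r1); split.
- exact: invariantD (invariantZ c If) If'.
- apply: (approximable_rigid hC) => m; apply: (approximableD hC).
    by apply: (approximableZ hC); exact: rigid_approximable.
  exact: rigid_approximable.
move=> g dg; rewrite slashZD.
have [a [s [a0 ha]]] := ex _ dg; have [b [t [b0 hb]]] := ex' _ dg.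
exists (fun i => c * a i + b i), (Order.min s t); rewrite a0 b0 mulr0 addr0; split=> // z lz.
have := vcvgD vv (vcvgZ vv c (ha z (level_le _ lz))) (hb z (level_le _ lz)).
rewrite !ge_min !lexx orbT => /(_ isT isT); apply: vcvg_ext.
by exists 0%N => m _; rewrite psumZD.
Qed.

Lemma slash_linear_sum (I : Type) (s : seq I) (c : I -> C) (b : I -> C -> C) g :
  sl g (fun z => \sum_(i <- s) c i * b i z) = (fun z => \sum_(i <- s) c i * sl g (b i) z).
Proof.
apply/funext => z; rewrite slash_sum; apply: eq_bigr => i _; exact: slashZ.
Qed.

(* A cusp form is determined by finitely many coefficients at finitely many
   cusps. *)
Lemma cuspforms_dim_le r : (1 <= r)%N -> exists D, dim_le (Sk r) D.
Proof.
move=> r1; have [s [s1 s2]] := finite_cosets hC k n0 wp0 r1.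
(* One more than k q^d, the threshold of [high_order_eq0]. *)
pose J := (k * #|F| ^ (size (n * wp ^+ r)).-1).+1.
exists (size s * J)%N => e b Sb ib; rewrite leqNgt; apply/negP => lt.
have /choice[a ha] : forall x : 'I_e * 'I_(size s), exists p : (nat -> C) * R, forall z,
    level emb v p.2 z -> vcvg v (psum p.1 (lattice_exp emb v (translations (G r) (tnth (in_tuple s) x.2)) z)^-1)
      (sl (tnth (in_tuple s) x.2) (b x.1) z).
  move=> [i x]; have [_ _ ex] := (cuspformsP _ r1).1 (Sb i).
  have [a [s0 [_ h]]] := ex _ (s1 _ (mem_tnth x (in_tuple s))); by exists (a, s0).
(* Row i holds the first J coefficients of b i for all cosets in s. With more rows than columns,
   some nontrivial combination of the b i has all of them equal to 0. *)
pose M : 'M[C]_(e, size s * J) :=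
  \matrix_(i < e) mxvec (\matrix_(x < size s, y < J) (a (i, x)).1 y).
have kM : kermx M != 0.
  rewrite -mxrank_eq0 mxrank_ker subn_eq0 -ltnNge.
  exact: leq_ltn_trans (rank_leq_col _) lt.
have [w [w0 wM]] : exists w : 'rV[C]_e, w != 0 /\ w *m M = 0.
  have /rowV0Pn[w wk w0] := kM; exists w; split=> //; exact/sub_kermxP.
have wa x (y : 'I_J) : \sum_i w 0 i * (a (i, x)).1 y = 0.
  have := congr1 (fun B : 'rV_(size s * J) => B 0 (mxvec_index x y)) wM.
  rewrite !mxE => h; rewrite -[RHS]h; apply: eq_bigr => i _.
  by rewrite mxE mxvecE mxE.
pose f z := \sum_i w 0 i * b i z.
have Sf : Sk r f by apply: subspace_sum => //; exact: cuspforms_subspace.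
have [If ra _] := (cuspformsP _ r1).1 Sf.
have f0 : f = (fun=> 0).
  apply: (@high_order_eq0 R F C emb v hC hv k n wp r n0 wp0 r1 f If ra s s1 s2 J _) => //.
  move=> g gs; have [x ->] := tnthP (in_tuple s) g gs.
  (* Minus the sum of absolute values lies below each radius, so all the expansions converge
     there. *)
  exists (fun y => \sum_i w 0 i * (a (i, x)).1 y), (- \sum_i `|(a (i, x)).2|).
  split; first by move=> y yJ; exact: (wa x (Ordinal yJ)).
  move=> z lz; rewrite slash_linear_sum.
  have c i : vcvg v (fun m => w 0 i * psum (a (i, x)).1
      (lattice_exp emb v (translations (G r) (tnth (in_tuple s) x)) z)^-1 m)
      (w 0 i * sl (tnth (in_tuple s) x) (b i) z).
    apply: vcvgZ => //; apply: (ha (i, x)); apply: level_le lz.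
    rewrite lerNl (bigD1 i) //= -normrN (le_trans (ler_norm _)) // lerDl.
    exact: sumr_ge0.
  apply: vcvg_ext (vcvg_sum vv (index_enum _) c); exists 0%N => m _.
  rewrite /psum; under [RHS]eq_bigr do rewrite mulr_suml.
  rewrite [RHS]exchange_big /=; apply: eq_bigr => i _.
  by rewrite mulr_sumr; apply: eq_bigr => y _; rewrite mulrA.
have w00 : w = 0.
  apply/rowP => i; rewrite mxE; apply: (ib (fun i => w 0 i)) => z.
  exact: (congr1 (fun g => g z) f0).
by rewrite w00 eqxx in w0.
Qed.

Lemma hecke_linear r : linear_op (U r).
Proof.
move=> c f g z; rewrite /hecke_U mulr_sumr -big_split /=; apply: eq_bigr => x _.
by rewrite slashZD.
Qed.

(* Eigenvectors for a nonzero eigenvalue are invariant under the group of level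
   wp, hence are cusp forms of that level. *)
Lemma generalized_level r l f : (1 <= r)%N -> l != 0 ->
  generalized_eigenspace (Sk r) (U r) l f <-> generalized_eigenspace (Sk 1) (U 1) l f.
Proof.
move=> r1 l0.
have key s t : (1 <= s)%N -> (1 <= t)%N ->
    generalized_eigenspace (Sk s) (U s) l f -> generalized_eigenspace (Sk t) (U t) l f.
  move=> s1 t1 [Sf [m hm]]; have [Is _ _] := (cuspformsP _ s1).1 Sf.
  have [e1 _] := iter_hecke_U hC wp_irr s1 l m Is; rewrite e1 in hm.
  have I1 := nilpotent_bottom hC wp_irr s1 l0 Is hm.
  split; first exact: cuspforms_level I1 Sf.
  exists m; have [-> _] := iter_hecke_U hC wp_irr t1 l m (invariant_le t1 I1).
  exact: hm.
by split; apply: key.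
Qed.

Lemma generalized_invariant r l f : (1 <= r)%N -> l != 0 ->
  generalized_eigenspace (Sk r) (U r) l f -> inv 1 f.
Proof.
move=> r1 l0 /(generalized_level _ r1 l0)[Sf _].
by case: ((cuspformsP _ (leqnn 1)).1 Sf).
Qed.

Lemma eigen_generalized W r l f : W f -> U r f = (fun z => l * f z) ->
  generalized_eigenspace W (U r) l f.
Proof.
move=> Wf e; split=> //; exists 1%N; apply/funext => z /=.
by rewrite e subrr.
Qed.

Lemma hecke_U_level r s f : (1 <= r)%N -> (1 <= s)%N -> inv 1 f -> U r f = U s f.
Proof.
by move=> r1 s1 I1; rewrite !(hecke_UE hC wp_irr) //; apply: invariant_le I1.
Qed.

(** Both assertions of the theorem are instances: P is either everything or the condition on the
    diamond operators. Independence of r is asked only of functions invariant at level 1, which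
    covers the generalised eigenvectors. *)
Lemma slope_level (P : nat -> set (C -> C)) (X : Type) (L : fieldType)
    (j : {rmorphism L -> C}) (sl0 : L -> X) (a : X) :
  (forall l, sl0 l = a -> l != 0) ->
  (forall r f, (1 <= r)%N -> inv 1 f -> P r f <-> P 1%N f) ->
  (forall c f g, P 1%N f -> P 1%N g -> P 1%N (fun z => c * f z + g z)) -> P 1%N (fun=> 0) ->
  exists d, forall r, (1 <= r)%N -> slope_dimension j sl0 (Sk r `&` P r) (U r) a d.
Proof.
move=> nz PE PD P0; have sub1 := cuspforms_subspace (leqnn 1).
have sW : subspace (Sk 1 `&` P 1%N).
  by split=> [|c f g [Sf Pf] [Sg Pg]]; split; try exact: P0; try exact: PD; apply sub1.
have [D dD] := cuspforms_dim_le (leqnn 1).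
have [d hd] := slope_dimension_ex j sl0 a sW (hecke_linear 1)
  (dim_le_sub (fun f => @proj1 _ _) dD).
exists d => r r1; apply: slope_dimension_eq hd => l /nz l0.
have jl0 : j l != 0 by rewrite fmorph_eq0.
have W1 s t f : (1 <= s)%N -> (1 <= t)%N ->
    generalized_eigenspace (Sk s `&` P s) (U s) (j l) f ->
    generalized_eigenspace (Sk t `&` P t) (U t) (j l) f /\ inv 1 f.
  move=> s1 t1 [[Sf Pf] hm].
  have gs : generalized_eigenspace (Sk s) (U s) (j l) f by split.
  have I1 := generalized_invariant s1 jl0 gs; split=> //.
  have [St ht] := (generalized_level f t1 jl0).2 ((generalized_level f s1 jl0).1 gs).
  by split=> //; split=> //; apply/(PE _ _ t1 I1)/(PE _ _ s1 I1).
split; last by apply/seteqP; split=> f h; [have [] := W1 1%N r f isT r1 h|have [] := W1 r 1%N f r1 isT h].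
have E s t : (1 <= s)%N -> (1 <= t)%N ->
    eigenvalue_on (Sk s `&` P s) (U s) (j l) -> eigenvalue_on (Sk t `&` P t) (U t) (j l).
  move=> s1 t1 [f [Wf fn e]]; have [[Wt _] I1] := W1 s t f s1 t1 (eigen_generalized Wf e).
  by exists f; split=> //; rewrite (hecke_U_level t1 s1 I1).
by split; apply: E.
Qed.

End CuspForms.

(** * Diamond operators *)

Section Adic.
Context {R : realType} {F : finFieldType} {D : fieldType}.
Variables (emb : {rmorphism {fraction {poly F}} -> D}) (v : D -> \bar R) (wp : {poly F}).
Hypothesis vv : is_valuation v.
Hypothesis hv : extends_adic_valuation wp emb v.
Hypothesis wp_irr : irreducible_poly wp.

Local Notation io := (coefA emb).

Lemma irredp_factor (a : {poly F}) : a != 0 ->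
  exists t b, ~~ (wp %| b) /\ a = wp ^+ t * b.
Proof.
move: {2}(size a) (leqnn (size a)) => m; elim: m a => [|m IH] a sa a0.
  by rewrite -size_poly_eq0 -leqn0 sa in a0.
have [/dvdpP[b aE]|nd] := boolP (wp %| a); last by exists 0%N, a; rewrite expr0 mul1r.
have b0 : b != 0 by apply: contraNneq a0 => b0; rewrite aE b0 mul0r.
have [||t [c [nc bE]]] := IH b => //.
  have [h _] := wp_irr; move: sa.
  rewrite aE size_mul ?(wp_neq0 wp_irr) //; move: h.
  by move: (size wp) (size b) => x y; lia.
by exists t.+1, c; split=> //; rewrite aE bE exprS; ring.
Qed.

Lemma vl_adic_unit a : ~~ (wp %| a) -> vl v (io a) = 0.
Proof. by move=> na; rewrite /vl /= (proj2 hv). Qed.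

Lemma vl_adic t a : ~~ (wp %| a) -> vl v (io (wp ^+ t * a)) = t%:R.
Proof.
move=> na; have a0 : a != 0 by apply: contraNneq na => ->; rewrite dvdp0.
have w0 := wp_neq0 wp_irr.
have -> : io (wp ^+ t * a) = io wp ^+ t * io a by rewrite rmorphM rmorphXn.
rewrite vlM ?expf_neq0 ?io_eq0 // vlX ?io_eq0 // (vl_adic_unit na).
have -> : vl v (io wp) = 1 by rewrite /vl /= (proj1 hv).
by rewrite mul1r addr0.
Qed.

Lemma vge_adic r a : wp ^+ r %| a -> vge v r%:R (io a).
Proof.
have [->|a0] := eqVneq a 0; first by left; rewrite rmorph0.
move=> /dvdpP[b aE].
have b0 : b != 0 by apply: contraNneq a0 => b0; rewrite aE b0 mul0r.
have [t [c [nc bE]]] := irredp_factor b0; right.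
have -> : a = wp ^+ (r + t) * c by rewrite aE bE exprD; ring.
by rewrite vl_adic // ler_nat leq_addr.
Qed.

Lemma vge0_adic a : vge v 0 (io a).
Proof. by apply: (vge_adic (r := 0)); rewrite expr0 dvd1p. Qed.

Lemma adic_dvd a : vge v 1 (io a) -> wp %| a.
Proof.
move=> h; apply/negP => /negP na.
have a0 : a != 0 by apply: contraNneq na => ->; rewrite dvdp0.
by have := vge_nz _ h; rewrite io_eq0 vl_adic_unit // => /(_ a0); lra.
Qed.

Lemma coprime_adic r a : ~~ (wp %| a) -> coprimep a (wp ^+ r).
Proof.
move=> na; rewrite coprimep_sym; apply: coprimep_expl.
rewrite coprimep_def; have [_ h] := wp_irr.
have [//|s1] := eqVneq (size (gcdp wp a)) 1%N.
have /h := dvdp_gcdl wp a; rewrite s1 => /(_ isT) e.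
by move: na; rewrite -(eqp_dvdl _ e) dvdp_gcdr.
Qed.

(** A nearby fraction has a denominator prime to wp after cancellation, because x is integral;
    Bezout inverts that denominator modulo wp^r and leaves a polynomial. *)
Lemma adic_integer_dense x r : vclosure v (range emb) x -> vge v 0 x ->
  exists a, vge v r%:R (x - io a).
Proof.
move=> /(vclosureP _ vv) /(_ r%:R)[_ [y _ <-] hy] x0.
have [a [b [b0 yE]]] := frac_repr y.
have [a0|a0] := eqVneq a 0.
  by exists 0; move: hy; rewrite yE a0 !rmorph0 mul0r rmorph0.
have [t [a' [na aE]]] := irredp_factor a0; have [s [b' [nb bE]]] := irredp_factor b0.
have yE' : emb y = io a / io b by rewrite yE fmorph_div.
have st : (s <= t)%N.
  have y0 : vge v 0 (emb y).
    have -> : emb y = x - (x - emb y) by ring.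
    by apply: vgeB => //; apply: vgeW hy; exact: ler0n.
  have := vge_nz _ y0; rewrite yE' mulf_neq0 ?invr_eq0 ?io_eq0 // => /(_ isT).
  by rewrite vl_div ?io_eq0 // aE bE !vl_adic // subr_ge0 ler_nat.
have /Bezout_eq1_coprimepP[[u w] /= e] := coprime_adic r nb.
exists (wp ^+ (t - s) * a' * u).
have b'0 : b' != 0 by apply: contraNneq nb => ->; rewrite dvdp0.
have w0 := wp_neq0 wp_irr.
have -> : x - io (wp ^+ (t - s) * a' * u) = (x - emb y) + io (wp ^+ (t - s) * a') * io (w * wp ^+ r) / io b'.
  have tE : wp ^+ t = wp ^+ (t - s) * wp ^+ s by rewrite -exprD subnK.
  rewrite yE' aE tE bE (_ : w * wp ^+ r = 1 - u * b'); last by rewrite -e; ring.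
  rewrite !(rmorphM, rmorphB, rmorph1, rmorphXn); field.
  by rewrite io_eq0 b'0 expf_neq0 ?io_eq0.
apply: vgeD => //.
rewrite -[r%:R]add0r -[_ + _]addr0; apply: vgeM => //.
  by apply: vgeM => //; [exact: vge0_adic|apply: vge_adic; rewrite dvdp_mull].
by right; rewrite vlV // vl_adic_unit // oppr0.
Qed.

End Adic.

(** * The matrices of the diamond operators *)

Section DiamondMatrices.
Context {R : realType} {F kappa : finFieldType} {L C D : fieldType}.
Variables (iK : {rmorphism {fraction {poly F}} -> L}) (j : {rmorphism L -> C}).
Variables (iota : {rmorphism L -> D}) (v : D -> \bar R) (n wp : {poly F}).
Variables (red : {rmorphism {poly F} -> kappa}) (teich : {rmorphism kappa -> L}).
Hypothesis vv : is_valuation v.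
Hypothesis hv : extends_adic_valuation wp (iota \o iK) v.
Hypothesis wp_irr : irreducible_poly wp.
Hypothesis n_coprime : coprimep n wp.
Hypothesis hteich : is_residue_section iK iota v red teich.

Local Notation A := {poly F}.
Local Notation io := (coefA (iota \o iK)).
Local Notation diamond_matrix r := (is_diamond_matrix iK iota v n wp r teich).

Lemma teich_integral x : vge v 0 (iota (teich x)).
Proof. by have [_ /(vgeP vv)] := hteich x. Qed.

Lemma vl_teich x : x != 0 -> vl v (iota (teich x)) = 0.
Proof.
move=> x0; have nz y : y != 0 -> iota (teich y) != 0 by move=> y0; rewrite !fmorph_eq0.
have h1 := vge_nz (nz _ x0) (teich_integral x).
have x0' : x^-1 != 0 by rewrite invr_eq0.
have := vge_nz (nz _ x0') (teich_integral x^-1).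
by rewrite !fmorphV vlV //; lra.
Qed.

Lemma diamond_matrix_exists r l : (1 <= r)%N -> exists g, diamond_matrix r l g.
Proof.
move=> r1; set T := iota (teich (val l)).
have l0 : val l != 0 by rewrite -unitfE; exact: (valP l).
have T0 : T != 0 by rewrite !fmorph_eq0.
have vT : vl v T = 0 by exact: vl_teich.
have [clT _ _] := hteich (val l).
have [e he] := adic_integer_dense vv hv wp_irr r clT (teich_integral _).
have /Bezout_eq1_coprimepP[[u w] /= uw] : coprimep n (wp ^+ r) by rewrite coprimep_expr.
(* Chinese remainders: d is 1 modulo n and, as n u = 1 modulo wp^r, it is e modulo wp^r, where e
   approximates the Teichmueller lift. *)
pose d := 1 + n * u * (e - 1).
have hd : vge v r%:R (io d - T).
  have -> : io d - T = io (w * wp ^+ r * (1 - e)) - (T - io e).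
    have -> : io d = io e + io (d - e) by rewrite -rmorphD; congr (io _); ring.
    have -> : d - e = w * wp ^+ r * (1 - e).
      have -> : w * wp ^+ r = 1 - n * u by rewrite -uw; ring.
      by rewrite /d; ring.
    ring.
  by apply: vgeB => //; apply: (vge_adic vv hv wp_irr); rewrite dvdp_mulr ?dvdp_mull.
have nd : ~~ (wp %| d).
  apply/negP => wd; have : vge v 1 T.
    have -> : T = io d - (io d - T) by ring.
    apply: vgeB => //; last by apply: vgeW hd; rewrite ler1n.
    by apply: (vge_adic vv hv wp_irr (r := 1)); rewrite expr1.
  by move=> /(vge_nz T0); rewrite vT; lra.
have cdn : coprimep d n.
  by apply/Bezout_eq1_coprimepP; exists (1, - (u * (e - 1))) => /=; rewrite /d; ring.
have cdw := coprime_adic wp_irr r nd.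
pose N := n * wp ^+ r.
have nN : n %| N by rewrite dvdp_mulr.
have wN : wp ^+ r %| N by rewrite dvdp_mull.
(* Inverting d modulo N^2 rather than N gives a d + y N^2 = 1, so both off-diagonal entries - y N
   and N can be multiples of N. *)
have /Bezout_eq1_coprimepP[[a y] /= ay] : coprimep d (N * N).
  by rewrite !coprimepMr cdn cdw.
have nd1 : n %| d - 1 by rewrite /d addrC addKr -mulrA dvdp_mulr.
have na1 : n %| a - 1.
  have -> : a - 1 = - (n * (wp ^+ r * (y * N))) - a * (d - 1).
    by rewrite -[X in a - X = _]ay /N; ring.
  by apply: dvdp_sub; [rewrite dvdpNr dvdp_mulr|rewrite dvdp_mull].
exists (mat2 a (- (y * N)) N d); split; rewrite ?mat2E.
- by rewrite /SL2 /= det2E !mat2E -ay; ring.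
- by move=> i k; case: (ord2P i) => ->; case: (ord2P k) => ->; rewrite !mat2E /= ?subr0 // dvdpNr dvdp_mull.
- by rewrite dvdpNr dvdp_mull.
- apply/(vgeP vv); rewrite -/T -[iota (iK _)]/(io a).
  have -> : io a - T^-1 = T^-1 * (io (- (y * N * n) * wp ^+ r) - io a * (io d - T)).
    have -> : - (y * N * n) * wp ^+ r = a * d - 1 by rewrite -ay /N; ring.
    by rewrite rmorphB rmorphM rmorph1; field.
  rewrite -[r%:R]add0r; apply: vgeM => //; first by right; rewrite vlV // vT oppr0.
  apply: vgeB => //; first by apply: (vge_adic vv hv wp_irr); rewrite dvdp_mull.
  by rewrite -[r%:R]add0r; apply: vgeM => //; exact: (vge0_adic vv hv wp_irr).
by apply/(vgeP vv); exact: hd.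
Qed.

Lemma diamond_matrix_quotient r l g h : (1 <= r)%N ->
  diamond_matrix r l g -> diamond_matrix 1 l h -> Gam n wp 1 (g *m adj2 h).
Proof.
move=> r1 [dg ng [wg wg'] ag eg] [dh nh [wh wh'] ah eh].
rewrite !expr1 in wh wh'; move: wg wg' => /(wp_dvd r1) wg /(wp_dvd r1) wg'.
rewrite /SL2 /= in dg dh.
have := ng 0 0; have := ng 0 1; have := ng 1 0; have := ng 1 1.
have := nh 0 0; have := nh 0 1; have := nh 1 0; have := nh 1 1.
rewrite /= ?subr0 => h11 h10 h01 h00 g11 g10 g01 g00.
have cong (x y : A) T : ((r%:R)%:E <= v (iota (iK (FracField.tofrac x)) - T)%R)%E ->
    ((1%:R)%:E <= v (iota (iK (FracField.tofrac y)) - T)%R)%E -> wp %| x - y.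
  move=> /(vgeP vv) hx /(vgeP vv) hy; apply: (adic_dvd hv).
  have -> : io (x - y) = (iota (iK (FracField.tofrac x)) - T) - (iota (iK (FracField.tofrac y)) - T).
    by rewrite rmorphB /=; ring.
  by apply: vgeB => //; apply: vgeW hx; rewrite ler1n.
have c00 := cong _ _ _ ag ah; have c11 := cong _ _ _ eg eh.
have dh' := dh; rewrite det2E in dh'.
have E0 : (g *m adj2 h) 0 0 - 1 = (g 0 0 - h 0 0) * h 1 1 - (g 0 1 - h 0 1) * h 1 0.
  by rewrite mulmx2E !mat2E -dh'; ring.
have E1 : (g *m adj2 h) 1 1 - 1 = (g 1 1 - h 1 1) * h 0 0 - (g 1 0 - h 1 0) * h 0 1.
  by rewrite mulmx2E !mat2E -dh'; ring.
have E2 : (g *m adj2 h) 1 0 = g 1 0 * h 1 1 - g 1 1 * h 1 0.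
  by rewrite mulmx2E !mat2E; ring.
have n0 : n %| g 0 0 - h 0 0.
  by have -> : g 0 0 - h 0 0 = (g 0 0 - 1) - (h 0 0 - 1) by [ring]; dvd.
have n1 : n %| g 1 1 - h 1 1.
  by have -> : g 1 1 - h 1 1 = (g 1 1 - 1) - (h 1 1 - 1) by [ring]; dvd.
split; rewrite ?expr1 ?E0 ?E1 ?E2.
- by rewrite det_mulmx det_adj2 dg dh mulr1.
- by split; dvd.
- by split; dvd.
by dvd.
Qed.

Lemma diamond_level (vC : C -> \bar R) k r l f :
  completed_algebraic_closure vC (range (j \o iK)) -> (1 <= r)%N ->
  level_invariant (j \o iK) vC k n wp 1 f ->
  diamond iK j iota v n wp r teich k l f = diamond iK j iota v n wp 1 teich k l f.
Proof.
move=> hC r1 If; rewrite /diamond.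
have Hg := xgetPex 1%:M (diamond_matrix_exists l r1).
have Hh := xgetPex 1%:M (diamond_matrix_exists l (leqnn 1)).
set g := xget _ _ in Hg *; set h := xget _ _ in Hh *.
have [dh _ _ _ _] := Hh.
rewrite -(invariant_mul (h := h) hC If (diamond_matrix_quotient r1 Hg Hh)) ?(det1_neq0 dh) //.
by rewrite -mulmxA adj2_mul // mulmx1.
Qed.

End DiamondMatrices.

Theorem proposition3p5
  (R : realType) (F : finFieldType)
  (* the algebraic closure of K, the fields C_infty and C_wp *)
  (Kbar Cinf Cwp : fieldType)
  (iK : {rmorphism {fraction {poly F}} -> Kbar})
  (j : {rmorphism Kbar -> Cinf}) (iota : {rmorphism Kbar -> Cwp})
  (vinf : Cinf -> \bar R) (vwp : Cwp -> \bar R)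
  (wp n : {poly F})
  (kappa : finFieldType) (red : {rmorphism {poly F} -> kappa})
  (teich : {rmorphism kappa -> Kbar})
  (wp_irr : irreducible_poly wp)
  (n_neq0 : n != 0)
  (n_coprime : coprimep n wp)
  (hCinf : completed_algebraic_closure vinf (range (j \o iK)))
  (hvinf : extends_infty_valuation (j \o iK) vinf)
  (hKbar : range j = algebraic_over (range (j \o iK)))
  (hCwp : completed_algebraic_closure vwp (range (iota \o iK)))
  (hvwp : extends_adic_valuation wp (iota \o iK) vwp)
  (hred : is_residue_map wp red)
  (hteich : is_residue_section iK iota vwp red teich)
  (k : nat) (k_ge2 : (2 <= k)%N)
  (chi : {unit kappa} -> {unit kappa})
  (chiM : {morph chi : x y / (x * y)%g}) :
  let Sk r := cuspforms (j \o iK) vinf k (Gamma1p n wp r) in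
  let U r := hecke_U (j \o iK) k (Gamma1p n wp r) wp in
  let Schi r := diamond_eigenspace iK j iota vwp n wp r teich k (Sk r) chi in
  let slope := fun l : Kbar => vwp (iota l) in
  (exists d : nat, forall r : nat, (1 <= r)%N ->
     slope_dimension j slope (Sk r) (U r) 0%E d) /\
  (exists d : nat, forall r : nat, (1 <= r)%N ->
     slope_dimension j slope (Schi r) (U r) 0%E d).
Proof.
have [vw _ _ _] := hCwp.
move=> Sk U Schi slope.
have slope_neq0 l : slope l = 0%E -> l != 0.
  by move=> s0; apply/negP => /eqP l0; move: s0; rewrite /slope l0 rmorph0 (v0 vw).
split.
  have [//|//|//|d hd] := slope_level (emb := j \o iK) hCinf hvinf n_neq0 wp_irr (k := k) (P := fun=> setT) j slope_neq0.
  by exists d => r /hd; rewrite setIT.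
(* [Schi r] is by definition the intersection of [Sk r] with this set. *)
apply: (slope_level (emb := j \o iK) hCinf hvinf n_neq0 wp_irr (k := k) j slope_neq0
  (P := fun r => [set f | forall l, diamond iK j iota vwp n wp r teich k l f =
    (fun z => j (teich (val (chi l))) * f z)])).
- move=> r f r1 If; have E l := diamond_level vw hvwp wp_irr n_coprime hteich l hCinf r1 If.
  by split=> h l; [rewrite -E|rewrite E].
- move=> c f g hf hg l; rewrite /diamond.
  rewrite (slashZD (j \o iK)) -/(diamond _ _ _ _ _ _ _ _ _ _ _) ; apply/funext => z.
  have /= := congr1 (fun u => u z) (hf l); have /= := congr1 (fun u => u z) (hg l).
  by rewrite /diamond => -> ->; ring.
move=> l; apply/funext => z.
by rewrite /diamond slashE !mulr0.
Qed.
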